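(* Let $n\ge2$, $0<\alpha<n$, $1\le p<n/\alpha$, $1/q=1/p-\alpha/n$, with $1\le s<p$ if $1<p<n/\alpha$ and $s=1$ if $p=1$. Let $w_1,w_2$ be weights on $\mathbb{R}^n$ with $(w_1^s,w_2^s)\in A_{p/s,q/s}$ and $w_2^s\in A_{p/s,q/s}$. Let $1<p_0<\infty$, $T>0$, $\psi:\mathbb{R}^n\times\mathbb{R}^+\to\mathbb{R}^+$, and let $w$ be a weight on $\mathbb{R}^n$. Let $\Omega\in L^{s'}(\mathbb{S}^{n-1})$ be homogeneous of degree zero, where $1/s+1/s'=1$, and let $$S_{\Omega,\alpha}(f)(x)=\int_{\mathbb{R}^n}\frac{\Omega(y)}{|y|^{n-\alpha}}f(x-y)\,dy .$$ Let $\psi_1,\psi_2$ be positive functions on $\mathbb{R}^n\times\mathbb{R}^+$. (1) Suppose $$\sup_{(a,r)\in\mathbb{R}^n\times\mathbb{R}^+}\frac1{\psi_2(a,r)}\int_r^\infty\frac{\inf_{t\le l<\infty}\psi_1(a,l)\,w_1^p(B(a,l))^{1/p}}{w_2^q(B(a,t))^{1/q}}\frac{dt}t<\infty .$$ If $1<p<n/\alpha$ and $S_{\Omega,\alpha}$ is bounded from $L^{p,w_1^p}$ to $L^{q,w_2^q}$, then $S_{\Omega,\alpha}$ is bounded from $\mathcal{M}_\psi^{p_0,w}(0,T,\mathcal{M}^{p,w_1^p}_{\psi_1})$ to $\mathcal{M}_\psi^{p_0,w}(0,T,\mathcal{M}^{q,w_2^q}_{\psi_2})$; if $p=1$ and $S_{\Omega,\alpha}$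 is bounded from $L^{1,w_1}$ to $WL^{q,w_2^q}$, then $S_{\Omega,\alpha}$ is bounded from $\mathcal{M}_\psi^{p_0,w}(0,T,\mathcal{M}^{1,w_1}_{\psi_1})$ to $\mathcal{M}_\psi^{p_0,w}(0,T,W\mathcal{M}^{q,w_2^q}_{\psi_2})$. (2) Suppose $1<p<n/\alpha$, $w_1\in A_\infty$ and $$\sup_{(a,r)\in\mathbb{R}^n\times\mathbb{R}^+}\frac1{\psi_2(a,r)}\int_r^\infty\left(1+\ln\frac tr\right)\frac{\inf_{t\le l<\infty}\psi_1(a,l)\,w_1^p(B(a,l))^{1/p}}{w_2^q(B(a,t))^{1/q}}\frac{dt}t<\infty .$$ If $b\in BMO$ and $[b,S_{\Omega,\alpha}]$ is bounded from $L^{p,w_1^p}$ to $L^{q,w_2^q}$, then $[b,S_{\Omega,\alpha}]$ is bounded from $\mathcal{M}_\psi^{p_0,w}(0,T,\mathcal{M}^{p,w_1^p}_{\psi_1})$ to $\mathcal{M}_\psi^{p_0,w}(0,T,\mathcal{M}^{q,w_2^q}_{\psi_2})$.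
   Context: Notation: $\mathbb{R}^+=(0,\infty)$; $B(a,r)$ is the open ball in $\mathbb{R}^n$; $\mathbb{S}^{n-1}$ is the unit sphere with normalized Lebesgue measure; $s'=\infty$ when $s=1$. A weight is a nonnegative locally integrable function on $\mathbb{R}^n$ with values in $(0,\infty)$ a.e.; $w(E)=\int_E w(x)\,dx$ and $w^p(E)=\int_E w(x)^p\,dx$. Weight classes: for $1<p<q<\infty$ and $1/p+1/p'=1$, $(w_1,w_2)\in A_{p,q}$ if there is $C>0$ with $\left(\frac1{|B|}\int_B w_2^q\right)^{1/q}\left(\frac1{|B|}\int_B w_1^{-p'}\right)^{1/p'}\le C$ for all balls $B$; for $p=1<q$, $(w_1,w_2)\in A_{1,q}$ if $\left(\frac1{|B|}\int_B w_2^q\right)^{1/q}\|w_1^{-1}\|_{L^\infty(B)}\le C$ for all balls $B$; $w\in A_{p,q}$ means $(w,w)\in A_{p,q}$. $A_\infty=\bigcup_{p\ge1}A_p$ with $A_p$ the usual Muckenhoupt classes. Spaces: $\|f\|_{L^{p,w}(E)}=\left(\int_E|f|^pw\right)^{1/p}$ and $\|f\|_{WL^{p,w}(E)}=\sup_{\gamma>0}\gamma\,w(\{x\in E:|f(x)|>\gamma\})^{1/p}$; $L^{p,w}$, $WL^{p,w}$ denote the case $E=\mathbb{R}^n$. For positive $\psi$ on $\mathbb{R}^n\times\mathbb{R}^+$, $\mathcal{M}^{p,w}_\psi$ and $W\mathcal{M}^{p,w}_\psi$ consist of the measurable $f$ for which respectively $\|f\|_{\mathcal{M}^{p,w}_\psi}=\sup_{a,r}\frac{1}{\psi(a,r)}w(B(a,r))^{-1/p}\|f\|_{L^{p,w}(B(a,r))}$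 and $\|f\|_{W\mathcal{M}^{p,w}_\psi}=\sup_{a,r}\frac{1}{\psi(a,r)}w(B(a,r))^{-1/p}\|f\|_{WL^{p,w}(B(a,r))}$ is finite. For $X$ one of these spaces, $\mathcal{M}^{p_0,w}_\psi(0,T,X)$ is the set of functions $f$ on $\mathbb{R}^n\times(0,T)$ with $$\|f\|_{\mathcal{M}^{p_0,w}_\psi(0,T,X)}=\sup_{a\in\mathbb{R}^n,\,r>0,\,t_0\in(0,T)}\frac1{\psi(a,r)}\frac1{w(B(a,r))^{1/p_0}}\left(\int_{(0,T)\cap(t_0-r,t_0+r)}\|f(\cdot,t)\|_X^{p_0}\,dt\right)^{1/p_0}<\infty .$$ Operators act on functions of $(x,t)$ by acting on $f(\cdot,t)$ for each $t$. $[b,N](f)=bN(f)-N(bf)$; $BMO$ has seminorm $\|b\|_*=\sup_B\frac1{|B|}\int_B|b-b_B|$, $b_B=\frac1{|B|}\int_Bb$. An operator $N$ is bounded from $X$ to $Y$ if $\|Nf\|_Y\le C\|f\|_X$ for all $f\in X$; for a commutator $[b,N]$ the constant is required to have the form $C\|b\|_*$. *)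

(* Defs.v *)
From HB Require Import structures.
From mathcomp Require Import all_boot all_order all_algebra.
From mathcomp Require Import all_classical all_reals all_analysis measurable_realfun.

Set Implicit Arguments.
Unset Strict Implicit.
Unset Printing Implicit Defensive.

Import Order.TTheory GRing.Theory Num.Theory.
Import numFieldNormedType.Exports.

Local Open Scope classical_set_scope.
Local Open Scope ring_scope.

Definition measure_rV_display : measure_display.
Proof. exact: default_measure_display. Qed.

(* The sigma-algebra of R^n is the one generated by the coordinates, that is,
   the Borel sigma-algebra; the construction mirrors that of n.-tuple. *)
Section measurable_rV.
Context {R : realType}.
Variable n : nat.

Let coors : 'I_n -> 'rV[R]_n -> R := fun i x => x ord0 i.

Let rV_set0 : g_sigma_preimage coors set0.
Proof. exact: sigma_algebra0. Qed.

Let rV_setC A : g_sigma_preimage coors A -> g_sigma_preimage coors (~` A).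
Proof. exact: sigma_algebraC. Qed.

Let rV_bigcup (F : _^nat) : (forall i, g_sigma_preimage coors (F i)) ->
  g_sigma_preimage coors (\bigcup_i (F i)).
Proof. exact: sigma_algebra_bigcup. Qed.

HB.instance Definition _ := @isMeasurable.Build measure_rV_display
  'rV[R]_n (g_sigma_preimage coors) rV_set0 rV_setC rV_bigcup.

End measurable_rV.

Section rV_measurability.
Context {R : realType}.

Lemma measurable_coord n (i : 'I_n) :
  measurable_fun [set: 'rV[R]_n] (fun x : 'rV[R]_n => x ord0 i).
Proof.
move=> _ Y mY; rewrite setTI; apply: sub_sigma_algebra => /=.
rewrite -bigcup_seq/=; exists i => /=; first by rewrite mem_index_enum.
by exists Y => //; rewrite setTI.
Qed.

Lemma measurable_fun_rVP d (T : measurableType d) n (f : T -> 'rV[R]_n) :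
  (forall i, measurable_fun setT (fun x => f x ord0 i)) ->
  measurable_fun setT f.
Proof.
move=> mf.
suff H : preimage_set_system setT f (@measurable _ 'rV[R]_n) `<=` @measurable _ T.
  by move=> _ A mA; apply: H; exists A.
rewrite [X in preimage_set_system _ _ X](_ : _ =
  g_sigma_preimage (fun (i : 'I_n) (x : 'rV[R]_n) => x ord0 i))//.
rewrite -g_sigma_preimage_comp.
apply: smallest_sub; first exact: sigma_algebra_measurable.
rewrite -bigcup_seq; apply: bigcup_sub => i _ A [B mB <-].
exact: mf.
Qed.

Definition enorm n (x : 'rV[R]_n) : R := Num.sqrt (\sum_i x ord0 i ^+ 2).

(* Not the library's [ball], which on 'rV is a cube (sup norm). *)
Definition eball n (a : 'rV[R]_n) (r : R) : set 'rV[R]_n :=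
  [set x | enorm (x - a) < r].

Lemma measurable_enorm n : measurable_fun [set: 'rV[R]_n] (@enorm n).
Proof.
rewrite (_ : @enorm n = fun x => (\sum_i x ord0 i ^+ 2) `^ 2^-1); last first.
  by apply/funext => x; rewrite powR12_sqrt// sumr_ge0// => i _; rewrite sqr_ge0.
apply: (measurableT_comp (measurable_powR _)).
by apply: measurable_sum => i; apply: measurable_funX; exact: measurable_coord.
Qed.

Lemma measurable_eball n (a : 'rV[R]_n) r : measurable (eball a r).
Proof.
have mf : measurable_fun setT (fun x : 'rV[R]_n => enorm (x - a)).
  apply: (measurableT_comp (@measurable_enorm n)).
  apply: measurable_fun_rVP => i.
  under eq_fun do rewrite !mxE.
  by apply: measurable_funB => //; exact: measurable_coord.
rewrite (_ : eball a r = (fun x => enorm (x - a)) @^-1` `]-oo, r[).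
  by rewrite -[X in measurable X]setTI; exact: mf.
by apply/seteqP; split => x /=; rewrite /eball/= in_itv.
Qed.

(* Radial projection onto the unit sphere (0 is sent to 0). *)
Definition edir n (x : 'rV[R]_n) : 'rV[R]_n := (enorm x)^-1 *: x.

Lemma measurable_edir n : measurable_fun [set: 'rV[R]_n] (@edir n).
Proof.
apply: measurable_fun_rVP => i; under eq_fun do rewrite mxE.
apply: measurable_funM; last exact: measurable_coord.
rewrite (_ : (fun x => _) = fun x : 'rV[R]_n => enorm x `^ (-1)); last first.
  by apply/funext => x; rewrite powR_inv1// /enorm sqrtr_ge0.
exact: (measurableT_comp (measurable_powR _) (@measurable_enorm n)).
Qed.

Definition rV_cons n (p : R * 'rV[R]_n) : 'rV[R]_n.+1 :=
  \row_(i < n.+1) (if unlift ord0 i is Some j then p.2 ord0 j else p.1).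

Lemma measurable_rV_cons n : measurable_fun setT (@rV_cons n).
Proof.
apply: measurable_fun_rVP => i; under eq_fun do rewrite mxE.
case: unliftP => [j _|_].
  exact: (measurableT_comp (measurable_coord j) measurable_snd).
exact: measurable_fst.
Qed.

Definition rV_uncons n (x : 'rV[R]_n.+1) : R * 'rV[R]_n :=
  (x ord0 ord0, \row_j x ord0 (lift ord0 j)).

Lemma measurable_rV_uncons n : measurable_fun setT (@rV_uncons n).
Proof.
apply: measurable_fun_pair; first exact: measurable_coord.
apply: measurable_fun_rVP => i; under eq_fun do rewrite mxE.
exact: measurable_coord.
Qed.

Lemma rV_consK n : cancel (@rV_cons n) (@rV_uncons n).
Proof.
move=> [a x]; rewrite /rV_uncons /rV_cons mxE unlift_none/=; congr pair.
by apply/rowP => j; rewrite !mxE liftK.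
Qed.

End rV_measurability.

Section lebesgue_rV.
Context {R : realType}.
Local Open Scope ereal_scope.

Section step.
Variables (n : nat) (mu : {sigma_finite_measure set 'rV[R]_n -> \bar R}).

Definition lebesgue_rV_step : set 'rV[R]_n.+1 -> \bar R :=
  pushforward (@lebesgue_measure R \x mu) (@rV_cons R n).

Let pushm := measure_function_pushforward__canonical__measure_function_Measure
  (@lebesgue_measure R \x mu) (@measurable_rV_cons R n).

HB.instance Definition _ := isMeasure.Build _ _ _ lebesgue_rV_step
  (@measure0 _ _ _ pushm) (@measure_ge0 _ _ _ pushm)
  (@measure_semi_sigma_additive _ _ _ pushm).

Let lebesgue_rV_step_sigma_finite : sigma_finite setT lebesgue_rV_step.
Proof.
have /sigma_finiteP[F [TF ndF Foo]] := sigma_finiteT (@lebesgue_measure R).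
have /sigma_finiteP[G [TG ndG Goo]] := sigma_finiteT mu.
exists (fun k => @rV_uncons R n @^-1` (F k `*` G k)).
  apply/seteqP; split => // x _.
  have [k _ Fk] : (\bigcup_i F i) (rV_uncons x).1 by rewrite -TF.
  have [l _ Gl] : (\bigcup_i G i) (rV_uncons x).2 by rewrite -TG.
  exists (maxn k l) => //; split.
    by move: Fk; exact/subsetPset/ndF/leq_maxl.
  by move: Gl; exact/subsetPset/ndG/leq_maxr.
move=> k; have [mF Fk] := Foo k; have [mG Gk] := Goo k; split.
  rewrite -[X in measurable X]setTI; apply: measurable_rV_uncons => //.
  exact: measurableX.
rewrite /lebesgue_rV_step /pushforward -comp_preimage.
rewrite (_ : _ \o _ = id); last by apply/funext => x /=; rewrite rV_consK.
by rewrite preimage_id product_measure1E// lte_mul_pinfty// ge0_fin_numE.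
Qed.

HB.instance Definition _ := Measure_isSigmaFinite.Build _ _ _ lebesgue_rV_step
  lebesgue_rV_step_sigma_finite.

End step.

(* Lebesgue measure on R^n, as the n-fold product of the one on R. *)
Fixpoint lebesgue_rV n : {sigma_finite_measure set 'rV[R]_n -> \bar R} :=
  if n is n'.+1 then lebesgue_rV_step (lebesgue_rV n') else \d_(0%R : 'rV[R]_0).

Lemma lebesgue_rV_box n (a b : 'I_n -> R) : (forall i, a i <= b i)%R ->
  lebesgue_rV n [set x : 'rV[R]_n | forall i, x ord0 i \in `[a i, b i]] =
  (\prod_(i < n) (b i - a i))%:E.
Proof.
elim: n a b => [|n IHn] a b ab.
  rewrite big_ord0 /= diracE (_ : _ \in _ = true)//.
  by apply/mem_set => -[].
rewrite big_ord_recl /= /lebesgue_rV_step /pushforward.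
rewrite (_ : _ @^-1` _ = `[a ord0, b ord0] `*`
  [set x : 'rV[R]_n | forall i, x ord0 i \in `[a (lift ord0 i), b (lift ord0 i)]]);
  last first.
  apply/seteqP; split => -[u x]/=.
    move=> H; split => [|i].
      by have := H ord0; rewrite mxE unlift_none.
    by have := H (lift ord0 i); rewrite mxE liftK.
  move=> [H0 H] i; rewrite mxE.
  by case: unliftP => [j ->|->].
rewrite product_measure1E//; last first.
  rewrite (_ : [set _ | _] = \bigcap_(i in [set: 'I_n])
    ((fun x : 'rV[R]_n => x ord0 i) @^-1` `[a (lift ord0 i), b (lift ord0 i)])).
    apply: fin_bigcap_measurable => // i _.
    rewrite -[X in measurable X]setTI; apply: measurable_coord => //.
  apply/seteqP; split => x /= H i; first by move=> _; exact: H.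
  exact: H.
rewrite IHn// EFinM; congr (_ * _).
transitivity (@lebesgue_measure R `[a ord0, b ord0]) => //.
rewrite lebesgue_measure_itv/= lte_fin.
case: ltP (ab ord0) => [_ _|ba ab0]; first by rewrite -EFinD.
by congr (_%:E); apply/esym/eqP; rewrite subr_eq0 eq_le ba ab0.
Qed.

Section sphere.
Variable n : nat.
Let B := @eball R n 0%R 1%R.
Let mB : measurable B := measurable_eball _ _.
Let muB : {measure set 'rV[R]_n -> \bar R} := mrestr (lebesgue_rV n) mB.
Let pushm := measure_function_pushforward__canonical__measure_function_Measure
  muB (@measurable_edir R n).

Let c_ge0 : (0 <= (fine (lebesgue_rV n B))^-1)%R.
Proof. by rewrite invr_ge0 fine_ge0. Qed.

(* Normalized surface measure of the unit sphere, in polar coordinates: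
   sphere_measure E = |{ x \in B(0,1) : x/|x| \in E }| / |B(0,1)|.
   It is a probability measure on R^n carried by the unit sphere. *)
Definition sphere_measure : set 'rV[R]_n -> \bar R := mscale (NngNum c_ge0) pushm.

HB.instance Definition _ := Measure.on sphere_measure.

End sphere.

End lebesgue_rV.
Arguments lebesgue_rV {R n}.
Arguments sphere_measure {R n}.

Section weights.
Context {R : realType} {n : nat}.
Local Open Scope ereal_scope.
Local Notation leb := (@lebesgue_rV R n).
Implicit Types (w b : 'rV[R]_n -> R) (p q : R) (a : 'rV[R]_n) (r : R).

Definition loc_integrable (g : 'rV[R]_n -> R) :=
  measurable_fun setT g /\
  forall a r, (0 < r)%R -> leb.-integrable (eball a r) (EFin \o g).

Definition weight w :=
  [/\ forall x, (0 <= w x)%R, {ae leb, forall x, (0 < w x)%R} &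
      loc_integrable w].

Definition wpow w p : 'rV[R]_n -> R := fun x => (w x `^ p)%R.

Definition wmeas w (E : set 'rV[R]_n) : \bar R := \int[leb]_(x in E) (w x)%:E.

Definition avg a r (g : 'rV[R]_n -> \bar R) : \bar R :=
  (leb (eball a r))^-1 * \int[leb]_(x in eball a r) g x.

(* || w^{-1} ||_{L^oo(B(a,r))}; extending by 0 off the ball does not change it. *)
Definition inv_linfty w a r : \bar R :=
  Lnorm leb +oo ((fun x => ((w x)^-1)%:E) \_ (eball a r)).

(* Two-weight class A_{p,q}, meaningful for 1 <= p < q. *)
Definition Apq p q (w1 w2 : 'rV[R]_n -> R) : Prop :=
  exists2 C : R, (0 < C)%R & forall a r, (0 < r)%R ->
    let W2 := (avg a r (EFin \o wpow w2 q)) `^ q^-1 in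
    if p == 1%R then W2 * inv_linfty w1 a r <= C%:E
    else let p' := (p / (p - 1))%R in
      W2 * (avg a r (EFin \o wpow w1 (- p'))) `^ p'^-1 <= C%:E.

(* The exponent 1 - p' of the classical A_p condition is -1/(p-1). *)
Definition muckenhoupt p w : Prop :=
  weight w /\
  exists2 C : R, (0 < C)%R & forall a r, (0 < r)%R ->
    if p == 1%R then avg a r (EFin \o w) * inv_linfty w a r <= C%:E
    else avg a r (EFin \o w) *
           (avg a r (EFin \o wpow w (- (p - 1)^-1))) `^ (p - 1) <= C%:E.

Definition muckenhoupt_infty w : Prop :=
  exists2 p : R, (1 <= p)%R & muckenhoupt p w.

Definition bmo_seminorm b : \bar R :=
  ereal_sup [set avg c.1 c.2
      (fun x => (`|b x - fine (avg c.1 c.2 (EFin \o b))|%R)%:E)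
    | c in [set c : 'rV[R]_n * R | (0 < c.2)%R]].

Definition BMO b : Prop := loc_integrable b /\ bmo_seminorm b < +oo.

End weights.

(* A function space on U: its elements and its norm. Elements may take infinite
   values, so that divergent integrals are not silently given a finite value. *)
Record fspace (R : realType) (U : Type) := FSpace {
  fmem : (U -> \bar R) -> Prop ;
  fnorm : (U -> \bar R) -> \bar R }.

Section spaces.
Context {R : realType} {n : nat}.
Local Open Scope ereal_scope.
Local Notation leb := (@lebesgue_rV R n).
Implicit Types (w : 'rV[R]_n -> R) (p : R) (psi : 'rV[R]_n -> R -> R).

Definition wLnorm p w (E : set 'rV[R]_n) (f : 'rV[R]_n -> \bar R) : \bar R :=
  (\int[leb]_(x in E) (`|f x| `^ p * (w x)%:E)) `^ p^-1.

Definition wWLnorm p w (E : set 'rV[R]_n) (f : 'rV[R]_n -> \bar R) : \bar R :=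
  ereal_sup [set g%:E * (wmeas w (E `&` [set x | g%:E < `|f x|])) `^ p^-1
    | g in [set g : R | (0 < g)%R]].

Definition normed_space (N : ('rV[R]_n -> \bar R) -> \bar R) :
    fspace R 'rV[R]_n :=
  FSpace (fun f => measurable_fun setT f /\ N f < +oo) N.

Definition wLspace p w := normed_space (wLnorm p w setT).

Definition wWLspace p w := normed_space (wWLnorm p w setT).

(* If w(B) = +oo the factor w(B)^{-1/p} is 0. *)
Definition morrey_norm (N : set 'rV[R]_n -> ('rV[R]_n -> \bar R) -> \bar R)
    p w psi (f : 'rV[R]_n -> \bar R) : \bar R :=
  ereal_sup [set ((psi c.1 c.2)^-1)%:E *
      ((wmeas w (eball c.1 c.2)) `^ p^-1)^-1 * N (eball c.1 c.2) f
    | c in [set c : 'rV[R]_n * R | (0 < c.2)%R]].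

Definition Morrey p w psi := normed_space (morrey_norm (wLnorm p w) p w psi).

Definition WMorrey p w psi := normed_space (morrey_norm (wWLnorm p w) p w psi).

(* M^{p0,w}_psi(0,T,X). The functions are total on R^n x R; only their values
   on R^n x (0,T) matter. For arbitrary psi and X the map t |-> ||f(.,t)||_X
   may fail to be measurable; the integral of the library is then the lower
   integral. *)
Definition time_dom (T : R) : set ('rV[R]_n * R) := setT `*` `]0%R, T[.

Definition time_morrey_norm p0 w psi (T : R) (X : fspace R 'rV[R]_n)
    (f : 'rV[R]_n * R -> \bar R) : \bar R :=
  ereal_sup [set ((psi c.1.1 c.1.2)^-1)%:E *
      ((wmeas w (eball c.1.1 c.1.2)) `^ p0^-1)^-1 *
      (\int[@lebesgue_measure R]_(t in
           `]0%R, T[ `&` `](c.2 - c.1.2)%R, (c.2 + c.1.2)%R[)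
         (fnorm X (fun x => f (x, t))) `^ p0) `^ p0^-1
    | c in [set c : 'rV[R]_n * R * R | (0 < c.1.2)%R /\ (0 < c.2 < T)%R]].

Definition TimeMorrey p0 w psi T X : fspace R ('rV[R]_n * R) :=
  FSpace
    (fun f => measurable_fun (time_dom T) f /\
              time_morrey_norm p0 w psi T X f < +oo)
    (time_morrey_norm p0 w psi T X).

End spaces.

Section operators.
Context {R : realType} {n : nat}.
Local Open Scope ereal_scope.

Definition operator (U : Type) := (U -> R) -> U -> \bar R.

(* fmem Y (N f) also asserts that N f is measurable. *)
Definition bounded_by (U : Type) (K : \bar R) (X Y : fspace R U)
    (N : operator U) : Prop :=
  forall f : U -> R, fmem X (EFin \o f) ->
    fmem Y (N f) /\ fnorm Y (N f) <= K * fnorm X (EFin \o f).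

Definition bounded_op (U : Type) (X Y : fspace R U) (N : operator U) : Prop :=
  exists2 C : R, (0 < C)%R & bounded_by C%:E X Y N.

Definition bounded_comm (U : Type) (b : 'rV[R]_n -> R) (X Y : fspace R U)
    (N : operator U) : Prop :=
  exists2 C : R, (0 < C)%R & bounded_by (C%:E * bmo_seminorm b) X Y N.

Definition in_time (N : operator 'rV[R]_n) : operator ('rV[R]_n * R) :=
  fun f z => N (fun x => f (x, z.2)) z.1.

Definition homogeneous0 (Omega : 'rV[R]_n -> R) : Prop :=
  forall (l : R) x, (0 < l)%R -> Omega (l *: x) = Omega x.

(* The value is +oo or -oo where the integral diverges (+oo - oo is -oo), so a
   finite norm of the image forces absolute convergence almost everywhere. *)
Definition frac_op (Omega : 'rV[R]_n -> R) (alpha : R) : operator 'rV[R]_n :=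
  fun f x => \int[@lebesgue_rV R n]_y
    (Omega y / enorm y `^ (n%:R - alpha) * f (x - y))%:E.

Definition commutator (b : 'rV[R]_n -> R) (N : operator 'rV[R]_n) :
    operator 'rV[R]_n :=
  fun f x => (b x)%:E * N f x - N (b \* f)%R x.

Definition growth (p q : R) (w1 w2 : 'rV[R]_n -> R) (psi1 : 'rV[R]_n -> R -> R)
    (a : 'rV[R]_n) (t : R) : \bar R :=
  ereal_inf [set (psi1 a l)%:E * (wmeas (wpow w1 p) (eball a l)) `^ p^-1
    | l in [set l : R | (t <= l)%R]] /
  (wmeas (wpow w2 q) (eball a t)) `^ q^-1.

Definition psi_condition (k : R -> R -> R) (p q : R) (w1 w2 : 'rV[R]_n -> R)
    (psi1 psi2 : 'rV[R]_n -> R -> R) : Prop :=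
  ereal_sup [set ((psi2 c.1 c.2)^-1)%:E *
      \int[@lebesgue_measure R]_(t in `]c.2, +oo[)
        ((k c.2 t)%:E * growth p q w1 w2 psi1 c.1 t * (t^-1)%:E)
    | c in [set c : 'rV[R]_n * R | (0 < c.2)%R]] < +oo.

End operators.

(* Main.v *)
From HB Require Import structures.
From mathcomp Require Import all_boot all_order all_algebra.
From mathcomp Require Import all_classical all_reals all_analysis measurable_realfun.
From mathcomp Require Import ess_sup_inf ring lra.
Require Import Defs.

(** The time variable is harmless: the operators act on each time slice, so a
    bound [fnorm Y (N g) <= C * M] for functions g of space with
    [fnorm X g <= M] integrates to a bound between the spaces over (0,T)
    ([time_morrey_lift]); only the joint measurability of the image needs an
    argument, which is Tonelli's theorem. What remains is a local estimate on a
    ball B = B(a,r) for f in a weighted Morrey space.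

    Split f into its restriction f1 to 2B and the rest. The assumed boundedness
    on Lebesgue spaces handles f1. For x in B the far part is cut along the
    dyadic annuli around a, where the kernel is of size |x - y|^(alpha - n), so
    everything reduces to one estimate on a ball of radius t:

       w2^q(B_t)^(1/q) int_{B_t} |Omega(x - y)| |f(y)| dy
            <= C t^(n - alpha) ||f||_{L^p(w1^p)(B_t)}.

    It follows from Hoelder's inequality with the exponents s', p and sigma,
    1/sigma = 1/s - 1/p ([kernel_ball_estimate], and [kernel_ball_estimate1]
    for p = 1). The factor |Omega| contributes t^(n/s') by homogeneity
    ([omega_hoelder]), and the last factor w1^(-sigma)(B_t)^(1/sigma) is
    controlled by the A_{p/s,q/s} condition. Summing over annuli gives

       |S f(x)| <= |S f1(x)| + C sum_k A_k,
       A_k = ||f||_{L^p(w1^p)(B(a, 2^k r))} / w2^q(B(a, 2^k r))^(1/q),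

    pointwise on B ([frac_op_local], [far_bound]), and the integral condition
    on psi1 and psi2 is exactly what bounds sum_k A_k by a multiple of
    psi2(a,r), after comparison of the integral with a dyadic sum
    ([psi_series]); this uses that w2^q is doubling.

    For the commutator, |b(x) - b(y)| is compared with the averages of b: the
    averages over B(a, 2^k r) and over B differ by at most C k ||b||_*
    ([favg_dilate]), which is absorbed by the logarithm in the integral
    condition. The deviations of b from its averages have to be integrated
    against powers of w2, both against w2^q on B and against w2^(-sigma) in
    Hoelder's inequality. This is a weighted John-Nirenberg inequality
    ([weighted_john_nirenberg], [weighted_bmo]), proved on dyadic cubes for
    every weight that gives a fixed share of the weight of a ball to each
    subset of at least a fixed share of its volume ([fair_weight]). By
    [fair_pair] the condition w2^s in A_{p/s,q/s} makes both powers of w2 fair.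
    Hoelder's inequality produces w1^(-sigma) instead of w2^(-sigma), but the
    two-weight condition forces w2 <= M w1 almost everywhere
    ([ae_le_of_pair]). *)


Set Implicit Arguments.
Unset Strict Implicit.
Unset Printing Implicit Defensive.

Import Order.TTheory GRing.Theory Num.Theory.
Import numFieldNormedType.Exports.

Local Open Scope classical_set_scope.
Local Open Scope ring_scope.

(** * Affine changes of variables in R^n *)

Section affine.
Context {R : realType}.
Local Open Scope ereal_scope.

Lemma lebesgue_measure_affine (c l : R) (A : set (measurableTypeR R)) :
  l != 0%R -> measurable A ->
  `|l|%:E * lebesgue_measure ((fun x => c + l * x)%R @^-1` A) = lebesgue_measure A.
Proof.
move=> l0 mA.
have [labs] : {k : {nonneg R} | k%:num = `|l|}%R by exists (NngNum (normr_ge0 l)).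
move=> labsE.
have mh : measurable_fun [set: measurableTypeR R]
    ((fun x => c + l * x)%R : measurableTypeR R -> measurableTypeR R).
  by apply: measurable_funD => //; exact: measurable_funM.
pose pm := measure_function_pushforward__canonical__measure_function_Measure
  (@lebesgue_measure R) mh.
transitivity (mscale labs pm A); first by rewrite -labsE.
apply/esym; apply: (@lebesgue_measure_unique R (mscale labs pm)) => //.
move=> _ [[a b]] _ <-.
transitivity (`|l|%:E * lebesgue_measure ((fun x => c + l * x)%R @^-1` `]a, b]));
  last by rewrite -labsE.
have [l_lt0|l_gt0] := ltP l 0%R.
  rewrite (_ : _ @^-1` _ = `[(b - c) / l, (a - c) / l[%classic)%R; last first.
    apply/seteqP; split => x /=; rewrite !in_itv/= => /andP[].
      by rewrite ler_ndivrMr// ltr_ndivlMr// => ? ?; apply/andP; split; lra.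
    by rewrite ler_ndivrMr// ltr_ndivlMr// => ? ?; apply/andP; split; lra.
  rewrite [in RHS]lebesgue_measure_itv/= lebesgue_measure_itv/= !lte_fin ltr_nM2r ?invr_lt0// ltrD2r.
  case: ifPn => _; last by rewrite mule0.
  rewrite -!EFinD -EFinM ltr0_norm//; congr EFin; field.
  by rewrite lt_eqF.
have {}l_gt0 : (0 < l)%R by rewrite lt_neqAle eq_sym l0.
rewrite (_ : _ @^-1` _ = `](a - c) / l, (b - c) / l]%classic)%R; last first.
  apply/seteqP; split => x /=; rewrite !in_itv/= => /andP[].
    by rewrite ltr_pdivrMr// ler_pdivlMr// => ? ?; apply/andP; split; lra.
  by rewrite ltr_pdivrMr// ler_pdivlMr// => ? ?; apply/andP; split; lra.
rewrite !lebesgue_measure_itv/= !lte_fin ltr_pM2r ?invr_gt0// ltrD2r.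
case: ifPn => _; last by rewrite mule0.
rewrite -!EFinD -EFinM gtr0_norm//; congr EFin; field.
by rewrite gt_eqF.
Qed.

Lemma measurable_affine n (c : 'rV[R]_n) (l : R) :
  measurable_fun [set: 'rV[R]_n] (fun x => c + l *: x)%R.
Proof.
apply: measurable_fun_rVP => i; under eq_fun do rewrite !mxE.
by apply: measurable_funD => //; apply: measurable_funM => //; exact: measurable_coord.
Qed.

(** Both sides are measures on R x R^n that agree on rectangles, by the case of
    dimension one and by induction; a product measure is determined by its
    values on rectangles. *)
Lemma lebesgue_rV_affine n (c : 'rV[R]_n) (l : R) (A : set 'rV[R]_n) :
  l != 0%R -> measurable A ->
  (`|l| ^+ n)%:E * lebesgue_rV ((fun x => c + l *: x)%R @^-1` A) = lebesgue_rV A.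
Proof.
move=> l0; elim: n c A => [|n IH] c A mA.
  rewrite expr0 mul1e; congr (lebesgue_rV _).
  by apply/seteqP; split => x /=; rewrite (_ : _ + _ = x)%R//; apply/rowP => -[].
rewrite /= /lebesgue_rV_step.
have [k kE] : {k : {nonneg R} | k%:num = `|l| ^+ n.+1}%R.
  by exists (NngNum (exprn_ge0 n.+1 (normr_ge0 l))).
pose c' : 'rV[R]_n := (\row_j c ord0 (lift ord0 j))%R.
pose h (z : measurableTypeR R * 'rV[R]_n) : measurableTypeR R * 'rV[R]_n :=
  (c ord0 ord0 + l * z.1, c' + l *: z.2)%R.
have mh : measurable_fun [set: measurableTypeR R * 'rV[R]_n] h.
  apply: measurable_fun_pair.
    by apply: measurable_funD => //; apply: measurable_funM => //.
  exact: (measurableT_comp (measurable_affine _ _)).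
pose pm := measure_function_pushforward__canonical__measure_function_Measure
  (@lebesgue_measure R \x @lebesgue_rV R n) mh.
rewrite /pushforward.
have := @product_measure_unique _ _ _ _ R (@lebesgue_measure R) (@lebesgue_rV R n) (mscale k pm).
move=> /(_ _ (@rV_cons R n @^-1` A)) ->.
- transitivity ((`|l| ^+ n.+1)%:E *
    (lebesgue_measure \x lebesgue_rV) (h @^-1` (@rV_cons R n @^-1` A))); last by rewrite -kE.
  congr (_ * (_ \x _) _).
  have rVh z : rV_cons (h z) = (c + l *: rV_cons z)%R.
    apply/rowP => i; rewrite !mxE/=.
    by case: unliftP => [j ->|->]; rewrite ?mxE.
  by apply/seteqP; split => z; rewrite /preimage/= rVh.
- move=> B C mB mC; transitivity ((`|l| ^+ n.+1)%:E *
    (lebesgue_measure \x lebesgue_rV) (h @^-1` (B `*` C))); first by rewrite -kE.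
  rewrite (_ : h @^-1` _ = ((fun x => c ord0 ord0 + l * x)%R @^-1` B) `*`
     ((fun x => c' + l *: x)%R @^-1` C))//.
  rewrite product_measure1E.
  + rewrite exprS EFinM muleACA; congr (_ * _); first exact: lebesgue_measure_affine.
    exact: IH.
  + by rewrite -[X in measurable X]setTI; apply: measurable_funD => //; apply: measurable_funM.
  + by rewrite -[X in measurable X]setTI; exact: measurable_affine.
- by rewrite -[X in measurable X]setTI; exact: measurable_rV_cons.
Qed.

Lemma integral_rV_affine n (c : 'rV[R]_n) (l : R) (D : set 'rV[R]_n)
    (f : 'rV[R]_n -> \bar R) :
  l != 0%R -> measurable D -> measurable_fun D f ->
  (forall x, D x -> 0 <= f x) ->
  (`|l| ^+ n)%:E * \int[lebesgue_rV]_(x in (fun x => c + l *: x)%R @^-1` D) f (c + l *: x)%R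
  = \int[lebesgue_rV]_(x in D) f x.
Proof.
move=> l0 mD mf f0.
have [k kE] : {k : {nonneg R} | k%:num = `|l| ^+ n}%R.
  by exists (NngNum (exprn_ge0 n (normr_ge0 l))).
pose pm := measure_function_pushforward__canonical__measure_function_Measure
  (@lebesgue_rV R n) (measurable_affine c l).
transitivity (\int[mscale k pm]_(x in D) f x).
  rewrite ge0_integral_mscale// kE; congr (_ * _).
  rewrite ge0_integral_pushforward//; last by move=> x /[!inE]; exact: f0.
  exact: measurable_affine.
apply: eq_measure_integral => A mA _.
transitivity ((`|l| ^+ n)%:E * lebesgue_rV ((fun x => c + l *: x)%R @^-1` A)).
  by rewrite -kE.
exact: lebesgue_rV_affine.
Qed.

End affine.

(** * Lower integrals and Hoelder's inequality *)

Lemma lee_poweR (R : realType) (x y : \bar R) (r : R) :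
  (0 <= r)%R -> (0 <= x)%E -> (x <= y)%E -> (x `^ r <= y `^ r)%E.
Proof.
move=> r0 x0 xy; apply: gt0_ler_poweR => //; rewrite in_itv/= leey andbT//.
exact: le_trans xy.
Qed.

Section lower_integral.
Context d (T : measurableType d) (R : realType) (mu : {measure set T -> \bar R}).
Local Open Scope ereal_scope.
Import HBNNSimple.

(** The integral of a nonnegative function is a supremum over the simple
    functions below it, so monotonicity needs no measurability. This is what
    allows norms of time slices, of unknown measurability, to be integrated. *)
Lemma le_lower_integral (D : set T) (f g : T -> \bar R) :
  (forall x, D x -> 0 <= f x) -> (forall x, D x -> f x <= g x) ->
  \int[mu]_(x in D) f x <= \int[mu]_(x in D) g x.
Proof.
move=> f0 fg; have g0 x : D x -> 0 <= g x by move=> Dx; rewrite (le_trans (f0 _ Dx)) ?fg.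
rewrite !ge0_integralE//; apply: ge_ereal_sup => _ [h hf <-].
apply: ereal_sup_ubound; exists h => // x; apply: (le_trans (hf x)).
by rewrite /patch; case: ifPn => // /[!inE]; exact: fg.
Qed.

Lemma le_integral_sub (A B : set T) (g : T -> \bar R) :
  (forall x, 0 <= g x) -> A `<=` B ->
  \int[mu]_(x in A) g x <= \int[mu]_(x in B) g x.
Proof.
move=> g0 AB; rewrite (integral_mkcond A) (integral_mkcond B).
apply: le_lower_integral => x _; rewrite /patch; first by case: ifP.
case: ifPn => [/[!inE] /AB Bx|_]; first by rewrite mem_set.
by case: ifP.
Qed.

Lemma lower_integralZl (D : set T) (f : T -> \bar R) (K : R) : (0 < K)%R ->
  (forall x, D x -> 0 <= f x) ->
  \int[mu]_(x in D) (K%:E * f x) <= K%:E * \int[mu]_(x in D) f x.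
Proof.
move=> K0 f0; rewrite !ge0_integralE//; last first.
  by move=> x Dx; rewrite mule_ge0 ?f0// lee_fin ltW.
apply: ge_ereal_sup => _ [h hf <-].
have Ki0 : (0 <= K^-1)%R by rewrite invr_ge0 ltW.
rewrite -lee_pdivrMl// -sintegralrM.
rewrite (_ : (_ \* _)%R = scale_nnsfun h Ki0)//.
apply: ereal_sup_ubound; exists (scale_nnsfun h Ki0) => //= x.
rewrite EFinM lee_pdivrMl//; apply: (le_trans (hf x)).
by rewrite /patch; case: ifPn => // _; rewrite mule0.
Qed.

End lower_integral.

Section hoelder_on.
Context d (T : measurableType d) (R : realType) (mu : {measure set T -> \bar R}).
Local Open Scope ereal_scope.

Lemma hoelder_on (D : set T) (F G : T -> R) (p q : R) : measurable D ->
  measurable_fun D F -> measurable_fun D G ->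
  (forall x, 0 <= F x)%R -> (forall x, 0 <= G x)%R ->
  (0 < p)%R -> (0 < q)%R -> (p^-1 + q^-1 = 1)%R ->
  \int[mu]_(x in D) (F x * G x)%:E <=
  (\int[mu]_(x in D) (F x `^ p)%:E) `^ p^-1 *
  (\int[mu]_(x in D) (G x `^ q)%:E) `^ q^-1.
Proof.
move=> mD mF mG F0 G0 p0 q0 pq.
have mF' : measurable_fun setT (F \_ D).
  by apply/(measurable_restrictT _ _).1.
have mG' : measurable_fun setT (G \_ D).
  by apply/(measurable_restrictT _ _).1.
have := hoelder mu mF' mG' p0 q0 pq; rewrite Lnorm1 unlock.
congr (_ <= _ `^ _ * _ `^ _); rewrite [RHS]integral_mkcond; apply: eq_integral => x _ /=; rewrite /patch.
- by case: ifPn => xD/=; rewrite ?mul0r ?normr0// normrM !ger0_norm.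
- by case: ifPn => xD/=; rewrite ?normr0 ?powR0 ?gt_eqF// ger0_norm.
- by case: ifPn => xD/=; rewrite ?normr0 ?powR0 ?gt_eqF// ger0_norm.
Qed.

End hoelder_on.

(** * From estimates in space to estimates in space and time *)

Section time_lift.
Context {R : realType} {n : nat}.
Local Open Scope ereal_scope.

(** The spatial estimate is applied at each time with M the norm of the slice.
    Slices of norm zero are reached through bounds tending to zero, at the
    price of an arbitrarily small loss in the constant, which a final limit
    removes: the constant C = 0 is allowed, as needed for a commutator whose
    symbol has seminorm zero. *)
Lemma time_morrey_lift (N : operator 'rV[R]_n) (X Y : fspace R 'rV[R]_n)
    (p0 T C : R) (w : 'rV[R]_n -> R) (psi : 'rV[R]_n -> R -> R) :
  (0 < T)%R -> (0 < p0)%R -> (0 <= C)%R -> (forall a r, 0 < r -> 0 < psi a r)%R ->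
  (forall g, 0 <= fnorm X g) -> (forall g, 0 <= fnorm Y g) ->
  (forall f : 'rV[R]_n * R -> R, measurable_fun (time_dom T) f ->
    measurable_fun (time_dom T) (in_time N f)) ->
  (forall (g : 'rV[R]_n -> R) (M : R), measurable_fun setT g -> (0 < M)%R ->
    fnorm X (EFin \o g) <= M%:E -> fnorm Y (N g) <= (C * M)%:E) ->
  bounded_by C%:E (TimeMorrey p0 w psi T X) (TimeMorrey p0 w psi T Y) (in_time N).
Proof.
move=> T0 p00 C0 psi0 X0 Y0 mN NXY f [/= /measurable_EFinP mf foo].
have sec (t : R) : (0 < t < T)%R -> measurable_fun setT (fun x => f (x, t)).
  move=> tT; apply: (measurable_comp (measurableX measurableT (measurable_itv _)) _ mf).
    by move=> _ [x _ <-]; split => //=; rewrite in_itv.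
  exact: measurable_fun_pair.
have pointwise (K t : R) : (C < K)%R -> (0 < t < T)%R ->
    fnorm Y (fun x => in_time N f (x, t)) <= K%:E * fnorm X (fun x => (f (x, t))%:E).
  move=> CK tT; have K0 : (0 < K)%R by exact: le_lt_trans CK.
  have := X0 (fun x => (f (x, t))%:E); rewrite le_eqVlt => /predU1P[X_eq0|].
    rewrite -X_eq0 mule0; apply/lee_addgt0Pr => e e0; rewrite add0e.
    apply: (le_trans (NXY _ (e / K)%R (sec t tT) _ _)); rewrite ?divr_gt0//.
      by rewrite /comp -X_eq0 lee_fin ltW// divr_gt0.
    rewrite lee_fin mulrCA ger_pMr//.
    by rewrite ler_pdivrMr// mul1r ltW.
  case: (fnorm X _) (NXY _ ^~ (sec t tT)) => [M| |]//.
    move=> /(_ M) NM M0; rewrite lte_fin in M0.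
    apply: (le_trans (NM M0 _)); first exact: lexx.
    by rewrite lee_fin ler_wpM2r// ltW.
  by move=> _ _; rewrite gt0_muley ?lte_fin// leey.
have normK (K : R) : (C < K)%R ->
    time_morrey_norm p0 w psi T Y (in_time N f) <=
    K%:E * time_morrey_norm p0 w psi T X (EFin \o f).
  move=> CK; have K0 : (0 < K)%R by exact: le_lt_trans CK.
  apply: ge_ereal_sup => _ [[[a r] t0]/= [r0 t0T] <-].
  set c := (X in X * _ <= _).
  have c0 : 0 <= c.
    rewrite /c mule_ge0//; first by rewrite lee_fin invr_ge0 ltW// psi0.
    by rewrite inve_ge0 poweR_ge0.
  apply: (@le_trans _ _ (K%:E * (c * (\int[@lebesgue_measure R]_(t in
      `]0%R, T[ `&` `](t0 - r)%R, (t0 + r)%R[)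
         (fnorm X (fun x => (f (x, t))%:E)) `^ p0) `^ p0^-1))); last first.
    apply: lee_wpmul2l; first by rewrite lee_fin ltW.
    by apply: ereal_sup_ubound; exists (a, r, t0).
  rewrite muleCA; apply: lee_wpmul2l => //.
  have Ke0 : 0 <= K%:E by rewrite lee_fin ltW.
  (* The constant enters the integral as K^p0. *)
  rewrite -[K%:E](poweRe1 Ke0) -(mulfV (lt0r_neq0 p00)) poweRrM.
  rewrite -poweRM ?poweR_ge0//; last by apply: integral_ge0 => t _; exact: poweR_ge0.
  apply: lee_poweR; first by rewrite invr_ge0 (ltW p00).
    by apply: integral_ge0 => t _; exact: poweR_ge0.
  apply: (le_trans _ (lower_integralZl _ _ _)); last 2 first.
  - by rewrite powR_gt0.
  - by move=> t _; exact: poweR_ge0.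
  apply: le_lower_integral => t; first by move=> _; exact: poweR_ge0.
  move=> [/= + _]; rewrite in_itv/= => tT.
  rewrite -poweR_EFin -poweRM//; apply: lee_poweR => //; first exact: ltW.
  exact: pointwise.
split; first split.
- exact: mN.
- apply: (le_lt_trans (normK (C + 1)%R _)); first by rewrite ltrDl.
  by rewrite lte_mul_pinfty// lee_fin addr_ge0.
- have M0 : 0 <= time_morrey_norm p0 w psi T X (EFin \o f).
    apply: ereal_sup_ge; eexists.
      by exists (0%R, 1%R, (T / 2)%R) => //=; split => //; lra.
    rewrite mule_ge0 ?poweR_ge0// mule_ge0// ?inve_ge0 ?poweR_ge0//.
    by rewrite lee_fin invr_ge0 ltW// psi0.
  move: M0 foo normK; case: (time_morrey_norm p0 w psi T X _) => // M.
  rewrite lee_fin => M0 _ normK; apply/lee_addgt0Pr => e e0.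
  have dM : (0 < e / (M + 1))%R by rewrite divr_gt0// ltr_wpDl.
  apply: (le_trans (normK (C + e / (M + 1))%R _)); first by rewrite ltrDl.
  rewrite -EFinM lee_fin mulrDl lerD2l mulrAC ler_pdivrMr ?ltr_wpDl//.
  by rewrite ler_pM2l// lerDl.
Qed.

End time_lift.

(** * Joint measurability of the images *)

Section joint_measurability.
Context {R : realType} {n : nat}.
Local Open Scope ereal_scope.

Lemma measurable_rVB d (U : measurableType d) (f g : U -> 'rV[R]_n) :
  measurable_fun setT f -> measurable_fun setT g ->
  measurable_fun setT (fun x => f x - g x)%R.
Proof.
move=> mf mg; apply: measurable_fun_rVP => i; under eq_fun do rewrite !mxE.
by apply: measurable_funB; apply: (measurableT_comp (measurable_coord i)).
Qed.

Lemma measurable_kernel (Omega : 'rV[R]_n -> R) (alpha : R) :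
  measurable_fun setT Omega ->
  measurable_fun setT (fun y => Omega y / enorm y `^ (n%:R - alpha))%R.
Proof.
move=> mO; apply: measurable_funM => //.
rewrite (_ : (fun x => _) = fun x : 'rV[R]_n => (enorm x `^ (n%:R - alpha)) `^ (-1))%R; last first.
  by apply/funext => x; rewrite powR_inv1// powR_ge0.
apply: (measurableT_comp (measurable_powR _)).
exact: (measurableT_comp (measurable_powR _) (@measurable_enorm R n)).
Qed.

(** The integrals of the positive and of the negative part are measurable in
    (x,t) by Tonelli's theorem, including at the points where they diverge. *)
Lemma measurable_in_time_frac_op (Omega : 'rV[R]_n -> R) (alpha T : R)
    (f : 'rV[R]_n * R -> R) :
  measurable_fun setT Omega -> measurable_fun (time_dom T) f ->
  measurable_fun (time_dom T) (in_time (frac_op Omega alpha) f).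
Proof.
move=> mO mf; have mD : measurable (@time_dom R n T).
  exact: measurableX.
have mf' : measurable_fun setT (f \_ (time_dom T)).
  by apply/(measurable_restrictT _ _).1.
pose F (z : ('rV[R]_n * R) * 'rV[R]_n) : \bar R :=
  (Omega z.2 / enorm z.2 `^ (n%:R - alpha) *
   (f \_ (time_dom T)) (z.1.1 - z.2, z.1.2))%:E.
have mF : measurable_fun setT F.
  apply/measurable_EFinP; apply: measurable_funM.
    exact: (measurableT_comp (measurable_kernel _ mO) measurable_snd).
  apply: (measurableT_comp mf'); apply: measurable_fun_pair.
    apply: measurable_rVB => //.
    exact: (measurableT_comp measurable_fst measurable_fst).
  exact: (measurableT_comp measurable_snd measurable_fst).
apply: (eq_measurable_fun (fun z => \int[@lebesgue_rV R n]_y F (z, y))).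
  move=> z /[!inE] zT; apply: eq_integral => y _.
  rewrite /F/= patchE ifT// inE; split => //=.
  by case: zT.
apply: measurable_funTS.
rewrite (_ : (fun z => _) = fun z =>
   \int[@lebesgue_rV R n]_y (F^\+ (z, y)) - \int[@lebesgue_rV R n]_y (F^\- (z, y))).
  apply: emeasurable_funB.
    apply: (@measurable_fun_fubini_tonelli_F _ _ _ _ _ (@lebesgue_rV R n) F^\+) => //.
    exact: measurable_funepos.
  apply: (@measurable_fun_fubini_tonelli_F _ _ _ _ _ (@lebesgue_rV R n) F^\-) => //.
  exact: measurable_funeneg.
apply/funext => z; rewrite [LHS]integralE.
congr (_ - _).
  apply: eq_integral => y _.
  by rewrite !funeposE.
apply: eq_integral => y _.
by rewrite !funenegE.
Qed.

Lemma measurable_in_time_commutator (b Omega : 'rV[R]_n -> R) (alpha T : R)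
    (f : 'rV[R]_n * R -> R) :
  measurable_fun setT b ->
  measurable_fun setT Omega -> measurable_fun (time_dom T) f ->
  measurable_fun (time_dom T) (in_time (commutator b (frac_op Omega alpha)) f).
Proof.
move=> mb mO mf.
have mb1 : measurable_fun setT (fun z : 'rV[R]_n * R => b z.1).
  exact: (measurableT_comp mb measurable_fst).
apply: emeasurable_funB.
  apply: emeasurable_funM; first by apply: measurable_funTS; exact/measurable_EFinP.
  exact: measurable_in_time_frac_op.
apply: (@measurable_in_time_frac_op Omega alpha T (fun z => b z.1 * f z)%R) => //.
by apply: measurable_funM => //; exact: measurable_funTS.
Qed.

End joint_measurability.

(** * Nested countable partitions *)

Lemma le_mu d (T : measurableType d) (R : realType)
    (mu : {measure set T -> \bar R}) (A B : set T) :
  measurable A -> measurable B -> A `<=` B -> (mu A <= mu B)%E.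
Proof. by move=> mA mB AB; apply: le_measure; rewrite ?inE. Qed.

Ltac meas_sets := repeat first
  [ assumption
  | match goal with
    | |- _ (setI _ _) => apply: measurableI
    | |- _ (setD _ _) => apply: measurableD
    | |- _ (setU _ _) => apply: measurableU
    end ].

Section sigma_add.
Context d (T : measurableType d) (R : realType).
Local Open Scope ereal_scope.

(** A property of set functions rather than a measure structure: it is applied
    to traces, multiples and indefinite integrals of a measure, of which only
    countable additivity is needed. *)
Definition sigma_add (nu : set T -> \bar R) := [/\ nu set0 = 0,
  forall A, 0 <= nu A & forall F : nat -> set T,
  (forall i, measurable (F i)) -> trivIset setT F ->
  nu (\bigcup_i F i) = \sum_(i <oo) nu (F i)].

Lemma sigma_add_measure (mu : {measure set T -> \bar R}) : sigma_add mu.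
Proof.
split => // F mF tF; apply: measure_semi_bigcup => //; exact: bigcup_measurable.
Qed.

Lemma sigma_add_trace (nu : set T -> \bar R) (A : set T) :
  sigma_add nu -> measurable A -> sigma_add (fun E => nu (A `&` E)).
Proof.
move=> [nu0 nu_ge0 nuS] mA; split => [|//|F mF tF]; first by rewrite setI0.
rewrite setI_bigcupr nuS//.
  by move=> i; exact: measurableI.
exact: trivIset_setIl.
Qed.

Lemma sigma_add_scale (nu : set T -> \bar R) (c : R) : (0 <= c)%R ->
  sigma_add nu -> sigma_add (fun E => c%:E * nu E).
Proof.
move=> c0 [nu0 nu_ge0 nuS]; split => [|A|F mF tF]; first by rewrite nu0 mule0.
  by rewrite mule_ge0.
by rewrite nuS// nneseriesZl.
Qed.

Lemma sigma_add_integral (mu : {measure set T -> \bar R}) (g : T -> \bar R) :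
  measurable_fun setT g -> (forall x, 0 <= g x) ->
  sigma_add (fun E => \int[mu]_(x in E) g x).
Proof.
move=> mg g0; split => [|A|F mF tF]; first by rewrite integral_set0.
  exact: integral_ge0.
rewrite ge0_integral_bigcup//.
exact: measurable_funTS.
Qed.

End sigma_add.

Section dyadic.
Context d (T : measurableType d) (R : realType) (mu : {measure set T -> \bar R}).
Variable idx : nat -> T -> nat.
Local Open Scope ereal_scope.

(** A filtration is encoded by the label [idx k x] of the cell of level k that
    contains x; the cells are the fibres of [idx k]. *)
Definition atom k i := idx k @^-1` [set i].

(** These are the unions of cells of level k. *)
Definition saturated k (E : set T) := forall x y, E x -> idx k x = idx k y -> E y.

Hypothesis matom : forall k i, measurable (atom k i).
Hypothesis nested : forall k x y, idx k.+1 x = idx k.+1 y -> idx k x = idx k y.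

Lemma nestedD k l x y : idx (k + l) x = idx (k + l) y -> idx k x = idx k y.
Proof. by elim: l => [|l IH]; rewrite ?addn0// addnS => /nested. Qed.

Lemma nested_le k l x y : (k <= l)%N -> idx l x = idx l y -> idx k x = idx k y.
Proof. by move=> /subnKC <-; exact: nestedD. Qed.

Lemma saturated_le k l E : (k <= l)%N -> saturated k E -> saturated l E.
Proof. by move=> kl sE x y Ex xy; apply: (sE x) => //; exact: nested_le xy. Qed.

Lemma saturated_atom k i : saturated k (atom k i).
Proof. by move=> x y; rewrite /atom/= => <- ->. Qed.

Let saturated_part k E i : saturated k E ->
  atom k i `&` E = if i \in idx k @` E then atom k i else set0.
Proof.
move=> sE; case: ifPn => [|]; rewrite ?inE ?notin_setE.
  by move=> [y Ey <-]; rewrite setIidl// => z /= zy; exact: (sE y).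
by move=> iE; rewrite -subset0 => z [/= zi Ez]; apply: iE; exists z.
Qed.

Let saturated_bigcup k (E : set T) : E = \bigcup_i (atom k i `&` E).
Proof.
by apply/seteqP; split => [x Ex|x [i _ []]//]; exists (idx k x).
Qed.

Lemma measurable_saturated k E : saturated k E -> measurable E.
Proof.
move=> sE; rewrite (saturated_bigcup k E); apply: bigcup_measurable => i _.
by rewrite saturated_part//; case: ifP.
Qed.

(** A union of cells is a countable disjoint union of cells, so a comparison of
    two countably additive set functions can be made cell by cell. *)
Lemma le_saturated (nu1 nu2 : set T -> \bar R) k E : saturated k E ->
  sigma_add nu1 -> sigma_add nu2 ->
  (forall x, E x -> nu1 (atom k (idx k x)) <= nu2 (atom k (idx k x))) ->
  nu1 E <= nu2 E.
Proof.
move=> sE [nu10 nu1_ge0 S1] [nu20 nu2_ge0 S2] H.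
have tr : trivIset setT (fun i => atom k i `&` E).
  by apply/trivIsetP => i j _ _ /eqP ij; rewrite -subset0 => x [[/= xi _] [/= xj _]];
    apply: ij; rewrite -xi -xj.
have mE := measurable_saturated sE.
rewrite (saturated_bigcup k E) S1//; last by move=> i; exact: measurableI.
rewrite S2//; last by move=> i; exact: measurableI.
apply: lee_nneseries => // i _.
rewrite saturated_part//; case: ifPn => [|_]; last by rewrite nu10.
by rewrite inE => -[x Ex <-]; exact: H.
Qed.

Hypothesis gen : forall A, measurable A ->
  <<s [set B | exists k i, B = atom k i] >> A.

(** The sets with such approximations inside Q form a sigma-algebra, by
    continuity from above of mu on Q for countable unions, and contain the
    cells. *)
Lemma saturated_approx (Q A : set T) : measurable Q -> mu Q < +oo ->
  measurable A -> forall k0 (e : R), (0 < e)%R -> exists k S,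
  [/\ (k0 <= k)%N, saturated k S, mu (Q `&` (A `\` S)) <= e%:E &
      mu (Q `&` (S `\` A)) <= e%:E].
Proof.
move=> mQ Qoo mA k0 e e0.
pose G := [set A | measurable A /\ forall e : R, (0 < e)%R -> exists k S,
  [/\ saturated k S, mu (Q `&` (A `\` S)) <= e%:E & mu (Q `&` (S `\` A)) <= e%:E]].
suff GA : G A.
  have [k [S [sS AS SA]]] := GA.2 e e0.
  exists (maxn k0 k), S; split=> //; first exact: leq_maxl.
  by apply: saturated_le sS; exact: leq_maxr.
have mu00 (x : R) : (0 < x)%R -> mu set0 <= x%:E by move=> x0; rewrite measure0 lee_fin ltW.
have GU B C : G B -> G C -> G (B `|` C).
  move=> [mB HB] [mC HC]; split => [|{}e {}e0]; first exact: measurableU.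
  have e20 : (0 < e / 2)%R by rewrite divr_gt0.
  have [k [S [sS BS SB]]] := HB _ e20.
  have [l [S' [sS' CS SC]]] := HC _ e20.
  have mS := measurable_saturated sS; have mS' := measurable_saturated sS'.
  exists (maxn k l), (S `|` S'); split.
  - move=> x y [Sx|Sx] xy; [left|right].
      by apply: (sS x) => //; apply: nested_le xy; exact: leq_maxl.
    by apply: (sS' x) => //; apply: nested_le xy; exact: leq_maxr.
  - apply: (@le_trans _ _ (mu (Q `&` (B `\` S) `|` Q `&` (C `\` S')))).
      apply: le_mu; [by meas_sets|by meas_sets|].
      by move=> x [Qx [[Bx|Cx] /not_orP[? ?]]]; [left|right].
    apply: (le_trans (measureU2 _ _ _)); [by meas_sets|by meas_sets|].
    by rewrite [e in leRHS]splitr EFinD leeD.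
  - apply: (@le_trans _ _ (mu (Q `&` (S `\` B) `|` Q `&` (S' `\` C)))).
      apply: le_mu; [by meas_sets|by meas_sets|].
      by move=> x [Qx [[Bx|Cx] /not_orP[? ?]]]; [left|right].
    apply: (le_trans (measureU2 _ _ _)); [by meas_sets|by meas_sets|].
    by rewrite [e in leRHS]splitr EFinD leeD.
suff : <<s [set B | exists k i, B = atom k i] >> `<=` G by apply; exact: gen.
apply: smallest_sub; last first.
  move=> _ [k [i ->]]; split => // {}e {}e0; exists k, (atom k i).
  by split; rewrite ?setDv ?setI0 ?mu00//; exact: saturated_atom.
split.
- split => // {}e {}e0; exists 0%N, set0.
  by split; rewrite ?setDv ?setI0 ?mu00//.
- move=> B [mB HB]; split; first by rewrite setTD; exact: measurableC.
  move=> e1 /HB[k [S [sS BS SB]]]; exists k, (~` S); split.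
  + by move=> x y nSx xy Sy; apply: nSx; apply: (sS y).
  + by rewrite setTD (setDE (~` B)) setCK (setIC (~` B)) -setDE.
  + by rewrite setTD (setDE (~` S)) setCK (setIC (~` S)) -setDE.
- move=> F GF; split; first by apply: bigcup_measurable => i _; exact: (GF i).1.
  move=> {}e {}e0.
  pose B m := \big[setU/set0]_(i < m) F i.
  have GB m : G (B m).
    rewrite /B; elim: m => [|m IH].
      rewrite big_ord0; split=> // e1 e10; exists 0%N, set0.
      by split; rewrite ?setDv ?setI0 ?mu00//.
    by rewrite big_ord_recr/=; apply: GU.
  have e20 : (0 < e / 2)%R by rewrite divr_gt0.
  have mUF : measurable (\bigcup_k F k) by apply: bigcup_measurable => i _; exact: (GF i).1.
  have mQF m : measurable (Q `&` (\bigcup_k F k `\` B m)).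
    by apply: measurableI => //; apply: measurableD => //; exact: (GB m).1.
  have [m Hm] : exists m, mu (Q `&` (\bigcup_k F k `\` B m)) <= (e / 2)%:E.
    apply: contrapT => /forallNP H.
    have QFcap : \bigcap_m (Q `&` (\bigcup_k F k `\` B m)) = set0.
      rewrite -subset0 => x Hx; have [_ [[k _ Fkx] _]] := Hx 0%N I.
      have [_ [_ +]] := Hx k.+1 I; apply.
      by rewrite /B -bigcup_mkord; exists k => //=.
    have : mu (Q `&` (\bigcup_k F k `\` B m)) @[m --> \oo] --> mu (\bigcap_m (Q `&` (\bigcup_k F k `\` B m))).
      apply: (@nonincreasing_cvg_mu _ _ _ mu (fun m => Q `&` (\bigcup_k F k `\` B m))) => //.
      - by apply: le_lt_trans Qoo; apply: le_mu => // x [].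
      - by rewrite QFcap.
      - move=> k l kl; apply/subsetPset => x [Qx [Fx nB]]; split=> //; split=> //.
        move: nB; apply: contra_not; rewrite /B -!bigcup_mkord => -[j /= jk Fjx].
        by exists j => //=; exact: leq_trans kl.
    rewrite QFcap measure0 => cv.
    have : (e / 2)%:E <= 0 :> \bar R.
      by apply: (cvge_ge _ cv); apply: nearW => k; apply: ltW; rewrite ltNge; apply/negP; exact: H.
    by rewrite lee_fin leNgt e20.
  have [k [S [sS BS SB]]] := (GB m).2 _ e20.
  have mS := measurable_saturated sS; have mB := (GB m).1.
  have BF : B m `<=` \bigcup_k F k.
    by rewrite /B -bigcup_mkord => x [j _ Fjx]; exists j.
  exists k, S; split => //.
  + apply: (@le_trans _ _ (mu (Q `&` (\bigcup_k F k `\` B m) `|` Q `&` (B m `\` S)))).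
      apply: le_mu; [by meas_sets|by meas_sets|].
      move=> x [Qx [Fx Sx]]; have [Bx|Bx] := pselect (B m x); first by right.
      by left.
    apply: (le_trans (measureU2 _ _ _)); [by meas_sets|by meas_sets|].
    by rewrite [e in leRHS]splitr EFinD leeD.
  + apply: (@le_trans _ _ (mu (Q `&` (S `\` B m)))).
      apply: le_mu; [by meas_sets|by meas_sets|].
      by move=> x [Qx [Sx nF]]; split=> //; split=> // /BF.
    by apply: (le_trans SB); rewrite lee_fin; lra.
Qed.

(** This replaces Lebesgue's density theorem. Let S be a union of cells close
    to F in Q. The hypothesis gives mu (F `&` S) <= mu (Q `&` S) / 2, while
    both sides without the factor 1/2 are arbitrarily close to mu F. *)
Lemma half_density_null (Q F : set T) k0 : measurable Q -> mu Q < +oo ->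
  measurable F -> F `<=` Q ->
  (forall k x, (k0 <= k)%N -> mu (F `&` atom k (idx k x)) <=
     (2^-1)%:E * mu (Q `&` atom k (idx k x))) ->
  mu F = 0.
Proof.
move=> mQ Qoo mF FQ H.
have Foo : mu F < +oo by apply: le_lt_trans Qoo; apply: le_measure; rewrite ?inE.
apply/eqP; rewrite eq_le measure_ge0 andbT; apply/lee_addgt0Pr => e e0; rewrite add0e.
have e40 : (0 < e / 4)%R by rewrite divr_gt0.
have [k [S [k0k sS FS SF]]] := saturated_approx mQ Qoo mF k0 e40.
have mS := measurable_saturated sS.
have h1 : mu (F `&` S) <= (2^-1)%:E * mu (Q `&` S).
  apply: (@le_saturated (fun E => mu (F `&` E)) (fun E => (2^-1)%:E * mu (Q `&` E)) k) => //.
  - exact: sigma_add_trace (sigma_add_measure mu) _.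
  - by apply: sigma_add_scale => //; exact: sigma_add_trace (sigma_add_measure mu) _.
  - by move=> x _; exact: H.
have h2 : mu (Q `&` S) <= mu F + (e / 4)%:E.
  apply: (@le_trans _ _ (mu (F `|` (Q `&` (S `\` F))))).
    apply: le_mu; [by meas_sets|by meas_sets|].
    by move=> x [Qx Sx]; have [Fx|Fx] := pselect (F x); [left|right].
  apply: (le_trans (measureU2 _ _ _)); [by meas_sets|by meas_sets|].
  exact: leeD.
have h3 : mu F <= mu (F `&` S) + (e / 4)%:E.
  rewrite (measureDI mu mF mS) addeC leeD2l//.
  by apply: (le_trans _ FS); apply: le_mu; [by meas_sets|by meas_sets|];
    move=> x [Fx Sx]; split => //; exact: FQ.
move: h3 => /le_trans => /(_ _ (leeD h1 (lexx _))).
move: h2; case: (mu (Q `&` S)) => [q| |].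
- have : mu F \is a fin_num by rewrite ge0_fin_numE.
  case: (mu F) => // f _; rewrite -!EFinD !lee_fin => ? ?; lra.
- have : mu F \is a fin_num by rewrite ge0_fin_numE.
  by case: (mu F).
- have : mu F \is a fin_num by rewrite ge0_fin_numE.
  by case: (mu F) => // f _ _; rewrite gt0_muleNy// ?lte_fin.
Qed.

End dyadic.

(** * A weighted John-Nirenberg inequality *)

Section john_nirenberg.
Context d (T : measurableType d) (R : realType) (mu : {measure set T -> \bar R}).
Variable idx : nat -> T -> nat.
Local Open Scope ereal_scope.
Local Notation atom := (atom idx).

Hypothesis matom : forall k i, measurable (atom k i).
Hypothesis nested : forall k x y, idx k.+1 x = idx k.+1 y -> idx k x = idx k y.
Hypothesis gen : forall A, measurable A ->
  <<s [set B | exists k i, B = atom k i] >> A.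

Variables (w b : T -> R) (m : nat -> nat -> R) (K D eta : R).
Hypotheses (mw : measurable_fun setT w) (w0 : forall x, (0 <= w x)%R).
Hypothesis mb : measurable_fun setT b.
Hypotheses (K0 : (0 < K)%R) (D1 : (1 <= D)%R) (eta01 : (0 < eta < 1)%R).
Hypothesis atom_fin : forall k i, mu (atom k i) < +oo.
Hypothesis osc : forall k i,
  \int[mu]_(x in atom k i) (`|b x - m k i|%R)%:E <= K%:E * mu (atom k i).
Hypothesis regular : forall k x,
  mu (atom k (idx k x)) <= D%:E * mu (atom k.+1 (idx k.+1 x)).
Let u A := \int[mu]_(x in A) (w x)%:E.
Hypothesis u_fin : forall k i, u (atom k i) < +oo.
Hypothesis u_half : forall k i E, measurable E -> E `<=` atom k i ->
  mu (atom k i) <= 2%:E * mu E -> eta%:E * u (atom k i) <= u E.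

Let L := ((5 + 2 * D) * K)%R.
Let lambda := (2 * K)%R.
Let lambda0 : (0 < lambda)%R. Proof. by rewrite mulr_gt0. Qed.

Let uS : sigma_add u.
Proof. by apply: sigma_add_integral => //; exact/measurable_EFinP. Qed.

Let msup k i c : measurable (atom k i `&` [set x | c < `|b x - m k i|]%R).
Proof.
apply: measurableI => //; rewrite -[X in measurable X]setTI.
have -> : [set x | c < `|b x - m k i|]%R = (fun x => `|b x - m k i|)%R @^-1` `]c, +oo[.
  by apply/seteqP; split => x /=; rewrite in_itv/= andbT.
apply: (_ : measurable_fun setT (fun x => `|b x - m k i|)%R) => //.
by apply: measurableT_comp => //; exact: measurable_funB.
Qed.

Let mdev (c : R) : measurable_fun setT (fun x => (`|b x - c|%R)%:E).
Proof.
apply/measurable_EFinP; apply: measurableT_comp => //; exact: measurable_funB.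
Qed.

Section stopping.
Variables (k i : nat).
Let m0 := m k i.
Let dev (A : set T) := \int[mu]_(x in A) (`|b x - m0|%R)%:E.
Let Q := atom k i.

(** A cell inside Q is bad when the mean of |b - m0| over it exceeds lambda.
    The Calderon-Zygmund stopping construction follows: [E l] is the union of
    the cells of level k + l that are bad and maximal, and U collects them. *)
Let bad l (x : T) : Prop :=
  lambda%:E * mu (atom (k + l) (idx (k + l) x)) < dev (atom (k + l) (idx (k + l) x)).

Let E l := [set x | [/\ Q x, bad l x & forall j, (j < l)%N -> ~ bad j x]].

Let U := \bigcup_l E l.

Let devS : sigma_add dev.
Proof. exact: sigma_add_integral. Qed.

Let bad_eq l l' x y : (l' <= l)%N -> idx (k + l) x = idx (k + l) y -> bad l' x -> bad l' y.
Proof.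
move=> ll xy; rewrite /bad.
by have -> // : idx (k + l') x = idx (k + l') y; apply: (nested_le nested) xy; rewrite leq_add2l.
Qed.

Let Qsat x y l : Q x -> idx (k + l) x = idx (k + l) y -> Q y.
Proof. by rewrite /Q /atom/= => <- /(nestedD nested) ->. Qed.

Let Esat l : saturated idx (k + l) (E l).
Proof.
move=> x y [Qx bx nbx] xy; split; first exact: Qsat xy.
  exact: bad_eq xy bx.
move=> j jl bj; apply: (nbx j jl); apply: bad_eq bj; last exact: (esym xy).
exact: ltnW.
Qed.

Let mE l : measurable (E l).
Proof. exact: (measurable_saturated matom (@Esat l)). Qed.

Let mU : measurable U. Proof. exact: bigcup_measurable. Qed.

Let UQ : U `<=` Q. Proof. by move=> x [l _ []]. Qed.

Let tE : trivIset setT E.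
Proof.
apply/trivIsetP => l l' _ _ ll; rewrite -subset0 => x [[_ bx nbx] [_ bx' nbx']].
by move: ll; rewrite neq_ltn => /orP[|] ll; [exact: nbx' ll _ |exact: nbx ll _].
Qed.

Let E0 : E 0%N = set0.
Proof.
rewrite -subset0 => x [Qx + _]; rewrite /bad addn0 (_ : idx k x = i)//.
apply/negP; rewrite -leNgt; apply: (le_trans (osc k i)).
by apply: lee_wpmul2r => //; rewrite lee_fin ler_peMl// ?ler1n// ltW.
Qed.

(** Chebyshev's inequality on each stopped cell, against the mean oscillation
    K = lambda / 2 over Q. *)
Let muU : 2%:E * mu U <= mu Q.
Proof.
have lU : lambda%:E * mu U <= dev U.
  have [_ _ devSU] := devS; have [_ _ muSU] := sigma_add_measure mu.
  rewrite /U devSU// muSU// -nneseriesZl//.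
  apply: lee_nneseries => // l _; first by rewrite mule_ge0// lee_fin ltW.
  apply: (@le_saturated _ _ _ idx matom (fun A => lambda%:E * mu A) dev (k + l)) => //.
  - apply: sigma_add_scale; [exact: ltW|exact: sigma_add_measure].
  - by move=> x [_ bx _]; exact: ltW.
have dUQ : dev U <= K%:E * mu Q.
  apply: le_trans (osc k i); apply: ge0_subset_integral => //.
  exact: measurable_funTS.
have := le_trans lU dUQ; rewrite /lambda mulrC EFinM -muleA.
by rewrite lee_pmul2l// lte_fin.
Qed.

(** The complement of U has at least half of the measure of Q, so it carries a
    share eta of the weight. *)
Let uU : u U <= (1 - eta)%:E * u Q.
Proof.
have mQ : measurable Q by exact: matom.
have QU : Q = (Q `\` U) `|` U by rewrite setUC setDUK.
have muQU : mu Q = mu (Q `\` U) + mu U.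
  rewrite {1}QU measureU//; [exact: measurableD|].
  by rewrite -subset0 => x [[_ ?]].
have uQU : u Q = u (Q `\` U) + u U.
  rewrite {1}QU /u ge0_integral_setU//.
  - exact: measurableD.
  - exact/measurable_funTS/measurable_EFinP.
  - by move=> x _; rewrite lee_fin.
  - by apply/disj_setPS => x [[_ ?]].
have half : mu Q <= 2%:E * mu (Q `\` U).
  have Ufin : mu U \is a fin_num.
    by rewrite ge0_fin_numE// (le_lt_trans _ (atom_fin k i))// le_mu.
  have QUfin : mu (Q `\` U) \is a fin_num.
    rewrite ge0_fin_numE// (le_lt_trans _ (atom_fin k i))// le_mu//.
    exact: measurableD.
  move: muU; rewrite muQU; case: (mu U) Ufin => // x _.
  case: (mu (Q `\` U)) QUfin => // y _; rewrite -!EFinD -!EFinM !lee_fin; lra.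
have := @u_half k i (Q `\` U) (measurableD mQ mU) (@subDsetl _ _ _) half.
have Ufin : u U \is a fin_num.
  rewrite ge0_fin_numE; last by apply: integral_ge0 => x _; rewrite lee_fin.
  apply: le_lt_trans (u_fin k i); apply: ge0_subset_integral => //.
    exact/measurable_funTS/measurable_EFinP.
  by move=> x _; rewrite lee_fin.
have : u Q \is a fin_num.
  rewrite ge0_fin_numE; first exact: u_fin.
  by apply: integral_ge0 => x _; rewrite lee_fin.
rewrite -/Q; rewrite uQU; move: (u U) Ufin => [y| |]// _.
case: (u (Q `\` U)) => // z _; rewrite -!EFinD -!EFinM !lee_fin; lra.
Qed.

(** Outside U all cells are good, so by Chebyshev's inequality the set where
    |b - m0| is large has density at most 1/2 in each of them. *)
Let offU : mu ((Q `\` U) `&` [set x | 2 * lambda < `|b x - m0|]%R) = 0.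
Proof.
have mQ : measurable Q by exact: matom.
have -> : (Q `\` U) `&` [set x | 2 * lambda < `|b x - m0|]%R =
    (Q `&` [set x | 2 * lambda < `|b x - m0|]%R) `\` U.
  by rewrite setDE setIAC -setDE.
set F := _ `\` U.
have mF : measurable F by apply: measurableD => //; exact: msup.
apply: (half_density_null matom nested gen (Q := Q) (k0 := k)) => //.
- exact: atom_fin.
- by move=> x [[]].
- move=> j x /subnKC <-; set l := (j - k)%N.
  set A := atom _ _.
  have [[y [Fy Ay]]|nFA] := pselect (exists y, F y /\ A y); last first.
    rewrite [X in mu X](_ : _ = set0) ?measure0; last first.
      by rewrite -subset0 => y [Fy Ay]; apply: nFA; exists y.
    by rewrite mule_ge0// lee_fin.
  have [[Qy _] nUy] := Fy.
  have AE : A = atom (k + l) (idx (k + l) y) by rewrite /A -Ay.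
  have AQ : A `<=` Q by move=> z; rewrite AE => yz; exact: (Qsat Qy (esym yz)).
  rewrite [X in _ * mu X](_ : _ = A); last by rewrite setIidr.
  have mA : measurable A by exact: matom.
  have good : dev A <= lambda%:E * mu A.
    rewrite leNgt; apply/negP; rewrite AE => bly; apply: nUy.
    have [l' [bl' nbl']] : exists l', bad l' y /\ forall j, (j < l')%N -> ~ bad j y.
      have /asboolP bl : bad l y by [].
      have ex : exists l, `[< bad l y >] by exists l.
      exists (ex_minn ex); case: ex_minnP => l' /asboolP bl' minl'; split=> // j' j'l /asboolP /minl'.
      by rewrite leqNgt j'l.
    by exists l'.
  have markov : (2 * lambda)%:E * mu (F `&` A) <= dev A.
    have mFA : measurable (F `&` A) by exact: measurableI.
    rewrite -integral_cst//; apply: (@le_trans _ _ (dev (F `&` A))).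
      apply: ge0_le_integral => //.
      - by move=> z _; rewrite lee_fin mulr_ge0// ltW.
      - exact: measurable_funTS.
      - by move=> z [[[_ /ltW]]]; rewrite lee_fin.
    by apply: ge0_subset_integral => //; exact: measurable_funTS.
  have := le_trans markov good; rewrite mulrC EFinM -muleA lee_pmul2l ?lte_fin//.
  by rewrite -[(2^-1)%:E * _]muleC lee_pdivlMr// muleC.
Qed.

(** Outside U there is nothing left at height L. On a maximal bad cell A the
    parent is good, whence |m_A - m_Q| <= K + lambda * D <= L: a point of A
    beyond height (j + 1) L for Q is beyond height j L for A, and the induction
    hypothesis on A is summed over A in U, which has weight at most
    (1 - eta) u Q. *)
Lemma good_lambda_step j :
  (forall k i, u (atom k i `&` [set x | j%:R * L < `|b x - m k i|]%R) <=
    ((1 - eta) ^+ j)%:E * u (atom k i)) ->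
  u (Q `&` [set x | j.+1%:R * L < `|b x - m0|]%R) <=
    ((1 - eta) ^+ j.+1)%:E * u Q.
Proof.
move=> IH.
have eta1 : (0 <= 1 - eta)%R by have /andP[_ ?] := eta01; rewrite subr_ge0 ltW.
set H := [set x | j.+1%:R * L < `|b x - m0|]%R.
have mQH : measurable (Q `&` H) by exact: msup.
have L0 : (0 < L)%R.
  by apply: mulr_gt0 => //; have := D1; lra.
have L2l : (2 * lambda <= j.+1%:R * L)%R.
  apply: (@le_trans _ _ L); last by rewrite ler_peMl ?ler1n// ltW.
  by rewrite /lambda /L mulrA ler_pM2r//; have := D1; lra.
have mQU : measurable ((Q `\` U) `&` H).
  have -> : (Q `\` U) `&` H = (Q `&` H) `\` U by rewrite setDE setIAC -setDE.
  exact: measurableD.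
have mUH : measurable (U `&` H).
  have -> : U `&` H = U `&` (Q `&` H) by rewrite setIA [U `&` Q]setIidl.
  exact: measurableI.
have null : u ((Q `\` U) `&` H) = 0.
  apply: null_set_integral => //; first exact/measurable_funTS/measurable_EFinP.
  apply/eqP; rewrite eq_le measure_ge0 andbT -offU; apply: le_mu => //.
    have -> : (Q `\` U) `&` [set x | 2 * lambda < `|b x - m0|]%R =
        (Q `&` [set x | 2 * lambda < `|b x - m0|]%R) `\` U.
      by rewrite setDE setIAC -setDE.
    by apply: measurableD => //; exact: msup.
  by move=> x [QUx Hx]; split => //=; exact: le_lt_trans Hx.
have -> : Q `&` H = ((Q `\` U) `&` H) `|` (U `&` H).
  by rewrite -setIUl setDKU.
have disj : [disjoint (Q `\` U) `&` H & U `&` H].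
  by apply/disj_setPLR => x [[_ ?] _] [].
rewrite /u ge0_integral_setU//; first last.
  - by move=> x _; rewrite lee_fin.
  - exact/measurable_funTS/measurable_EFinP.
rewrite -/(u _) null add0e exprS EFinM muleAC.
apply: (@le_trans _ _ (((1 - eta) ^+ j)%:E * u U)); last first.
  rewrite muleC; apply: lee_wpmul2r; last exact: uU.
  by rewrite lee_fin exprn_ge0.
have [u_0 u_ge0 uSU] := uS.
have UH : U `&` H = \bigcup_l (E l `&` (Q `&` H)).
  rewrite -setI_bigcupl setIA [U `&` Q]setIidl//.
rewrite -/(u _) UH uSU; last 2 first.
  - by move=> l; exact: measurableI.
  - exact: trivIset_setIr.
rewrite /U uSU// -nneseriesZl//.
apply: lee_nneseries => // l _.
rewrite setIC.
apply: (@le_saturated _ _ _ idx matom (fun A => u ((Q `&` H) `&` A))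
   (fun A => ((1 - eta) ^+ j)%:E * u A) (k + l)) => //.
- exact: sigma_add_trace.
- by apply: sigma_add_scale => //; rewrite exprn_ge0.
case: l => [|l] x Elx; first by rewrite E0 in Elx.
have [Qx bx nbx] := Elx.
set A := atom _ _.
have mA : measurable A by exact: matom.
have AQ : A `<=` Q by move=> z xz; exact: (Qsat Qx (esym xz)).
apply: le_trans (IH (k + l.+1)%N (idx (k + l.+1) x)).
apply: ge0_subset_integral => //.
- exact: measurableI.
- exact/measurable_funTS/measurable_EFinP.
- by move=> z _; rewrite lee_fin.
move=> z [[Qz Hz] Az]; split=> //=.
set mA' := m _ _.
suff mm : (`|mA' - m0| <= L)%R.
  have := ler_distD mA' (b z) m0; move: Hz; rewrite /H/= -natr1 mulrDl mul1r; lra.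
have parent : dev A <= (lambda * D)%:E * mu A.
  have := nbx l (ltnSn l); rewrite /bad => /negP; rewrite -leNgt => pl.
  apply: (@le_trans _ _ (dev (atom (k + l) (idx (k + l) x)))).
    apply: ge0_subset_integral => //; first exact: measurable_funTS.
    by move=> y; rewrite /A addnS => /nested; exact.
  apply: (le_trans pl); rewrite (EFinM lambda D) -muleA; apply: lee_wpmul2l.
    by rewrite lee_fin ltW.
  by rewrite /A addnS; exact: regular.
have Apos : 0 < mu A.
  rewrite lt0e measure_ge0 andbT; apply/eqP => A0.
  move: bx; rewrite /bad -/A A0 mule0.
  rewrite (_ : dev A = 0) ?ltxx//.
  by apply: null_set_integral => //; exact: measurable_funTS.
have Afin : mu A \is a fin_num by rewrite ge0_fin_numE// atom_fin.
have : (`|mA' - m0|%R)%:E * mu A <= (K + lambda * D)%:E * mu A.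
  rewrite -integral_cst//.
  rewrite EFinD ge0_muleDl; last 2 first.
  - by rewrite lee_fin ltW.
  - by rewrite lee_fin mulr_ge0 ?(ltW lambda0)//; have := D1; lra.
  apply: le_trans (leeD (osc _ _) parent).
  rewrite /dev -ge0_integralD//; last 2 first.
  - exact: measurable_funTS.
  - exact: measurable_funTS.
  apply: le_lower_integral => y _ /=; first by rewrite lee_fin.
  rewrite -EFinD lee_fin.
  rewrite -[m _ _]/mA' [leRHS]addrC; have := ler_normB (b y - m0)%R (b y - mA')%R.
  by rewrite (_ : b y - m0 - (b y - mA') = mA' - m0)%R//; ring.
rewrite lee_pmul2r ?lee_fin// => /le_trans; apply.
by rewrite /lambda /L; have := D1; have := K0; nra.
Qed.

End stopping.

Lemma weighted_john_nirenberg j k i :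
  u (atom k i `&` [set x | j%:R * L < `|b x - m k i|]%R) <=
    ((1 - eta) ^+ j)%:E * u (atom k i).
Proof.
elim: j k i => [|j IH] k i; last exact: good_lambda_step.
rewrite expr0 mul1e; apply: ge0_subset_integral => //.
- exact/measurable_funTS/measurable_EFinP.
- by move=> z _; rewrite lee_fin.
Qed.

End john_nirenberg.

(** * Moments from exponential decay *)

Section moments.
Context {R : realType}.
Local Open Scope ereal_scope.

Lemma nneseries_geometric_le (M rho : R) : (0 <= M)%R -> (0 <= rho < 1)%R ->
  \sum_(j <oo) (M * rho ^+ j)%:E <= (M / (1 - rho))%:E.
Proof.
move=> M0 /andP[rho0 rho1]; apply: lime_le.
  by apply: is_cvg_nneseries => j _ _; rewrite lee_fin mulr_ge0// exprn_ge0.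
apply: nearW => n; rewrite sumEFin lee_fin.
have := @geometric_seriesE _ M rho (negbT (lt_eqF rho1)) => /(congr1 (fun f => f n)).
rewrite /series/geometric/= => ->.
rewrite ler_wpM2r ?invr_ge0 ?subr_ge0 ?(ltW rho1)//.
by rewrite ler_piMr// gerBl exprn_ge0.
Qed.

(** With rho between theta and 1, the powers of rho / theta outgrow every power
    of j; the constant M comes from the inequality ln y < y applied at
    y = (j + 1) a / q, a = ln (rho / theta). *)
Lemma powR_exp_bound (q theta : R) : (0 < q)%R -> (0 < theta < 1)%R ->
  exists M rho : R, [/\ (0 <= M)%R, (0 <= rho < 1)%R &
    forall j, (j.+1%:R `^ q * theta ^+ j <= M * rho ^+ j)%R].
Proof.
move=> q0 /andP[theta0 theta1].
pose rho : R := ((1 + theta) / 2)%R.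
have rhoth : (theta < rho)%R by rewrite /rho; lra.
have rho1 : (rho < 1)%R by rewrite /rho; lra.
have rho0 : (0 < rho)%R by rewrite /rho; lra.
pose a : R := ln (rho / theta).
have a0 : (0 < a)%R by rewrite ln_gt0// ltr_pdivlMr// mul1r.
pose M : R := expR (a - q * ln (a / q)).
exists M, rho; split; rewrite ?expR_ge0 ?(ltW rho0)//= => j.
have y0 : (0 < j.+1%:R :> R)%R by rewrite ltr0n.
have aq0 : (0 < a / q)%R by rewrite divr_gt0.
have h : (j.+1%:R `^ q <= M * (rho / theta) ^+ j)%R.
  rewrite -(@lnK _ (j.+1%:R `^ q)%R) ?posrE ?powR_gt0// ln_powR.
  have -> : (rho / theta = expR a)%R by rewrite /a lnK// posrE divr_gt0.
  rewrite -expRM_natl /M -expRD ler_expR.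
  have /ltW := @ln_sublinear R (j.+1%:R * (a / q))%R (mulr_gt0 y0 aq0).
  rewrite lnM ?posrE// => H.
  have := ler_wpM2l (ltW q0) H; rewrite mulrDr.
  rewrite (_ : q * (j.+1%:R * (a / q)) = a + j%:R * a)%R; first by lra.
  by rewrite -natr1; field; rewrite gt_eqF.
apply: (@le_trans _ _ (M * (rho / theta) ^+ j * theta ^+ j)%R).
  by rewrite ler_wpM2r// exprn_ge0// ltW.
by rewrite -mulrA -exprMn divfK// gt_eqF.
Qed.

(** Cut Q into the layers j L < g <= (j + 1) L; the weight of each decays
    geometrically. *)
Lemma moment_of_decay (q theta : R) : (0 < q)%R -> (0 < theta < 1)%R ->
  exists2 C : R, (0 < C)%R &
  forall d (T : measurableType d) (mu : {measure set T -> \bar R}) (Q : set T)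
    (g w : T -> R) (L : R), (0 < L)%R -> measurable Q ->
    measurable_fun setT g -> measurable_fun setT w ->
    (forall x, 0 <= g x)%R -> (forall x, 0 <= w x)%R ->
    (forall j, \int[mu]_(x in Q `&` [set x | j%:R * L < g x]%R) (w x)%:E <=
       (theta ^+ j)%:E * \int[mu]_(x in Q) (w x)%:E) ->
    \int[mu]_(x in Q) (g x `^ q * w x)%:E <=
    (C * L `^ q)%:E * \int[mu]_(x in Q) (w x)%:E.
Proof.
move=> q0 th01; have [M [rho [M0 rho01 bound]]] := powR_exp_bound q0 th01.
have [rho0 rho1] := andP rho01.
exists (M / (1 - rho) + 1)%R.
  by rewrite ltr_wpDl// divr_ge0// subr_ge0 ltW.
move=> d T mu Q g w L L0 mQ mg mw g0 w0 decay.
pose S j := [set x | j%:R * L < g x]%R.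
have mS j : measurable (S j).
  rewrite -[X in measurable X]setTI.
  have -> : S j = g @^-1` `](j%:R * L)%R, +oo[.
    by apply/seteqP; split => x /=; rewrite /S/= in_itv/= andbT.
  exact: mg.
pose F j x := ((j.+1%:R * L) `^ q * (w x * \1_(S j) x))%:E.
have F0 j x : 0 <= F j x by rewrite lee_fin mulr_ge0 ?powR_ge0// mulr_ge0.
have mF j : measurable_fun Q (F j).
  apply/measurable_EFinP/measurable_funTS; apply: measurable_funM => //.
  by apply: measurable_funM => //; exact: measurable_indic.
have w_int : 0 <= \int[mu]_(x in Q) (w x)%:E.
  by apply: integral_ge0 => x _; rewrite lee_fin.
have C0 : (0 < M / (1 - rho) + 1)%R.
  by rewrite ltr_wpDl// divr_ge0// subr_ge0 ltW.
have [woo|wfin] := eqVneq (\int[mu]_(x in Q) (w x)%:E) +oo.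
  by rewrite woo gt0_muley ?leey// lte_fin mulr_gt0// powR_gt0.
apply: (@le_trans _ _ (\int[mu]_(x in Q) (\sum_(j <oo) F j x))).
  apply: le_lower_integral => x Qx; first by rewrite lee_fin mulr_ge0// powR_ge0.
  have [gx0|gx0] := eqVneq (g x) 0%R.
    by rewrite gx0 powR0 ?gt_eqF// mul0r; apply: nneseries_ge0.
  have gpos : (0 < g x)%R by rewrite lt_neqAle eq_sym gx0 g0.
  have gL0 : (0 < g x / L)%R by rewrite divr_gt0.
  have [j jg gj] : exists2 j : nat, (j%:R * L < g x)%R & (g x <= j.+1%:R * L)%R.
    have : exists m : nat, (g x <= m%:R * L)%R.
      exists (Num.bound (g x / L)); rewrite -ler_pdivrMr//.
      by apply: ltW; apply: archi_boundP; exact: ltW.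
    move=> ex; case: (ex_minnP ex) => -[|m] gm minm.
      by move: gm; rewrite mul0r leNgt gpos.
    exists m => //; rewrite ltNge; apply/negP => /minm.
    by rewrite ltnn.
  apply: (@le_trans _ _ (F j x)).
    rewrite lee_fin indicE mem_set// mulr1 ler_wpM2r//.
    by apply: ge0_ler_powR; rewrite ?nnegrE ?(ltW q0)// mulr_ge0// ltW.
  rewrite (@nneseriesD1 _ (F^~ x) j)//.
  by rewrite leeDl// nneseries_ge0.
rewrite integral_nneseries//.
apply: (@le_trans _ _ (\sum_(j <oo) ((M * rho ^+ j)%:E * ((L `^ q)%:E * \int[mu]_(x in Q) (w x)%:E)))).
  apply: lee_nneseries => [j _ _|j _ /=]; first exact: integral_ge0.
  rewrite /F; under eq_integral do rewrite EFinM.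
  rewrite ge0_integralZl//; last 3 first.
  - apply/measurable_EFinP/measurable_funTS.
    by apply: measurable_funM => //; exact: measurable_indic.
  - by move=> x _; rewrite lee_fin mulr_ge0.
  - by rewrite lee_fin powR_ge0.
  have -> : \int[mu]_(x in Q) (w x * \1_(S j) x)%:E = \int[mu]_(x in Q `&` S j) (w x)%:E.
    rewrite integral_mkcondr; apply: eq_integral => x _.
    by rewrite patchE indicE; case: ifPn => xS; rewrite ?mulr1 ?mulr0.
  apply: (@le_trans _ _ (((j.+1%:R * L) `^ q)%:E * ((theta ^+ j)%:E * \int[mu]_(x in Q) (w x)%:E))).
    by apply: lee_wpmul2l; rewrite ?lee_fin ?powR_ge0//; exact: decay.
  rewrite powRM// ?(ltW L0)// EFinM !muleA -!EFinM.
  rewrite lee_wpmul2r// lee_fin mulrAC ler_wpM2r ?powR_ge0//.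
move: wfin; case: (\int[mu]_(x in Q) (w x)%:E) w_int => // v; rewrite lee_fin => v0 _.
rewrite (_ : (fun n => _) =
    (fun n => \sum_(0 <= j < n) (L `^ q * v * M * rho ^+ j)%:E)); last first.
  apply/funext => n; apply: eq_bigr => j _; rewrite -!EFinM; congr EFin; ring.
apply: (le_trans (nneseries_geometric_le _ rho01)).
  by rewrite !mulr_ge0// powR_ge0.
rewrite -EFinM lee_fin.
rewrite (_ : L `^ q * v * M / (1 - rho) = M / (1 - rho) * (L `^ q * v))%R; last by ring.
by rewrite -[leRHS]mulrA ler_wpM2r ?lerDl// mulr_ge0// powR_ge0.
Qed.

End moments.

(** * Euclidean norm and balls *)

Section euclidean_balls.
Context {R : realType} {n : nat}.
Implicit Types (x y a : 'rV[R]_n) (r : R).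

Lemma enorm_ge0 x : 0 <= enorm x.
Proof. exact: sqrtr_ge0. Qed.

Lemma sqr_enorm x : enorm x ^+ 2 = \sum_i x ord0 i ^+ 2.
Proof. by rewrite sqr_sqrtr// sumr_ge0// => i _; rewrite sqr_ge0. Qed.

Lemma coord_le_enorm x i : `|x ord0 i| <= enorm x.
Proof.
rewrite -(@ler_pXn2r _ 2)// ?nnegrE ?enorm_ge0// sqr_enorm real_normK ?num_real//.
by rewrite (bigD1 i)//= lerDl sumr_ge0// => j _; rewrite sqr_ge0.
Qed.

Lemma enormZ (l : R) x : enorm (l *: x) = `|l| * enorm x.
Proof.
rewrite /enorm -sqrtr_sqr -sqrtrM ?sqr_ge0// mulr_sumr; congr (Num.sqrt _).
by apply: eq_bigr => i _; rewrite mxE exprMn.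
Qed.

Lemma enormN x : enorm (- x) = enorm x.
Proof. by rewrite -scaleN1r enormZ normrN1 mul1r. Qed.

Lemma enorm0 : enorm (0 : 'rV[R]_n) = 0.
Proof. by rewrite /enorm big1 ?sqrtr0// => i _; rewrite mxE expr0n. Qed.

Lemma enorm_eq0 x : enorm x = 0 -> x = 0.
Proof.
move=> x0; apply/rowP => i; rewrite mxE; apply/eqP.
by rewrite -normr_eq0 eq_le normr_ge0 andbT -x0 coord_le_enorm.
Qed.

Lemma dot_le_enorm x y : \sum_i x ord0 i * y ord0 i <= enorm x * enorm y.
Proof.
have [/eqP/enorm_eq0 ->|x0] := boolP (enorm x == 0).
  by rewrite enorm0 mul0r big1// => i _; rewrite mxE mul0r.
have [/eqP/enorm_eq0 ->|y0] := boolP (enorm y == 0).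
  by rewrite enorm0 mulr0 big1// => i _; rewrite mxE mulr0.
have a0 : 0 < enorm x by rewrite lt_neqAle eq_sym x0 enorm_ge0.
have b0 : 0 < enorm y by rewrite lt_neqAle eq_sym y0 enorm_ge0.
apply: (@le_trans _ _ (\sum_i (enorm y / enorm x * x ord0 i ^+ 2 +
    enorm x / enorm y * y ord0 i ^+ 2) / 2)).
  apply: ler_sum => i _; set u := x _ _; set v := y _ _.
  have := sqr_ge0 (enorm y * u - enorm x * v).
  set A := enorm x in a0 *; set B := enorm y in b0 *.
  rewrite (_ : (B * u - A * v) ^+ 2 = (A * B) * (B / A * u ^+ 2 + A / B * v ^+ 2 - 2 * (u * v))).
    by rewrite pmulr_rge0 ?mulr_gt0//; lra.
  by field; rewrite !gt_eqF.
rewrite -mulr_suml big_split/= -!mulr_sumr -!sqr_enorm.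
rewrite le_eqVlt; apply/orP; left; apply/eqP; field.
by rewrite !gt_eqF.
Qed.

Lemma enorm_triangle x y : enorm (x + y) <= enorm x + enorm y.
Proof.
rewrite -(@ler_pXn2r _ 2)// ?nnegrE ?addr_ge0 ?enorm_ge0//.
rewrite sqr_enorm sqrrD !sqr_enorm.
under eq_bigr do rewrite mxE sqrrD.
rewrite !big_split/= lerD2r lerD2l.
by rewrite mulr2n lerD// dot_le_enorm.
Qed.

Lemma enorm_le_coords x c : (0 < n)%N -> (forall i, `|x ord0 i| <= c) -> enorm x <= n%:R * c.
Proof.
move=> n0 xc; have c0 : 0 <= c.
  by apply: le_trans (xc (Ordinal n0)); exact: normr_ge0.
rewrite -(@ler_pXn2r _ 2)// ?nnegrE ?mulr_ge0 ?enorm_ge0// sqr_enorm.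
apply: (@le_trans _ _ (\sum_(i < n) c ^+ 2)).
  apply: ler_sum => i _; rewrite -[x _ _ ^+ 2]real_normK ?num_real//.
  by rewrite ler_pXn2r// nnegrE.
rewrite sumr_const card_ord exprMn -[leLHS]mulr_natl ler_wpM2r ?sqr_ge0//.
by rewrite expr2 ler_peMr ?ler1n// ler0n.
Qed.

Lemma eball_sub a a' r r' : enorm (a - a') + r <= r' -> eball a r `<=` eball a' r'.
Proof.
move=> h x; rewrite /eball/= => xa; apply: lt_le_trans h.
rewrite (_ : x - a' = (a - a') + (x - a)); last by rewrite [RHS]addrC addrA subrK.
by apply: le_lt_trans (enorm_triangle _ _) _; rewrite ltrD2l.
Qed.

Lemma eball_subr a r r' : r <= r' -> eball a r `<=` eball a r'.
Proof. by move=> h; apply: eball_sub; rewrite subrr enorm0 add0r. Qed.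

Local Open Scope ereal_scope.

Lemma lebesgue_eballE a r : (0 < r)%R ->
  lebesgue_rV (eball a r) = (r ^+ n)%:E * lebesgue_rV (eball (0%R : 'rV[R]_n) 1).
Proof.
move=> r0; rewrite -(lebesgue_rV_affine a (lt0r_neq0 r0) (measurable_eball a r)).
rewrite gtr0_norm//; congr (_ * lebesgue_rV _).
apply/seteqP; split => x; rewrite /eball/= addrAC subrr add0r subr0 enormZ gtr0_norm//.
  by rewrite -ltr_pdivlMl// mulVf// gt_eqF.
by rewrite -ltr_pdivlMl// mulVf// gt_eqF.
Qed.

Lemma measurable_box (a b : 'I_n -> R) :
  measurable [set x : 'rV[R]_n | forall i, (x ord0 i \in `[a i, b i])%R].
Proof.
rewrite (_ : [set _ | _] = \bigcap_(i in [set: 'I_n])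
    ((fun x : 'rV[R]_n => x ord0 i) @^-1` `[a i, b i])).
  apply: fin_bigcap_measurable => // i _.
  by rewrite -[X in measurable X]setTI; apply: measurable_coord.
apply/seteqP; split => x /= H i; first by move=> _; exact: H.
exact: H.
Qed.

Lemma lebesgue_eball_gt0 a r : (0 < n)%N -> (0 < r)%R -> 0 < lebesgue_rV (eball a r).
Proof.
move=> n0 r0; have e0 : (0 < r / (n.+1)%:R)%R by rewrite divr_gt0.
set e := (r / n.+1%:R)%R in e0.
have := @lebesgue_rV_box R n (fun i => a ord0 i - e)%R (fun i => a ord0 i + e)%R.
move=> /(_ _)/wrap[]; first by move=> i; lra.
set S := [set x | _] => SE.
apply: (@lt_le_trans _ _ (lebesgue_rV S)).
  rewrite SE lte_fin; apply: prodr_gt0 => i _; lra.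
apply: le_mu; [exact: measurable_box|exact: measurable_eball|].
move=> x Sx; rewrite /eball/=; apply: (@le_lt_trans _ _ (n%:R * e)%R).
  apply: enorm_le_coords => // i; rewrite !mxE.
  have := Sx i; rewrite in_itv/= ler_norml => /andP[? ?].
  by apply/andP; split; lra.
by rewrite /e mulrA ltr_pdivrMr// mulrC ltr_pM2l// ltr_nat.
Qed.

Lemma lebesgue_eball_fin a r : (0 < r)%R -> lebesgue_rV (eball a r) < +oo.
Proof.
move=> r0.
have := @lebesgue_rV_box R n (fun i => a ord0 i - r)%R (fun i => a ord0 i + r)%R.
move=> /(_ _)/wrap[]; first by move=> i; lra.
set S := [set x | _] => SE.
apply: (@le_lt_trans _ _ (lebesgue_rV S)); last by rewrite SE ltry.
apply: le_mu; [exact: measurable_eball|exact: measurable_box|].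
move=> x; rewrite /eball/= => xr i; have := le_lt_trans (coord_le_enorm (x - a) i) xr.
by rewrite !mxE ltr_norml in_itv/= => /andP[? ?]; apply/andP; split; lra.
Qed.

End euclidean_balls.

Definition ball_volume (R : realType) (n : nat) : R :=
  fine (lebesgue_rV (eball (0 : 'rV[R]_n) 1)).

Lemma ball_volume_gt0 (R : realType) (n : nat) : (0 < n)%N -> 0 < ball_volume R n.
Proof.
move=> n0; apply: fine_gt0; rewrite lebesgue_eball_gt0//=.
exact: lebesgue_eball_fin.
Qed.

Lemma lebesgue_eball (R : realType) (n : nat) (a : 'rV[R]_n) (r : R) : 0 < r ->
  lebesgue_rV (eball a r) = (r ^+ n * ball_volume R n)%:E.
Proof.
move=> r0; rewrite lebesgue_eballE// EFinM fineK// ge0_fin_numE//.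
exact: lebesgue_eball_fin.
Qed.

(** * The dyadic grid *)

Section dyadic_grid.
Context {R : realType} {n : nat}.
Variables (n_gt0 : (0 < n)%N) (c : 'rV[R]_n) (L : R) (L0 : 0 < L).

Definition cell_side k : R := L / 2 ^+ k.

(** The cells of level k are the half-open cubes of side L / 2^k of the grid
    based at c; their integer positions are encoded by natural numbers, to fit
    partitions with labels in nat. *)
Definition cell_pos k (x : 'rV[R]_n) : 'rV[int]_n :=
  \row_i Num.floor ((x ord0 i - c ord0 i) / cell_side k).

Definition cell_idx k (x : 'rV[R]_n) : nat := pickle (cell_pos k x).

Definition cell_corner k (i : nat) : 'rV[R]_n :=
  if unpickle i is Some v then
    \row_j (c ord0 j + cell_side k * ((v : 'rV[int]_n) ord0 j)%:~R)
  else c.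

Let side0 k : 0 < cell_side k.
Proof. by rewrite divr_gt0// exprn_gt0. Qed.

Lemma cell_side_gt0 k : 0 < cell_side k. Proof. exact: side0. Qed.

Lemma cell_posP k x (v : 'rV[int]_n) : cell_pos k x = v <->
  forall i, c ord0 i + cell_side k * (v ord0 i)%:~R <= x ord0 i <
            c ord0 i + cell_side k * (v ord0 i + 1)%:~R.
Proof.
have H i (m : int) : (Num.floor ((x ord0 i - c ord0 i) / cell_side k) == m) =
    (c ord0 i + cell_side k * m%:~R <= x ord0 i <
            c ord0 i + cell_side k * (m + 1)%:~R).
  rewrite floor_eq ler_pdivlMr// ltr_pdivrMr//.
  by rewrite lerBrDl ltrBlDl (mulrC _%:~R) [in X in _ && X](mulrC _%:~R).
split=> [<- i|xv]; first by rewrite -H mxE.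
by apply/rowP => i; rewrite mxE; apply/eqP; rewrite H.
Qed.

Lemma cell_idxP k x y : cell_idx k x = cell_idx k y <-> cell_pos k x = cell_pos k y.
Proof. by split=> [/(pcan_inj pickleK)|xy]//; rewrite /cell_idx xy. Qed.

Lemma cell_cornerE k x j :
  cell_corner k (cell_idx k x) ord0 j =
  c ord0 j + cell_side k * (cell_pos k x ord0 j)%:~R.
Proof. by rewrite /cell_corner /cell_idx pickleK mxE. Qed.

Lemma cell_bounds k x j :
  cell_corner k (cell_idx k x) ord0 j <= x ord0 j <
  cell_corner k (cell_idx k x) ord0 j + cell_side k.
Proof.
rewrite cell_cornerE; have /cell_posP/(_ j) := erefl (cell_pos k x).
by rewrite intrD mulrDr mulr1 addrA.
Qed.

Lemma cell_nested k x y : cell_idx k.+1 x = cell_idx k.+1 y -> cell_idx k x = cell_idx k y.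
Proof.
move=> /cell_idxP xy; apply/cell_idxP/rowP => i; rewrite !mxE.
move/rowP : xy => /(_ i); rewrite !mxE.
have h z : (z ord0 i - c ord0 i) / cell_side k.+1 =
    2 * ((z ord0 i - c ord0 i) / cell_side k).
  by rewrite /cell_side exprS; field; rewrite ?gt_eqF ?exprn_gt0//.
rewrite !h; move: (_ / _) (_ / _) => u v uv.
apply/esym/eqP; rewrite floor_eq.
have /andP[v1 v2] := floor_itv v.
have : (2 * Num.floor v <= Num.floor (2 * v))%R.
  by rewrite floor_ge_int intrM ler_pM2l.
have : (Num.floor (2 * v) < 2 * (Num.floor v + 1))%R.
  by rewrite floor_lt_int intrM ltr_pM2l.
rewrite uv floor_ge_int floor_lt_int !intrM ler_pM2l// ltr_pM2l//.
by move=> -> ->.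
Qed.

Lemma measurable_cell k i : measurable (atom cell_idx k i).
Proof.
have [[x xi]|nx] := pselect (exists x, cell_idx k x = i); last first.
  rewrite (_ : atom _ _ _ = set0)//.
  by rewrite -subset0 => x /= xi; apply: nx; exists x.
rewrite (_ : atom _ _ _ = \bigcap_(j in [set: 'I_n])
    ((fun x : 'rV[R]_n => x ord0 j) @^-1`
      `[(cell_corner k i ord0 j), (cell_corner k i ord0 j + cell_side k)[)).
  apply: fin_bigcap_measurable => // j _.
  by rewrite -[X in measurable X]setTI; apply: measurable_coord.
apply/seteqP; split => y; rewrite /atom/=.
  by move=> <- j _ /=; rewrite in_itv/=; exact: cell_bounds.
move=> H; rewrite -xi; apply/cell_idxP/cell_posP => j.
have := H j I; rewrite /= in_itv/= -xi cell_cornerE.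
by rewrite intrD mulrDr mulr1 addrA.
Qed.

Lemma cell_side_small (e : R) : 0 < e -> exists k, cell_side k < e.
Proof.
move=> e0; exists (Num.bound (L / e)).
rewrite /cell_side ltr_pdivrMr ?exprn_gt0// mulrC -ltr_pdivrMr//.
apply: lt_le_trans (archi_boundP _) _; first by rewrite divr_ge0// ltW.
by rewrite -natrX ler_nat ltnW// ltn_expl.
Qed.

(** Each coordinate is the supremum over k of the corners of the cells of level
    k, since the sides tend to zero. *)
Lemma measurable_generated_by_cells (A : set 'rV[R]_n) : measurable A ->
  <<s [set B | exists k i, B = atom cell_idx k i] >> A.
Proof.
set G := [set B | _].
pose GT : measurableType G.-sigma := g_sigma_algebraType G.
suff sub : g_sigma_preimage (fun (i : 'I_n) (x : 'rV[R]_n) => x ord0 i) `<=` <<s G >>.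
  exact: sub.
have sat k (E : set 'rV[R]_n) : saturated cell_idx k E -> <<s G >> E.
  move=> sE.
  have -> : E = \bigcup_(i in cell_idx k @` E) atom cell_idx k i.
    apply/seteqP; split => [x Ex|x [_ [y Ey <-] /=]].
      by exists (cell_idx k x) => //; exists x.
    by move=> xy; exact: (sE y).
  apply: (@bigcup_measurable _ GT) => i _.
  by apply: sub_sigma_algebra; exists k, i.
apply: smallest_sub; first exact: smallest_sigma_algebra.
rewrite -bigcup_seq; apply: bigcup_sub => j _ _ [B mB <-]; rewrite setTI.
have : measurable_fun [set: GT] ((fun x : 'rV[R]_n => x ord0 j) : GT -> R).
  move=> mT; apply: (measurability _ (RGenOInfty.measurableE R)) => //.
  move=> _ [_ [y ->] <-]; rewrite setTI.
  rewrite (_ : _ @^-1` _ = \bigcup_k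
     [set x | y < cell_corner k (cell_idx k x) ord0 j]).
    apply: bigcup_measurable => k _; apply: (sat k) => x z /=.
    by move=> + <-.
  apply/seteqP; split => x /=; rewrite in_itv/= andbT.
    rewrite -subr_gt0 => yx; have [k ks] := cell_side_small yx.
    exists k => //=; have /andP[_] := cell_bounds k x j; lra.
  by move=> [k _ /= yk]; have /andP[h _] := cell_bounds k x j; exact: lt_le_trans h.
by move=> /(_ measurableT B mB); rewrite setTI.
Qed.

Lemma cell_sub_eball k i : atom cell_idx k i `<=` eball (cell_corner k i) (n.+1%:R * cell_side k).
Proof.
move=> x <-; rewrite /eball/=; apply: (@le_lt_trans _ _ (n%:R * cell_side k)).
  apply: enorm_le_coords => // j; rewrite !mxE.
  have /andP[h1 h2] := cell_bounds k x j; rewrite ger0_norm; lra.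
by rewrite ltr_pM2r// ltr_nat.
Qed.

Lemma cell_volume_ge k x :
  (((cell_side k / 2) ^+ n)%:E <= lebesgue_rV (atom cell_idx k (cell_idx k x)))%E.
Proof.
set q := cell_corner k (cell_idx k x).
have := @lebesgue_rV_box R n (fun i => q ord0 i)%R (fun i => q ord0 i + cell_side k / 2)%R.
move=> /(_ _)/wrap[]; first by move=> i; rewrite lerDl ltW// divr_gt0.
set S := [set x | _] => SE.
apply: (@le_trans _ _ (lebesgue_rV S)).
  rewrite SE lee_fin (eq_bigr (fun=> cell_side k / 2)); last by move=> i _; lra.
  by rewrite prodr_const card_ord.
apply: le_mu; [exact: measurable_box|exact: measurable_cell|].
move=> y Sy; rewrite /atom/=; apply/cell_idxP/cell_posP => j.
have := Sy j; rewrite in_itv/= /q cell_cornerE => /andP[-> /=].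
rewrite intrD mulrDr mulr1 addrA => h; apply: le_lt_trans h _.
by rewrite ltrD2l ltr_pdivrMr// mulrC ltr_pMl// ltr1n.
Qed.

End dyadic_grid.

Lemma powR_addle (R : realType) (q x y : R) : 0 < q -> 0 <= x -> 0 <= y ->
  (x + y) `^ q <= 2 `^ q * (x `^ q + y `^ q).
Proof.
move=> q0 x0 y0; have [xy|/ltW yx] := leP x y.
  apply: (@le_trans _ _ ((2 * y) `^ q)).
    by apply: ge0_ler_powR; rewrite ?nnegrE ?addr_ge0 ?mulr_ge0 ?(ltW q0)//; lra.
  by rewrite powRM// ler_wpM2l ?powR_ge0// lerDr powR_ge0.
apply: (@le_trans _ _ ((2 * x) `^ q)).
  by apply: ge0_ler_powR; rewrite ?nnegrE ?addr_ge0 ?mulr_ge0 ?(ltW q0)//; lra.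
by rewrite powRM// ler_wpM2l ?powR_ge0// lerDl powR_ge0.
Qed.

(** * Averages over balls, fair weights and BMO *)

Section bmo.
Context {R : realType} {n : nat}.
Hypothesis n_gt0 : (0 < n)%N.
Local Open Scope ereal_scope.
Local Notation leb := (@lebesgue_rV R n).
Implicit Types (a : 'rV[R]_n) (r : R) (b w : 'rV[R]_n -> R).

Definition favg b a r : R := fine (avg a r (EFin \o b)).

Let vol0 : (0 < ball_volume R n)%R. Proof. exact: ball_volume_gt0. Qed.

Lemma bmo_osc b (beta : R) a r : (0 < r)%R -> bmo_seminorm b <= beta%:E ->
  \int[leb]_(x in eball a r) (`|b x - favg b a r|%R)%:E <= beta%:E * leb (eball a r).
Proof.
move=> r0 bb; have : avg a r (fun x => (`|b x - favg b a r|%R)%:E) <= beta%:E.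
  by apply: le_trans bb; apply: ereal_sup_ubound; exists (a, r).
rewrite /avg lebesgue_eball// inver gt_eqF ?mulr_gt0 ?exprn_gt0//.
by rewrite lee_pdivrMl ?mulr_gt0 ?exprn_gt0// muleC.
Qed.

Lemma favg_dist b a r (k : R) : (0 < r)%R -> loc_integrable b ->
  (`|favg b a r - k|%R)%:E * leb (eball a r) <=
  \int[leb]_(x in eball a r) (`|b x - k|%R)%:E.
Proof.
move=> r0 [mb ib]; have iB := ib a r r0.
have v0 : (0 < r ^+ n * ball_volume R n)%R by rewrite mulr_gt0 ?exprn_gt0.
set v := (r ^+ n * _)%R in v0.
have mB : measurable (eball a r) by exact: measurable_eball.
have fin : \int[leb]_(x in eball a r) (b x)%:E \is a fin_num.
  exact: integrable_fin_num.
have ik : leb.-integrable (eball a r) (fun=> k%:E).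
  apply/integrableP; split => //.
  have lB : leb (eball a r) < +oo by rewrite lebesgue_eball// ltry.
  by rewrite (integral_cst leb mB `|k%:E|); exact: lte_mul_pinfty.
have eqi : \int[leb]_(x in eball a r) (b x - k)%:E = ((favg b a r - k) * v)%:E.
  under eq_integral do rewrite EFinB.
  transitivity (\int[leb]_(x in eball a r) (b x)%:E - k%:E * v%:E).
    rewrite integralB//; congr (_ - _).
    rewrite (integral_cst leb mB k%:E); congr (_ * _); exact: lebesgue_eball.
  rewrite /favg /avg lebesgue_eball// -/v inver gt_eqF//=.
  move: fin; case: (\int[leb]_(x in eball a r) (b x)%:E) => // I _.
  rewrite -EFinD -EFinM/=; congr EFin.
  by field; rewrite gt_eqF.
have mbk : measurable_fun (eball a r) (fun x => (b x - k)%:E).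
  by apply/measurable_EFinP/measurable_funTS; exact: measurable_funB.
apply: le_trans (le_abse_integral leb mB mbk).
rewrite eqi lebesgue_eball// -/v -EFinM abse_EFin lee_fin normrM.
by rewrite (gtr0_norm v0).
Qed.

(** Both averages are compared through the larger ball: the oscillation of b
    over the smaller one is at most its oscillation over the larger one times
    the ratio of the volumes. *)
Lemma favg_sub b (beta : R) a r a' r' : (0 < r)%R -> (0 < r')%R ->
  loc_integrable b ->
  bmo_seminorm b <= beta%:E -> eball a r `<=` eball a' r' ->
  (`|favg b a r - favg b a' r'| <= (r' / r) ^+ n * beta)%R.
Proof.
move=> r0 r'0 lb bb sub.
have v0 : (0 < r ^+ n * ball_volume R n)%R by rewrite mulr_gt0 ?exprn_gt0.
have := favg_dist a (favg b a' r') r0 lb.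
have : \int[leb]_(x in eball a r) (`|b x - favg b a' r'|%R)%:E <=
    beta%:E * leb (eball a' r').
  apply: le_trans (bmo_osc _ r'0 bb); apply: ge0_subset_integral => //.
  - exact: measurable_eball.
  - exact: measurable_eball.
  - apply/measurable_EFinP/measurable_funTS; apply: measurableT_comp => //.
    by apply: measurable_funB => //; exact: lb.1.
move=> /[swap] /le_trans /[apply].
rewrite !lebesgue_eball// -!EFinM lee_fin -ler_pdivlMr// => /le_trans; apply.
rewrite le_eqVlt; apply/orP; left; apply/eqP; rewrite expr_div_n; field.
by rewrite !gt_eqF// exprn_gt0.
Qed.

(** Telescoping over the radii 2^j r, j < k. *)
Lemma favg_dilate b (beta : R) a r k : (0 < r)%R -> loc_integrable b ->
  (0 <= beta)%R -> bmo_seminorm b <= beta%:E ->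
  (`|favg b a r - favg b a (2 ^+ k * r)| <= k%:R * (2 ^+ n * beta))%R.
Proof.
move=> r0 lb b0 bb; elim: k => [|k IH].
  by rewrite expr0 mul1r subrr normr0 mul0r.
apply: (le_trans (ler_distD (favg b a (2 ^+ k * r)) _ _)).
rewrite -[k.+1%:R]natr1 mulrDl mul1r; apply: lerD => //.
have k0 : (0 < 2 ^+ k * r)%R by rewrite mulr_gt0 ?exprn_gt0.
have k1 : (0 < 2 ^+ k.+1 * r)%R by rewrite mulr_gt0 ?exprn_gt0.
apply: le_trans (favg_sub k0 k1 lb bb _) _.
  by apply: eball_subr; rewrite ler_pM2r// ler_eXn2l ?ltr1n.
rewrite exprS -!mulrA [X in ((2 * X) ^+ n)%R](_ : _ = 1)%R ?mulr1//.
by rewrite mulrA divff// gt_eqF.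
Qed.

(** A quantitative form of the A_oo condition: a subset of a ball with a fixed
    share 1/N of the volume carries a fixed share eta of the weight. It implies
    doubling, and it is all that the John-Nirenberg argument asks of a
    weight. *)
Definition fair_weight w := forall N : R, exists2 eta : R, (0 < eta < 1)%R &
  forall a r E, (0 < r)%R -> measurable E -> E `<=` eball a r ->
  leb (eball a r) <= N%:E * leb E ->
  eta%:E * wmeas w (eball a r) <= wmeas w E.

Section fair.
Variable w : 'rV[R]_n -> R.
Hypotheses (mw : measurable_fun setT w) (w0 : forall x, (0 <= w x)%R).
Hypothesis wfin : forall a r, (0 < r)%R -> wmeas w (eball a r) < +oo.
Hypothesis wfair : fair_weight w.

Lemma le_wmeas (A B : set 'rV[R]_n) : A `<=` B -> wmeas w A <= wmeas w B.
Proof. by move=> AB; apply: le_integral_sub => // x; rewrite lee_fin. Qed.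

(** The small ball is a subset of the large one with a share of the volume at
    least N^(-n). *)
Lemma fair_doubling (N : R) : exists2 C : R, (0 < C)%R &
  forall a r a' r', (0 < r)%R -> (0 < r')%R -> (r' <= N * r)%R ->
    eball a r `<=` eball a' r' ->
    wmeas w (eball a' r') <= C%:E * wmeas w (eball a r).
Proof.
have [eta /andP[eta0 _] H] := wfair (N ^+ n)%R.
exists (eta^-1)%R; first by rewrite invr_gt0.
move=> a r a' r' r0 r'0 rN sub; rewrite muleC lee_pdivlMr// muleC.
apply: H => //; first exact: measurable_eball.
rewrite !lebesgue_eball// -EFinM lee_fin mulrA ler_wpM2r ?(ltW vol0)//.
by rewrite -exprMn lerXn2r// ?nnegrE ltW// (lt_le_trans _ rN).
Qed.

(** The ball lies in a dyadic cube of side 2 r, which lies in a ball of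
    comparable radius. Oscillations over cubes are controlled by those over
    circumscribed balls, the inequality on cubes gives exponential decay, and
    doubling returns from the cube to the ball. *)
Lemma weighted_bmo (q : R) : (0 < q)%R -> exists2 C : R, (0 < C)%R &
  forall b (beta : R), loc_integrable b -> (0 < beta)%R ->
  bmo_seminorm b <= beta%:E -> forall a r, (0 < r)%R ->
  \int[leb]_(x in eball a r) (`|b x - favg b a r| `^ q * w x)%:E <=
  (C * beta `^ q)%:E * wmeas w (eball a r).
Proof.
move=> q0; set vol := ball_volume R n.
(* A cube of side d fits in a ball of radius (n + 1) d around its corner; the
   strict inequality defining balls is why n + 1 and not n. *)
pose n1 : R := n.+1%:R.
have n10 : (0 < n1)%R by rewrite ltr0n.
pose D0 : R := ((2 * n1) ^+ n * vol)%R.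
pose D : R := ((4 * n1) ^+ n * vol + 1)%R.
have D00 : (0 < D0)%R by rewrite mulr_gt0// exprn_gt0// mulr_gt0.
have D1 : (1 <= D)%R by rewrite lerDr mulr_ge0 ?exprn_ge0 ?mulr_ge0 ?ltW.
have [eta eta01 Heta] := wfair (2 * D0)%R.
have th01 : (0 < 1 - eta < 1)%R by case/andP: eta01 => ? ?; apply/andP; split; lra.
have [C1 C10 moment] := moment_of_decay q0 th01.
have [C2 C20 dbl] := fair_doubling (3 * n1)%R.
pose A : R := ((2 * n1) ^+ n)%R.
have A0 : (0 < A)%R by rewrite exprn_gt0// mulr_gt0.
pose L1 : R := ((5 + 2 * D) * D0)%R.
have L10 : (0 < L1)%R by rewrite mulr_gt0//; lra.
exists (2 `^ q * (C1 * L1 `^ q * C2 + A `^ q))%R.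
  by rewrite mulr_gt0 ?powR_gt0// addr_gt0 ?powR_gt0// !mulr_gt0// powR_gt0.
move=> b beta lb beta0 bb a r r0.
pose c : 'rV[R]_n := (a - const_mx r)%R.
have rr0 : (0 < 2 * r)%R by rewrite mulr_gt0.
pose idx := cell_idx c (2 * r)%R.
pose cor := cell_corner c (2 * r)%R.
pose sd := cell_side (2 * r)%R.
have sd0 k : (0 < sd k)%R by exact: cell_side_gt0.
have nsd0 k : (0 < n1 * sd k)%R by rewrite mulr_gt0.
pose m k i := favg b (cor k i) (n1 * sd k)%R.
have mat k i : measurable (atom idx k i) by exact: measurable_cell.
have atom_ball k i : atom idx k i `<=` eball (cor k i) (n1 * sd k).
  exact: cell_sub_eball.
have ball_atom k x : leb (eball (cor k (idx k x)) (n1 * sd k)) <=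
    D0%:E * leb (atom idx k (idx k x)).
  apply: (@le_trans _ _ (D0%:E * ((sd k / 2) ^+ n)%:E)); last first.
    by apply: lee_wpmul2l; [rewrite lee_fin ltW|exact: cell_volume_ge].
  rewrite lebesgue_eball// -EFinM lee_fin /D0 -/vol [leRHS]mulrAC -exprMn.
  by rewrite (_ : 2 * n1 * (sd k / 2) = n1 * sd k)%R//; field.
have empty_or k i : (exists x, idx k x = i) \/ atom idx k i = set0.
  have [|nx] := pselect (exists x, idx k x = i); [by left|right].
  by rewrite -subset0 => x xi; apply: nx; exists x.
have lebfin (B : set 'rV[R]_n) k i : measurable B -> B `<=` eball (cor k i) (n1 * sd k) -> leb B < +oo.
  move=> mB Bs; apply: (@le_lt_trans _ _ (leb (eball (cor k i) (n1 * sd k)))).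
    by apply: le_mu => //; exact: measurable_eball.
  by rewrite lebesgue_eball// ltry.
have mdev k (s : R) : measurable_fun setT (fun x => (`|b x - s|%R `^ k)%R).
  apply: (measurableT_comp (measurable_powR _)); apply: measurableT_comp => //.
  by apply: measurable_funB => //; exact: lb.1.
have mdev1 (s : R) : measurable_fun setT (fun x => (`|b x - s|%R)%R).
  apply: measurableT_comp => //.
  by apply: measurable_funB => //; exact: lb.1.
have D0b0 : (0 < D0 * beta)%R by rewrite mulr_gt0.
have JN := @weighted_john_nirenberg _ _ R leb idx mat (cell_nested rr0)
  (measurable_generated_by_cells rr0) w b m (D0 * beta)%R D eta mw w0 lb.1 D0b0 D1 eta01.
have {}JN j k i : wmeas w (atom idx k i `&` [set x | j%:R * ((5 + 2 * D) * (D0 * beta)) < `|b x - m k i|]%R) <=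
    ((1 - eta) ^+ j)%:E * wmeas w (atom idx k i).
  apply: JN.
  - by move=> k' i'; apply: lebfin (mat _ _) (@atom_ball _ _).
  - move=> k' i'; have [[x <-]|->] := empty_or k' i'; last first.
      by rewrite integral_set0 measure0 mule0.
    apply: (@le_trans _ _ (\int[leb]_(x0 in eball (cor k' (idx k' x)) (n1 * sd k'))
        `|b x0 - m k' (idx k' x)|%:E)).
      apply: ge0_subset_integral => //; first exact: measurable_eball.
      exact/measurable_EFinP/measurable_funTS.
    apply: (le_trans (bmo_osc _ _ bb)) => //.
    rewrite (mulrC D0) (EFinM beta) -muleA; apply: lee_wpmul2l; first by rewrite lee_fin ltW.
    exact: ball_atom.
  - move=> k' x; apply: (@le_trans _ _ (leb (eball (cor k' (idx k' x)) (n1 * sd k')))).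
      by apply: le_mu => //; exact: measurable_eball.
    apply: (@le_trans _ _ (D%:E * ((sd k'.+1 / 2) ^+ n)%:E)); last first.
      by apply: lee_wpmul2l; [rewrite lee_fin; lra|exact: cell_volume_ge].
    rewrite lebesgue_eball// -EFinM lee_fin.
    apply: (@le_trans _ _ ((4 * n1) ^+ n * vol * (sd k'.+1 / 2) ^+ n)%R).
      rewrite [leRHS]mulrAC -exprMn (_ : 4 * n1 * (sd k'.+1 / 2) = n1 * sd k')%R//.
      rewrite /sd /cell_side exprS; field.
      by rewrite gt_eqF// exprn_gt0.
    by apply: ler_wpM2r; rewrite ?lerDl// exprn_ge0// divr_ge0// (ltW (sd0 _)).
  - move=> k' i'; apply: (@le_lt_trans _ _ (wmeas w (eball (cor k' i') (n1 * sd k')))).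
      exact: le_wmeas.
    exact: wfin.
  - move=> k' i' E mE EA AE; have [[x xi]|A_0] := empty_or k' i'; last first.
      rewrite A_0 integral_set0 mule0; apply: integral_ge0 => x _.
      by rewrite lee_fin.
    apply: (@le_trans _ _ (eta%:E * wmeas w (eball (cor k' i') (n1 * sd k')))).
      apply: lee_wpmul2l; first by case/andP: eta01 => /ltW ? _; rewrite lee_fin.
      exact: le_wmeas.
    apply: Heta => //; first exact: subset_trans EA (@atom_ball _ _).
    rewrite -xi; apply: (le_trans (ball_atom _ _)).
    rewrite (mulrC 2%R) (EFinM D0) -muleA; apply: lee_wpmul2l; first by rewrite lee_fin ltW.
    by rewrite xi.
pose i0 := idx 0%N c.
have cor0 : cor 0%N i0 = c.
  apply/rowP => j; rewrite /cor /i0 cell_cornerE.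
  have -> : cell_pos c (2 * r)%R 0 c ord0 j = 0%R by rewrite mxE subrr mul0r floor0.
  by rewrite mulr0 addr0.
have s0 : sd 0%N = (2 * r)%R by rewrite /sd /cell_side expr0 divr1.
have BQ : eball a r `<=` atom idx 0%N i0.
  move=> x; rewrite /eball/= => xa; apply/cell_idxP/rowP => j; rewrite !mxE.
  rewrite subrr mul0r floor0 -/(sd 0%N) s0; apply/eqP.
  have := le_lt_trans (coord_le_enorm (x - a)%R j) xa.
  rewrite !mxE ltr_norml => /andP[h1 h2].
  rewrite floor_eq ler_pdivlMr// ltr_pdivrMr// mul0r add0r mul1r; apply/andP; split; lra.
have QB' : atom idx 0%N i0 `<=` eball c (n1 * (2 * r)).
  by have := @atom_ball 0%N i0; rewrite cor0 s0.
have ca : (enorm (c - a) <= n%:R * r)%R.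
  by apply: enorm_le_coords => // j; rewrite !mxE addrAC subrr add0r normrN gtr0_norm.
have B'B : eball c (n1 * (2 * r)) `<=` eball a (3 * n1 * r).
  apply: eball_sub; apply: (le_trans (lerD ca (lexx _))).
  rewrite /n1 -natr1; nra.
have wQ : wmeas w (atom idx 0%N i0) <= C2%:E * wmeas w (eball a r).
  apply: (@le_trans _ _ (wmeas w (eball a (3 * n1 * r)))).
    by apply: le_wmeas; exact: subset_trans B'B.
  apply: dbl => //; first by rewrite !mulr_gt0.
  exact: subset_trans (subset_trans QB' B'B).
have mm : (`|m 0%N i0 - favg b a r| <= A * beta)%R.
  rewrite distrC /m cor0 s0; apply: (le_trans (favg_sub _ _ lb bb _)) => //.
  - by rewrite !mulr_gt0.
  - exact: subset_trans QB'.
  rewrite /A ler_wpM2r ?(ltW beta0)// le_eqVlt; apply/orP; left; apply/eqP.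
  by congr (_ ^+ n)%R; field; rewrite gt_eqF.
have mom : \int[leb]_(x in atom idx 0%N i0) (`|b x - m 0%N i0| `^ q * w x)%:E <=
   (C1 * (L1 * beta) `^ q)%:E * wmeas w (atom idx 0%N i0).
  apply: moment => //; first by rewrite mulr_gt0.
  by move=> j; have := JN j 0%N i0; rewrite /L1 -mulrA.
have mB : measurable (eball a r) by exact: measurable_eball.
have W0 : 0 <= wmeas w (eball a r) by apply: integral_ge0 => x _; rewrite lee_fin.
apply: (@le_trans _ _ (\int[leb]_(x in eball a r)
   ((2 `^ q)%:E * ((`|b x - m 0%N i0| `^ q * w x)%:E + ((A * beta) `^ q)%:E * (w x)%:E)))).
  apply: le_lower_integral => x Bx.
    by rewrite lee_fin mulr_ge0// powR_ge0.
  rewrite -(EFinM ((A * beta) `^ q)%R) -EFinD -EFinM lee_fin -mulrDl mulrA ler_wpM2r//.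
  apply: le_trans (powR_addle _ _ _) => //; last by rewrite mulr_ge0 ?ltW.
  apply: ge0_ler_powR; rewrite ?nnegrE ?(ltW q0) ?addr_ge0 ?mulr_ge0 ?(ltW A0) ?(ltW beta0)//.
  by apply: (le_trans (ler_distD (m 0%N i0) _ _)); rewrite lerD2l.
have mbw : measurable_fun (eball a r) (fun x => (`|b x - m 0%N i0| `^ q * w x)%:E).
  by apply/measurable_EFinP/measurable_funTS; exact: measurable_funM.
have mAw : measurable_fun (eball a r) (fun x => ((A * beta) `^ q)%:E * (w x)%:E).
  apply: measurable_funeM; exact/measurable_EFinP/measurable_funTS.
rewrite ge0_integralZl//; last 2 first.
- exact: emeasurable_funD.
- by move=> x _; rewrite adde_ge0// -?EFinM lee_fin mulr_ge0// powR_ge0.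
rewrite ge0_integralD//; last 2 first.
- by move=> x _; rewrite lee_fin mulr_ge0// powR_ge0.
- by move=> x _; rewrite -?EFinM lee_fin mulr_ge0// powR_ge0.
rewrite -mulrA EFinM -muleA; apply: lee_wpmul2l; first by rewrite lee_fin powR_ge0.
rewrite ge0_integralZl; first last.
- by rewrite lee_fin powR_ge0.
- by move=> x _; rewrite lee_fin.
- exact/measurable_EFinP/measurable_funTS.
- exact: mB.
rewrite mulrDl EFinD ge0_muleDl ?lee_fin ?mulr_ge0 ?powR_ge0 ?(ltW C10) ?(ltW C20)//.
apply: leeD; last by rewrite powRM// ltW.
apply: (@le_trans _ _ (\int[leb]_(x in atom idx 0%N i0) (`|b x - m 0%N i0| `^ q * w x)%:E)).
  apply: ge0_subset_integral => //.
    by apply/measurable_EFinP/measurable_funTS; exact: measurable_funM.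
  by move=> x _; rewrite lee_fin mulr_ge0// powR_ge0.
apply: (le_trans mom).
apply: (@le_trans _ _ ((C1 * (L1 * beta) `^ q)%:E * (C2%:E * wmeas w (eball a r)))).
  by apply: lee_wpmul2l => //; rewrite lee_fin mulr_ge0 ?powR_ge0 ?(ltW C10).
rewrite muleA -EFinM powRM ?(ltW L10) ?(ltW beta0)//.
rewrite (_ : C1 * (L1 `^ q * beta `^ q) * C2 = C1 * L1 `^ q * C2 * beta `^ q)%R//.
by ring.
Qed.

End fair.

End bmo.

(** * Pairs of weights with bounded averages *)

Section muckenhoupt_pairs.
Context {R : realType} {n : nat}.
Hypothesis n_gt0 : (0 < n)%N.
Local Open Scope ereal_scope.
Local Notation leb := (@lebesgue_rV R n).
Implicit Types (a : 'rV[R]_n) (r : R) (u v w : 'rV[R]_n -> R).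

Let ball_vol r : R := (r ^+ n * ball_volume R n)%R.

Let ball_vol_gt0 r : (0 < r)%R -> (0 < ball_vol r)%R.
Proof. by move=> r0; rewrite mulr_gt0 ?exprn_gt0 ?ball_volume_gt0. Qed.

Lemma wmeas_ge0 w E : (forall x, (0 <= w x)%R) -> 0 <= wmeas w E.
Proof. by move=> w0; apply: integral_ge0 => x _; rewrite lee_fin. Qed.

Lemma avgE w a r : (0 < r)%R ->
  avg a r (EFin \o w) = ((ball_vol r)^-1)%:E * wmeas w (eball a r).
Proof.
by move=> r0; rewrite /avg lebesgue_eball// inver gt_eqF// ball_vol_gt0.
Qed.

Lemma powRVl (x k : R) : (0 <= x)%R -> (x^-1 `^ k = (x `^ k)^-1)%R.
Proof. by move=> x0; rewrite -powR_inv1// -powRrM mulN1r powRN. Qed.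

Lemma avg_pair_le u v a r (k m C : R) : (0 < r)%R ->
  (forall x, (0 <= u x)%R) -> (forall x, (0 <= v x)%R) ->
  avg a r (EFin \o u) `^ k * avg a r (EFin \o v) `^ m <= C%:E ->
  wmeas u (eball a r) `^ k * wmeas v (eball a r) `^ m <=
    (C * ball_vol r `^ (k + m))%:E.
Proof.
move=> r0 u0 v0; have V0 := ball_vol_gt0 r0.
have Vi0 : 0 <= ((ball_vol r)^-1)%:E by rewrite lee_fin invr_ge0 ltW.
rewrite !avgE// !poweRM ?wmeas_ge0// muleACA !poweR_EFin -EFinM.
rewrite !powRVl ?(ltW V0)// -invfM -powRD; last by rewrite (gt_eqF V0) implybT.
by rewrite lee_pdivrMl ?powR_gt0// mulrC.
Qed.

Lemma wmeas_gt0 u a r : measurable_fun setT u -> (forall x, (0 <= u x)%R) ->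
  {ae leb, forall x, (0 < u x)%R} -> (0 < r)%R -> 0 < wmeas u (eball a r).
Proof.
move=> mu u0 upos r0; rewrite lt_neqAle eq_sym wmeas_ge0// andbT; apply/eqP => U0.
have mB : measurable (eball a r) by exact: measurable_eball.
have mu' : measurable_fun (eball a r) (EFin \o u).
  exact/measurable_EFinP/measurable_funTS.
have /(ae_eq_integral_abs leb mB mu').1 ae0 :
    \int[leb]_(x in eball a r) `|(EFin \o u) x| = 0.
  rewrite -U0; apply: eq_integral => x _.
  by rewrite /= ger0_norm.
have : {ae leb, forall x, ~ eball a r x}.
  apply: filterS2 upos ae0 => x ux /= h /h [] ux0.
  by rewrite ux0 ltxx in ux.
move=> nB; have /negligibleP : leb.-negligible (eball a r).
  by rewrite -[eball a r]setCK; exact: nB.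
by move=> /(_ mB) B0; have := lebesgue_eball_gt0 a n_gt0 r0; rewrite B0 ltxx.
Qed.

(** A bounded product with a positive factor has its other factor finite. *)
Lemma pair_lty (U V : \bar R) (k m c : R) : (0 < k)%R -> 0 < V ->
  0 <= U -> U `^ k * V `^ m <= c%:E -> U < +oo.
Proof.
move=> k0 V0; case: U => [x _ _| _|//]; first by rewrite ltry.
rewrite poweRyr ?gt_eqF// gt0_mulye ?poweR_gt0//.
Qed.

Section pair.
Variables (u v : 'rV[R]_n -> R) (k m C : R).
Hypotheses (k0 : (0 < k)%R) (m0 : (0 < m)%R) (C0 : (0 < C)%R).
Hypotheses (mu : measurable_fun setT u) (mv : measurable_fun setT v).
Hypotheses (u0 : forall x, (0 <= u x)%R) (v0 : forall x, (0 <= v x)%R).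
Hypotheses (upos : {ae leb, forall x, (0 < u x)%R}).
Hypotheses (vpos : {ae leb, forall x, (0 < v x)%R}).
Hypothesis pairC : forall a r, (0 < r)%R ->
  avg a r (EFin \o u) `^ k * avg a r (EFin \o v) `^ m <= C%:E.

Lemma pair_wmeas_fin a r : (0 < r)%R -> wmeas u (eball a r) < +oo.
Proof.
move=> r0; apply: (pair_lty k0 (wmeas_gt0 a mv v0 vpos r0) (wmeas_ge0 _ u0)).
exact: avg_pair_le (pairC a r0).
Qed.

Lemma pair_wmeas_fin2 a r : (0 < r)%R -> wmeas v (eball a r) < +oo.
Proof.
move=> r0; apply: (pair_lty m0 (wmeas_gt0 a mu u0 upos r0) (wmeas_ge0 _ v0)).
rewrite muleC; exact: avg_pair_le (pairC a r0).
Qed.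

Hypothesis uv1 : {ae leb, forall x, (1 <= u x `^ k * v x `^ m)%R}.

(** Hoelder's inequality for 1 <= u^(k/(k+m)) v^(m/(k+m)) on E. *)
Lemma pair_lower E : measurable E ->
  leb E `^ (k + m) <= wmeas u E `^ k * wmeas v E `^ m.
Proof.
move=> mE; have h0 : (0 < k + m)%R by rewrite addr_gt0.
pose t : R := (k + m)^-1%R.
have t0 : (0 < t)%R by rewrite invr_gt0.
have kt0 : (0 < k * t)%R by rewrite mulr_gt0.
have mt0 : (0 < m * t)%R by rewrite mulr_gt0.
have mF : measurable_fun setT (fun x => u x `^ (k * t))%R.
  exact: (measurableT_comp (measurable_powR _) mu).
have mG : measurable_fun setT (fun x => v x `^ (m * t))%R.
  exact: (measurableT_comp (measurable_powR _) mv).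
have h1 : leb E <= \int[leb]_(x in E) (u x `^ (k * t) * v x `^ (m * t))%:E.
  rewrite -[leLHS]mul1e -integral_cst//; apply: ae_ge0_le_integral => //.
  - by move=> x _; rewrite lee_fin mulr_ge0// powR_ge0.
  - by apply/measurable_EFinP/measurable_funTS; exact: measurable_funM.
  - apply: filterS uv1 => x uvx _; rewrite lee_fin !powRrM -powRM ?powR_ge0//.
    have := @ge0_ler_powR _ t (ltW t0) 1%R (u x `^ k * v x `^ m)%R.
    by rewrite powR1 !nnegrE ler01 mulr_ge0 ?powR_ge0//; exact.
have h2 := @hoelder_on _ _ R leb E (fun x => u x `^ (k * t))%R (fun x => v x `^ (m * t))%R
  (k * t)^-1%R (m * t)^-1%R mE (measurable_funTS mF) (measurable_funTS mG)
  (fun x => powR_ge0 _ _) (fun x => powR_ge0 _ _).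
rewrite !invr_gt0 !invrK in h2.
have {h2} := h2 kt0 mt0 _; rewrite -mulrDl mulfV ?gt_eqF// => /(_ erefl).
under [X in _ <= X `^ _ * _ -> _]eq_integral do rewrite -powRrM mulfV ?gt_eqF// powRr1//.
under [X in _ <= _ * X `^ _ -> _]eq_integral do rewrite -powRrM mulfV ?gt_eqF// powRr1//.
move=> h2; have {h1 h2} := le_trans h1 h2.
rewrite -/(wmeas u E) -/(wmeas v E) => h.
have := lee_poweR (ltW h0) (measure_ge0 leb E) h.
rewrite poweRM ?poweR_ge0// -!poweRrM -!mulrA mulVf ?gt_eqF//.
by rewrite !mulr1.
Qed.

(** For E in a ball B, |E|^(k+m) <= u(E)^k v(E)^m <= u(E)^k v(B)^m, while the
    bound on the averages reads u(B)^k v(B)^m <= C |B|^(k+m). Division gives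
    (|E|/|B|)^(k+m) <= C (u(E)/u(B))^k. *)
Lemma fair_pair : fair_weight u.
Proof.
move=> N; pose N1 := Num.max N 1%R.
have N10 : (0 < N1)%R by rewrite lt_max ltr01 orbT.
pose h := (k + m)%R.
have h0 : (0 < h)%R by rewrite addr_gt0.
pose M := (C * N1 `^ h)%R; have M0 : (0 < M)%R by rewrite mulr_gt0 ?powR_gt0.
pose e := (M `^ k^-1)^-1%R; have e0 : (0 < e)%R by rewrite invr_gt0 powR_gt0.
exists (Num.min e 2^-1)%R.
  apply/andP; split; first by rewrite lt_min e0/=; lra.
  by rewrite gt_min; apply/orP; right; lra.
move=> a r E r0 mE EB BE.
have mB : measurable (eball a r) by exact: measurable_eball.
have Epos : 0 < leb E.
  rewrite lt0e measure_ge0 andbT; apply/eqP => E0.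
  by have := lebesgue_eball_gt0 a n_gt0 r0; rewrite ltNge => /negP; apply; rewrite (le_trans BE)// E0 mule0.
have Efin : leb E < +oo.
  by apply: le_lt_trans (lebesgue_eball_fin a r0); exact: le_mu.
have uEB : wmeas u E <= wmeas u (eball a r) by exact: le_wmeas.
have vEB : wmeas v E <= wmeas v (eball a r) by exact: le_wmeas.
have ub := pair_wmeas_fin a r0; have vb := pair_wmeas_fin2 a r0.
have vB0 := wmeas_gt0 a mv v0 vpos r0.
have lo := pair_lower mE.
have hi := avg_pair_le r0 u0 v0 (pairC a r0).
have uE0 := wmeas_ge0 E u0.
have uB0 := wmeas_ge0 (eball a r) u0.
have lo' : leb E `^ h <= wmeas u E `^ k * wmeas v (eball a r) `^ m.
  apply: (le_trans lo); apply: lee_wpmul2l; first exact: poweR_ge0.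
  by apply: lee_poweR => //; [exact: ltW|exact: wmeas_ge0].
have uEfin := le_lt_trans uEB ub.
rewrite lebesgue_eball// in BE.
have u_E_fin : wmeas u E \is a fin_num by rewrite ge0_fin_numE.
have u_B_fin : wmeas u (eball a r) \is a fin_num by rewrite ge0_fin_numE.
have v_B_fin : wmeas v (eball a r) \is a fin_num by rewrite ge0_fin_numE// wmeas_ge0.
have E_fin : leb E \is a fin_num by rewrite ge0_fin_numE.
move: Epos BE lo' hi vB0 uE0 uB0.
case: (wmeas u E) u_E_fin => // x _; case: (wmeas u (eball a r)) u_B_fin => // y _.
case: (wmeas v (eball a r)) v_B_fin => // z _; case: (leb E) E_fin => // l _.
rewrite !poweR_EFin -!EFinM !lee_fin !lte_fin -/(ball_vol r) => l0 BE lo' hi z0 x0 y0.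
have zm0 : (0 < z `^ m)%R by rewrite powR_gt0.
have step : (y `^ k <= M * x `^ k)%R.
  rewrite -(ler_pM2r zm0); apply: (le_trans hi).
  rewrite /M -!mulrA ler_pM2l//; apply: (@le_trans _ _ (N1 `^ h * l `^ h)%R); last first.
    by rewrite ler_wpM2l// powR_ge0.
  rewrite -powRM ?(ltW l0) ?(ltW N10)//; apply: ge0_ler_powR; rewrite ?(ltW h0) ?nnegrE ?(ltW (ball_vol_gt0 r0))//.
    by rewrite mulr_ge0// ltW.
  by apply: (le_trans BE); rewrite ler_pM2r// le_max lexx.
have {}step : (y <= M `^ k^-1 * x)%R.
  have ki0 : (0 <= k^-1)%R by rewrite invr_ge0 ltW.
  have /(ge0_ler_powR ki0) : (y `^ k <= M * x `^ k)%R by [].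
  rewrite !nnegrE powR_ge0 mulr_ge0 ?powR_ge0 ?(ltW M0)// => /(_ isT isT).
  by rewrite powRM ?powR_ge0 ?(ltW M0)// -!powRrM mulfV ?gt_eqF// !powRr1.
apply: (@le_trans _ _ (e * y)%R); first by rewrite ler_wpM2r// ge_min lexx.
by rewrite /e ler_pdivrMl// powR_gt0.
Qed.

End pair.

End muckenhoupt_pairs.

(** * Pointwise comparison of the two weights *)

Section two_weights.
Context {R : realType} {n : nat}.
Hypothesis n_gt0 : (0 < n)%N.
Local Open Scope ereal_scope.
Local Notation leb := (@lebesgue_rV R n).
Implicit Types (a : 'rV[R]_n) (r : R) (u v w : 'rV[R]_n -> R).

Lemma measurable_wpow w p : measurable_fun setT w -> measurable_fun setT (wpow w p).
Proof. by move=> mw; exact: (measurableT_comp (measurable_powR _) mw). Qed.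

Lemma wpow_ge0 w p x : (0 <= wpow w p x)%R.
Proof. exact: powR_ge0. Qed.

Lemma wpow_wpow w p q : wpow (wpow w p) q = wpow w (p * q).
Proof. by apply/funext => x; rewrite /wpow powRrM. Qed.

(** Suppose that M w1 < rho < w2 on more than half of a dyadic cell, rho > 0.
    Then the averages of w2^q and w1^(-sigma) over the ball around the cell are
    at least multiples of rho^q and (M / rho)^sigma, and the powers of rho
    cancel in the product, which exceeds C when M is large. So this set has
    density at most 1/2 in every cell and is null; the set where w2 > M w1 is
    the union of such sets over rational rho. *)
Lemma ae_le_of_pair (w1 w2 : 'rV[R]_n -> R) (k m q sigma s C : R) :
  (0 < k)%R -> (0 < m)%R -> (0 < q)%R -> (0 < sigma)%R -> (0 < s)%R -> (0 < C)%R ->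
  (q * k = s)%R -> (sigma * m = s)%R ->
  measurable_fun setT w1 -> measurable_fun setT w2 ->
  {ae leb, forall x, (0 < w1 x)%R} ->
  (forall a r, (0 < r)%R ->
    avg a r (EFin \o wpow w2 q) `^ k * avg a r (EFin \o wpow w1 (- sigma)) `^ m <= C%:E) ->
  exists2 M : R, (0 < M)%R & {ae leb, forall x, (w2 x <= M * w1 x)%R}.
Proof.
move=> k0 m0 q0 sigma0 s0 C0 qk sm mw1 mw2 w1pos pairC.
pose D0 : R := ((2 * n.+1%:R) ^+ n * ball_volume R n)%R.
have D00 : (0 < D0)%R by rewrite mulr_gt0 ?ball_volume_gt0// exprn_gt0// mulr_gt0.
have D20 : (0 < 2 * D0)%R by rewrite mulr_gt0.
pose M : R := ((2 * C * (2 * D0) `^ (k + m)) `^ s^-1)%R.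
have B0 : (0 < 2 * C * (2 * D0) `^ (k + m))%R by rewrite !mulr_gt0// powR_gt0.
have M0 : (0 < M)%R by rewrite powR_gt0.
have Ms : (M `^ s = 2 * C * (2 * D0) `^ (k + m))%R.
  by rewrite /M -powRrM mulVf ?gt_eqF// powRr1// ltW.
clearbody M; exists M => //.
have L0 : (0 < 1 :> R)%R by [].
pose idx := @cell_idx R n 0%R 1%R.
have mat j i : measurable (atom idx j i) by exact: measurable_cell.
pose F (rho : R) i := atom idx 0%N i `&` [set x | (M * w1 x < rho)%R /\ (0 < w1 x)%R /\ (rho < w2 x)%R].
have mF rho i : measurable (F rho i).
  apply: measurableI => //.
  have -> : [set x | (M * w1 x < rho)%R /\ (0 < w1 x)%R /\ (rho < w2 x)%R] =
      (fun x => M * w1 x)%R @^-1` `]-oo, rho[ `&` (w1 @^-1` `]0%R, +oo[ `&` w2 @^-1` `]rho, +oo[).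
    by apply/seteqP; split => x /=; rewrite !in_itv/= ?andbT.
  apply: measurableI.
    rewrite -[X in measurable X]setTI.
    have mMw : measurable_fun setT (fun x => M * w1 x)%R by exact: measurable_funM.
    exact: mMw.
  by apply: measurableI; rewrite -[X in measurable X]setTI; [exact: mw1|exact: mw2].
have Fnull rho i : (0 < rho)%R -> leb (F rho i) = 0.
  move=> rho0.
  have ballfin j l : leb (eball (cell_corner 0 1 j l) (n.+1%:R * cell_side 1 j)) < +oo.
    by apply: lebesgue_eball_fin; rewrite mulr_gt0// cell_side_gt0.
  apply: (half_density_null mat (cell_nested L0) (measurable_generated_by_cells L0)
     (Q := atom idx 0%N i) (k0 := 0%N)) => //.
  - apply: le_lt_trans (ballfin 0%N i); apply: le_mu => //; first exact: measurable_eball.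
    exact: cell_sub_eball.
  - by move=> x [].
  move=> j x _; set A := atom idx j (idx j x).
  have [[y [Fy Ay]]|nFA] := pselect (exists y, F rho i y /\ A y); last first.
    have -> : F rho i `&` A = set0.
      by rewrite -subset0 => y [Fy Ay]; apply: nFA; exists y.
    by rewrite measure0 mule_ge0// lee_fin.
  have AQ : A `<=` atom idx 0%N i.
    move=> z zx; have [/= yi _] := Fy; rewrite /atom/= -yi.
    apply: (nested_le (cell_nested L0)) (leq0n j) _.
    exact: etrans zx (esym Ay).
  rewrite (setIidr AQ) leNgt; apply/negP => big.
  pose a : 'rV[R]_n := cell_corner (0 : 'rV[R]_n)%R (1 : R)%R j (idx j x); pose r : R := (n.+1%:R * cell_side 1 j)%R.
  have r0 : (0 < r)%R by rewrite mulr_gt0// cell_side_gt0.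
  have AB : A `<=` eball a r by exact: cell_sub_eball.
  have mA : measurable A by exact: mat.
  have mB : measurable (eball a r) by exact: measurable_eball.
  have mFA : measurable (F rho i `&` A) by exact: measurableI.
  have BA : leb (eball a r) <= (2 * D0)%:E * leb (F rho i `&` A).
    apply: (@le_trans _ _ (D0%:E * ((cell_side 1 j / 2) ^+ n)%:E)).
      rewrite lebesgue_eball// -EFinM lee_fin /D0 [leRHS]mulrAC -exprMn.
      by rewrite (_ : 2 * n.+1%:R * (cell_side 1 j / 2) = r)%R// /r; field.
    rewrite (mulrC 2%R) (EFinM D0) -muleA; apply: lee_wpmul2l; first by rewrite lee_fin ltW.
    apply: (le_trans (@cell_volume_ge R n 0%R 1%R L0 j x)).
    by rewrite -lee_pdivrMl//; exact: ltW.
  have V0 : (0 < r ^+ n * ball_volume R n)%R.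
    by rewrite mulr_gt0 ?ball_volume_gt0// exprn_gt0.
  set V := (r ^+ n * _)%R in V0.
  have lower (g : 'rV[R]_n -> R) (c : R) : (0 <= c)%R -> measurable_fun setT g ->
      (forall x, (0 <= g x)%R) -> (forall x, F rho i x -> (c <= g x)%R) ->
      (c / (2 * D0))%:E <= avg a r (EFin \o g).
    move=> c0 mg g0 cg; rewrite avgE// -/V.
    rewrite lee_pdivlMl//.
    apply: (@le_trans _ _ (c%:E * leb (F rho i `&` A))).
      rewrite (EFinM c) muleCA; apply: lee_wpmul2l => //.
      rewrite muleC lee_pdivrMl//.
      by move: BA; rewrite lebesgue_eball//.
    rewrite -integral_cst//; apply: (@le_trans _ _ (\int[leb]_(x in F rho i `&` A) (g x)%:E)).
      by apply: le_lower_integral => z; rewrite ?lee_fin// => -[Fz _]; exact: cg.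
    apply: ge0_subset_integral => //.
    - exact/measurable_EFinP/measurable_funTS.
    - by move=> z _; rewrite lee_fin.
    - by move=> z [_ Az]; exact: AB.
  have c1 : (rho `^ q / (2 * D0))%:E <= avg a r (EFin \o wpow w2 q).
    apply: lower; rewrite ?powR_ge0//; first exact: measurable_wpow.
      by move=> z; exact: powR_ge0.
    move=> z [_ [_ [_ zr]]]; apply: ge0_ler_powR; rewrite ?nnegrE ?(ltW q0)// ltW//.
    exact: lt_trans zr.
  have c2 : ((M / rho) `^ sigma / (2 * D0))%:E <= avg a r (EFin \o wpow w1 (- sigma)).
    apply: lower; rewrite ?powR_ge0//; first exact: measurable_wpow.
      by move=> z; exact: powR_ge0.
    move=> z [_ [zr [z0 _]]]; rewrite /wpow powRN -powRVl ?(ltW z0)//.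
    apply: ge0_ler_powR; rewrite ?nnegrE ?(ltW sigma0) ?divr_ge0 ?invr_ge0 ?(ltW M0) ?(ltW z0) ?(ltW rho0)//.
    by rewrite ler_pdivrMr// mulrC ler_pdivlMr// ltW.
  have := pairC a r r0; apply/negP; rewrite -ltNge.
  apply: (@lt_le_trans _ _ (((rho `^ q / (2 * D0))%:E) `^ k * (((M / rho) `^ sigma / (2 * D0))%:E) `^ m)); last first.
    apply: lee_pmul; [exact: poweR_ge0|exact: poweR_ge0| |].
    - apply: lee_poweR c1; first exact: ltW.
      by rewrite lee_fin divr_ge0 ?powR_ge0 ?(ltW D20).
    - apply: lee_poweR c2; first exact: ltW.
      by rewrite lee_fin divr_ge0 ?powR_ge0 ?(ltW D20).
  rewrite !poweR_EFin -EFinM lte_fin !powRM ?mulr_ge0 ?powR_ge0 ?invr_ge0 ?(ltW D20) ?(ltW M0) ?(ltW rho0)//.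
  rewrite -!powRrM qk sm (powRVl _ (ltW rho0)) Ms !powRVl ?(ltW D20)//.
  have -> : ((2 * D0) `^ (k + m) = (2 * D0) `^ k * (2 * D0) `^ m)%R.
    by rewrite powRD// (gt_eqF D20) implybT.
  have : (0 < rho `^ s)%R by rewrite powR_gt0.
  have : (0 < (2 * D0) `^ k)%R by rewrite powR_gt0.
  have : (0 < (2 * D0) `^ m)%R by rewrite powR_gt0.
  move: (_ `^ k)%R (_ `^ m)%R (_ `^ s)%R => X Y Z X0 Y0 Z0.
  rewrite [ltRHS](_ : _ = 2 * C)%R; first by lra.
  by field; rewrite !gt_eqF.
have aeF : {ae leb, forall x, forall j i : nat, forall rho : rat,
    unpickle j = Some rho -> (0 < rho)%R -> ~ F (ratr rho) i x}.
  apply/ae_foralln => j; apply/ae_foralln => i.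
  case: (unpickle j) => [rho|]; last by apply: nearW.
  have [rho0|rho0] := ltP 0%R rho; last first.
    by apply: nearW => x _ [<-]; rewrite ltNge rho0.
  have : leb.-negligible (F (ratr rho) i).
    by apply/negligibleP => //; apply: Fnull; rewrite ltr0q.
  rewrite -[X in _.-negligible X]setCK => nF.
  suff : {ae leb, forall x, ~ F (ratr rho) i x}.
    by apply: filterS => x Fx _ [<-] _.
  exact: nF.
apply: filterS2 w1pos aeF => x w1x Fx; rewrite leNgt; apply/negP => Mw.
have [rho] := rat_in_itvoo Mw; rewrite in_itv/= => /andP[h1 h2].
have rho0 : (0 < rho)%R.
  by rewrite -(ltr0q R); apply: lt_trans h1; rewrite mulr_gt0.
apply: (Fx (pickle rho) (idx 0%N x) rho (pickleK rho) rho0).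
by split.
Qed.

End two_weights.

(** * Homogeneous kernels of degree zero *)

Lemma integralZl_fin d (T : measurableType d) (R : realType)
    (mu : {measure set T -> \bar R}) (D : set T) (k : R) (f : T -> R) :
  measurable D -> measurable_fun setT f -> (forall x, 0 <= f x) -> 0 <= k ->
  (\int[mu]_(x in D) (k * f x)%:E = k%:E * \int[mu]_(x in D) (f x)%:E)%E.
Proof.
move=> mD mf f0 k0; under eq_integral do rewrite EFinM.
rewrite ge0_integralZl//.
- exact/measurable_EFinP/measurable_funTS.
- by move=> x _; rewrite lee_fin.
Qed.

Lemma ge0_integral_mrestr d (T : measurableType d) (R : realType)
    (mu : {measure set T -> \bar R}) (D : set T) (mD : measurable D)
    (f : T -> \bar R) : measurable_fun setT f -> (forall x, 0 <= f x)%E ->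
  (\int[mrestr mu mD]_x f x = \int[mu]_(x in D) f x)%E.
Proof.
move=> mf f0; rewrite -(setUv D) ge0_integral_setU//; first last.
- by apply/disj_setPS => x [].
- exact: measurable_funTS.
- exact: measurableC.
rewrite [X in (_ + X)%E](_ : _ = 0%E) ?adde0.
  apply: eq_measure_integral => A mA AD; transitivity (mu (A `&` D)) => //.
  by rewrite setIidl.
apply: null_set_integral => //; first exact: measurableC.
  exact: measurable_funTS.
transitivity (mu (~` D `&` D)) => //.
by rewrite setICl measure0.
Qed.

Section homogeneous_kernel.
Context {R : realType} {n : nat}.
Hypothesis n_gt0 : (0 < n)%N.
Local Open Scope ereal_scope.
Local Notation leb := (@lebesgue_rV R n).
Implicit Types (a x : 'rV[R]_n) (t : R) (Omega : 'rV[R]_n -> R).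

Let B1 := @eball R n 0%R 1%R.

Lemma homogeneous_edir Omega x : homogeneous0 Omega -> Omega (edir x) = Omega x.
Proof.
move=> hom; have [->|x0] := eqVneq x 0%R; first by rewrite /edir scaler0.
rewrite /edir hom// invr_gt0 lt_neqAle enorm_ge0 andbT eq_sym.
by apply: contra x0 => /eqP/enorm_eq0 ->.
Qed.

Lemma sphere_measureE (E : set 'rV[R]_n) :
  sphere_measure E = ((ball_volume R n)^-1)%:E * leb (@edir R n @^-1` E `&` B1).
Proof. by []. Qed.

Lemma integral_sphere_measure (g : 'rV[R]_n -> \bar R) :
  measurable_fun setT g -> (forall x, 0 <= g x) ->
  \int[sphere_measure]_x g x =
  ((ball_volume R n)^-1)%:E * \int[leb]_(x in B1) g (edir x).
Proof.
move=> mg g0.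
rewrite /sphere_measure ge0_integral_mscale//; congr (_ * _).
rewrite ge0_integral_pushforward//; last exact: measurable_edir.
rewrite preimage_setT; apply: ge0_integral_mrestr => //.
  exact: (measurableT_comp mg (@measurable_edir R n)).
by move=> x; exact: g0.
Qed.

(** The map y |-> x - y sends B(a,t) into B(0,2t), and the dilation by 2 t
    leaves Omega unchanged. *)
Lemma omega_ball_invariant (Omega : 'rV[R]_n -> R) (phi : R -> \bar R) a x t :
  measurable_fun setT Omega -> homogeneous0 Omega -> measurable_fun setT phi ->
  (forall z, 0 <= phi z) -> (0 < t)%R -> (enorm (x - a) <= t)%R ->
  \int[leb]_(y in eball a t) phi (Omega (x - y)%R) <=
  ((2 * t) ^+ n)%:E * \int[leb]_(y in B1) phi (Omega y).
Proof.
move=> mO hom mphi phi0 t0 xa.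
have t20 : (0 < 2 * t)%R by rewrite mulr_gt0.
have mg : measurable_fun setT (phi \o Omega) by exact: measurableT_comp.
pose D := eball (0%R : 'rV[R]_n) (2 * t).
have mD : measurable D by exact: measurable_eball.
apply: (@le_trans _ _ (\int[leb]_(y in D) phi (Omega y))); last first.
  rewrite -(@integral_rV_affine _ _ 0%R (2 * t) D (phi \o Omega) (lt0r_neq0 t20) mD
    (measurable_funTS mg) (fun y _ => phi0 _)).
  rewrite gtr0_norm//.
  rewrite (_ : _ @^-1` D = B1); last first.
    by apply/seteqP; split => z; rewrite /D /B1 /eball/= add0r !subr0 enormZ gtr0_norm// gtr_pMr.
  rewrite le_eqVlt; apply/orP; left; apply/eqP; congr (_ * _).
  by apply: eq_integral => y _; rewrite /= add0r hom.
have N1 : (-1 != 0 :> R)%R by rewrite oppr_eq0 oner_eq0.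
rewrite -(@integral_rV_affine _ _ x (-1) D (phi \o Omega) N1 mD
    (measurable_funTS mg) (fun y _ => phi0 _)).
rewrite normrN1 expr1n mul1e.
have eqO y : (x + -1 *: y = x - y)%R by rewrite scaleN1r.
under [leRHS]eq_integral do rewrite /= eqO.
apply: ge0_subset_integral => //.
- exact: measurable_eball.
- by rewrite -[X in measurable X]setTI; exact: measurable_affine.
- apply: measurable_funTS; apply: (measurableT_comp mg).
  exact: measurable_rVB.
- move=> y; rewrite /eball/= /D => ya; rewrite /preimage/= /D /eball/= eqO subr0.
  rewrite (_ : x - y = (x - a) - (y - a))%R; last by rewrite opprB addrA subrK.
  apply: (le_lt_trans (enorm_triangle _ _)); rewrite enormN.
  rewrite (_ : 2 * t = t + t)%R; [exact: ler_ltD|ring].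
Qed.

(** Hoelder's inequality with exponents s' and s; the norm of Omega on the ball
    is its norm on the sphere up to the factor t^(n/s'). For s = 1 the essential
    bound of Omega on the sphere is transported to the ball by
    [omega_ball_invariant], applied to the indicator function of the large
    values. *)
Lemma omega_hoelder (s : R) Omega : (1 <= s)%R ->
  Omega \in Lfun sphere_measure (hoelder_conjugate s%:E) -> homogeneous0 Omega ->
  exists2 C : R, (0 < C)%R & forall a x t (G : 'rV[R]_n -> R), (0 < t)%R ->
    (enorm (x - a) <= t)%R -> measurable_fun setT G -> (forall y, 0 <= G y)%R ->
    \int[leb]_(y in eball a t) (`|Omega (x - y)| * G y)%:E <=
    (C * t `^ (n%:R - n%:R / s))%:E *
      (\int[leb]_(y in eball a t) (G y `^ s)%:E) `^ s^-1.
Proof.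
move=> s1; rewrite inE => /andP[/[!inE] mO fO] hom.
have s0 : (0 < s)%R by exact: lt_le_trans s1.
have vol0 : (0 < ball_volume R n)%R by exact: ball_volume_gt0.
have mB1 : measurable B1 by exact: measurable_eball.
have mabsO : measurable_fun setT (fun y => `|Omega y|)%R by exact: measurableT_comp.
have mOx x : measurable_fun setT (fun y : 'rV[R]_n => `|Omega (x - y)|)%R.
  by apply: (measurableT_comp mabsO); exact: measurable_rVB.
move: fO; rewrite /= /finite_norm.
move: s1; rewrite le_eqVlt => /predU1P[s1|s1].
  rewrite -s1 hoelder_conjugate1 unlock.
  have muT : 0 < @sphere_measure R n setT.
    rewrite sphere_measureE preimage_setT setTI.
    by rewrite lebesgue_eball// expr1n mul1r -EFinM mulVf ?gt_eqF// lte_fin.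
  rewrite muT => /(@ess_supr_bounded _ _ _ _ (fun y => `|Omega y|%R))[M0 OM0].
  pose M := Num.max M0 1%R.
  have M_gt0 : (0 < M)%R by rewrite lt_max ltr01 orbT.
  pose phi (z : R) : \bar R := (\1_[set z : R | M < `|z|]%R z)%:E.
  have mS : measurable [set z : R | M < `|z|]%R.
    rewrite -[X in measurable X]setTI.
    have -> : [set z : R | M < `|z|]%R = (fun z : R => `|z|)%R @^-1` `]M, +oo[.
      by apply/seteqP; split => z /=; rewrite in_itv/= andbT.
    have mn : measurable_fun setT (fun z : R => `|z|%R) by [].
    exact: mn.
  have mphi : measurable_fun setT phi by apply/measurable_EFinP; exact: measurable_indic.
  have phi0 z : 0 <= phi z by rewrite lee_fin.
  have sph0 : \int[sphere_measure]_x phi (Omega x) = 0.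
    rewrite (ae_eq_integral (cst 0))//; first by rewrite integral0.
      exact: measurableT_comp.
    apply: filterS OM0 => y Oy _; rewrite /phi indicE memNset//=.
    by apply/negP; rewrite -leNgt (le_trans Oy)// le_max lexx.
  have B10 : \int[leb]_(y in B1) phi (Omega y) = 0.
    move: sph0; rewrite integral_sphere_measure//; last exact: measurableT_comp.
    under eq_integral do rewrite homogeneous_edir//.
    move=> /eqP; rewrite mule_eq0 eqe invr_eq0 gt_eqF//= => /eqP.
    exact.
  exists M => // a x t G t0 xa mG G0.
  have mB : measurable (eball a t) by exact: measurable_eball.
  have : \int[leb]_(y in eball a t) phi (Omega (x - y)%R) <= 0.
    by apply: (le_trans (omega_ball_invariant mO hom mphi phi0 t0 xa)); rewrite B10 mule0.
  have mphiO : measurable_fun (eball a t) (fun y => phi (Omega (x - y)%R)).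
    apply: measurable_funTS; apply: (measurableT_comp mphi).
    by apply: (measurableT_comp mO); exact: measurable_rVB.
  move=> le0.
  have /(ae_eq_integral_abs leb mB mphiO).1 ae0 :
      \int[leb]_(y in eball a t) `|phi (Omega (x - y)%R)| = 0.
    under eq_integral do rewrite gee0_abs//.
    by apply/eqP; rewrite eq_le le0; apply: integral_ge0.
  rewrite invr1 mulr1 subrr powRr0 mulr1 poweRe1; last first.
    by apply: integral_ge0 => y _; rewrite lee_fin powR_ge0.
  under [in leRHS]eq_integral do rewrite powRr1//.
  rewrite -integralZl_fin// ?(ltW M_gt0)//.
  apply: ae_ge0_le_integral => //.
  - by move=> y _; rewrite lee_fin mulr_ge0.
  - by apply/measurable_EFinP/measurable_funTS; exact: measurable_funM.
  - by move=> y _; rewrite lee_fin mulr_ge0// ltW.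
  - by apply/measurable_EFinP/measurable_funTS; exact: measurable_funM.
  apply: filterS ae0 => y /= H By; rewrite lee_fin ler_wpM2r//.
  rewrite leNgt; apply/negP => My; have [] := H By.
  by rewrite /phi indicE mem_set//= => /eqP; rewrite oner_eq0.
have s1n0 : (s - 1 != 0)%R by rewrite subr_eq0 gt_eqF.
pose s' := (s / (s - 1))%R.
have s'0 : (0 < s')%R by rewrite divr_gt0// subr_gt0.
have -> : hoelder_conjugate s%:E = s'%:E.
  rewrite /hoelder_conjugate/= eqe gt_eqF// -EFinB inver (negbTE s1n0).
  by rewrite -EFinM.
have ss' : (s'^-1 + s^-1 = 1)%R.
  by rewrite /s'; field; rewrite s1n0 gt_eqF.
rewrite unlock => fO.
have K0 : \int[sphere_measure]_x (`|(EFin \o Omega) x| `^ s') < +oo.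
  by move: fO => /lty_poweRy; apply; rewrite invr_eq0 gt_eqF.
pose phi (z : R) : \bar R := (`|z| `^ s')%:E.
have mphi : measurable_fun setT phi.
  apply/measurable_EFinP; exact: (measurableT_comp (measurable_powR _)).
have phi0 z : 0 <= phi z by rewrite lee_fin powR_ge0.
have : \int[leb]_(y in B1) phi (Omega y) < +oo.
  have mphiO : measurable_fun setT (phi \o Omega) by exact: measurableT_comp.
  have : \int[sphere_measure]_x (phi \o Omega) x < +oo := K0.
  rewrite (integral_sphere_measure mphiO (fun x => phi0 _)).
  under eq_integral do rewrite /= homogeneous_edir//.
  have i0 : 0 <= \int[leb]_(y in B1) phi (Omega y) by apply: integral_ge0.
  move: i0; case: (\int[leb]_(y in B1) phi (Omega y)) => // [z _ _|_]; first by rewrite ltry.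
  by rewrite gt0_muley// lte_fin invr_gt0.
have : 0 <= \int[leb]_(y in B1) phi (Omega y) by apply: integral_ge0.
case KE : (\int[leb]_(y in B1) phi (Omega y)) => [K| |]// K_ge0 _.
rewrite lee_fin in K_ge0.
exists ((2 ^+ n * K) `^ s'^-1 + 1)%R; first by rewrite ltr_wpDl// powR_ge0.
move=> a x t G t0 xa mG G0.
have mB : measurable (eball a t) by exact: measurable_eball.
apply: (le_trans (hoelder_on leb mB (measurable_funTS (mOx x)) (measurable_funTS mG) _ G0 s'0 s0 ss')) => //.
apply: lee_wpmul2r; first exact: poweR_ge0.
apply: (@le_trans _ _ ((((2 * t) ^+ n * K)%:E) `^ s'^-1)).
  apply: lee_poweR; first by rewrite invr_ge0 ltW.
    by apply: integral_ge0 => y _; rewrite lee_fin powR_ge0.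
  by have := omega_ball_invariant mO hom mphi phi0 t0 xa; rewrite KE -EFinM.
rewrite poweR_EFin lee_fin exprMn mulrAC powRM ?mulr_ge0 ?exprn_ge0 ?(ltW t0)//.
have -> : ((t ^+ n) `^ s'^-1 = t `^ (n%:R - n%:R / s))%R.
  rewrite -powR_mulrn ?(ltW t0)// -powRrM; congr (_ `^ _)%R.
  have -> : (s'^-1 = 1 - s^-1)%R by rewrite -ss' addrK.
  by rewrite mulrBr mulr1.
by rewrite ler_wpM2r ?powR_ge0// lerDl.
Qed.

End homogeneous_kernel.

(** * The estimate on one ball *)

Section kernel_on_balls.
Context {R : realType} {n : nat}.
Hypothesis n_gt0 : (0 < n)%N.
Local Open Scope ereal_scope.
Local Notation leb := (@lebesgue_rV R n).
Implicit Types (a x : 'rV[R]_n) (t : R) (u v w f h : 'rV[R]_n -> R).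

Lemma wLnormE p w E f :
  wLnorm p w E (EFin \o f) = (\int[leb]_(y in E) (`|f y| `^ p * w y)%:E) `^ p^-1.
Proof. by congr (_ `^ _); apply: eq_integral => y _; rewrite /= poweR_EFin. Qed.

Lemma wLnorm_ge0 p w E (f : 'rV[R]_n -> \bar R) : 0 <= wLnorm p w E f.
Proof. exact: poweR_ge0. Qed.

Lemma wLnorm_sub p w (A B : set 'rV[R]_n) (g : 'rV[R]_n -> \bar R) : (0 < p)%R ->
  (forall x, 0 <= w x)%R -> A `<=` B -> wLnorm p w A g <= wLnorm p w B g.
Proof.
move=> p0 w0 AB.
have pos x : 0 <= `|g x| `^ p * (w x)%:E by rewrite mule_ge0 ?poweR_ge0// lee_fin.
apply: lee_poweR; first by rewrite invr_ge0 ltW.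
  exact: integral_ge0.
exact: le_integral_sub.
Qed.

Variables (Omega : 'rV[R]_n -> R) (s : R).
Hypotheses (s1 : (1 <= s)%R) (hom : homogeneous0 Omega).
Hypothesis LO : Omega \in Lfun sphere_measure (hoelder_conjugate s%:E).

(** After [omega_hoelder], write h |f| = (|f| w1) (h w1^(-1)) with
    w1^(-1) <= M w2^(-1) and use the exponents p / s and sigma / s on the s-th
    powers. The factor h is 1 for the operator and |b - favg b a t| for the
    commutator; A measures its mean of order sigma for the weight
    w2^(-sigma). *)
Lemma kernel_ball_estimate (p q alpha sigma C0 M : R) w1 w2 :
  (s < p)%R -> sigma = (s * p / (p - s))%R ->
  measurable_fun setT w1 -> measurable_fun setT w2 ->
  {ae leb, forall y, (0 < w2 y)%R} -> (0 < C0)%R -> (0 < M)%R ->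
  {ae leb, forall y, (w2 y <= M * w1 y)%R} ->
  (forall a t, (0 < t)%R ->
    wmeas (wpow w2 q) (eball a t) `^ q^-1 *
    wmeas (wpow w2 (- sigma)) (eball a t) `^ sigma^-1 <=
    (C0 * t `^ (n%:R / s - alpha))%:E) ->
  exists2 C : R, (0 < C)%R & forall a x t h f (A : R), (0 < t)%R ->
    (enorm (x - a) <= t)%R -> measurable_fun setT h -> measurable_fun setT f ->
    (forall y, 0 <= h y)%R -> (0 <= A)%R ->
    \int[leb]_(y in eball a t) (h y `^ sigma * wpow w2 (- sigma) y)%:E <=
      (A `^ sigma)%:E * wmeas (wpow w2 (- sigma)) (eball a t) ->
    wmeas (wpow w2 q) (eball a t) `^ q^-1 *
      \int[leb]_(y in eball a t) (`|Omega (x - y)| * (h y * `|f y|))%:E <=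
    (C * A * t `^ (n%:R - alpha))%:E *
      wLnorm p (wpow w1 p) (eball a t) (EFin \o f).
Proof.
move=> sp sigmaE mw1 mw2 w2pos C0_gt0 M0 w21 pair.
have s0 : (0 < s)%R by exact: lt_le_trans s1.
have p0 : (0 < p)%R by exact: lt_trans sp.
have sigma0 : (0 < sigma)%R by rewrite sigmaE divr_gt0 ?mulr_gt0 ?subr_gt0.
have [C1 C10 OH] := omega_hoelder n_gt0 s1 LO hom.
exists (C1 * M * C0)%R; first by rewrite !mulr_gt0.
move=> a x t h f A t0 xa mh mf h0 A0 hA.
set B := eball a t.
have mB : measurable B by exact: measurable_eball.
have maf : measurable_fun setT (fun y => `|f y|)%R by exact: measurableT_comp.
have mhf : measurable_fun setT (fun y => h y * `|f y|)%R by exact: measurable_funM.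
have hf0 y : (0 <= h y * `|f y|)%R by rewrite mulr_ge0.
pose V := wmeas (wpow w2 (- sigma)) B.
pose U := wmeas (wpow w2 q) B.
pose X := wLnorm p (wpow w1 p) B (EFin \o f).
have mpow g k : measurable_fun setT g -> measurable_fun setT (fun y : 'rV[R]_n => g y `^ k : R)%R.
  by move=> mg; exact: (measurableT_comp (measurable_powR _) mg).
pose F y := (`|f y| `^ s * w1 y `^ s)%R.
pose G y := (h y `^ s * w2 y `^ (- s))%R.
have mF : measurable_fun setT F by apply: measurable_funM; exact: mpow.
have mG : measurable_fun setT G by apply: measurable_funM; exact: mpow.
have F0 y : (0 <= F y)%R by rewrite mulr_ge0// powR_ge0.
have G0 y : (0 <= G y)%R by rewrite mulr_ge0// powR_ge0.
have Ms0 : (0 <= M `^ s)%R by exact: powR_ge0.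
have step1 : \int[leb]_(y in B) ((h y * `|f y|) `^ s)%:E <=
    (M `^ s)%:E * \int[leb]_(y in B) (F y * G y)%:E.
  rewrite -integralZl_fin//; last 2 first.
    exact: measurable_funM.
    by move=> y; rewrite mulr_ge0.
  apply: ae_ge0_le_integral => //.
  - by move=> y _; rewrite lee_fin powR_ge0.
  - by apply/measurable_EFinP/measurable_funTS; exact: mpow.
  - by move=> y _; rewrite lee_fin mulr_ge0// mulr_ge0.
  - apply/measurable_EFinP/measurable_funTS; apply: measurable_funM => //.
    exact: measurable_funM.
  apply: filterS2 w2pos w21 => y w2y w21y _; rewrite lee_fin /F /G.
  rewrite powRN powRM// mulrC.
  rewrite (_ : M `^ s * _ = (`|f y| `^ s * h y `^ s) * (M `^ s * w1 y `^ s / w2 y `^ s))%R; last by ring.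
  rewrite ler_peMr ?mulr_ge0 ?powR_ge0// ler_pdivlMr ?powR_gt0// mul1r.
  have w1y : (0 <= w1 y)%R.
    by rewrite -(pmulr_rge0 _ M0); apply: le_trans w21y; exact: ltW.
  rewrite -powRM//; last exact: ltW.
  by apply: ge0_ler_powR; rewrite ?nnegrE ?mulr_ge0 ?(ltW s0) ?(ltW w2y) ?(ltW M0).
have step2 : \int[leb]_(y in B) (F y * G y)%:E <=
    (\int[leb]_(y in B) (`|f y| `^ p * wpow w1 p y)%:E) `^ (p^-1 * s) *
    (\int[leb]_(y in B) (h y `^ sigma * wpow w2 (- sigma) y)%:E) `^ (sigma^-1 * s).
  apply: (le_trans (@hoelder_on _ _ R leb B F G (p / s) (sigma / s) mB
    (measurable_funTS mF) (measurable_funTS mG) F0 G0 _ _ _)).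
  - by rewrite divr_gt0.
  - by rewrite divr_gt0.
  - rewrite sigmaE; field; rewrite !gt_eqF//=; last by rewrite subr_gt0.
  rewrite !invf_div (mulrC s p^-1%R) (mulrC s sigma^-1%R).
  rewrite le_eqVlt; apply/orP; left; apply/eqP; congr (_ `^ _ * _ `^ _).
    apply: eq_integral => y _; rewrite /F /wpow powRM ?powR_ge0// -!powRrM.
    by rewrite (_ : s * (p / s) = p)%R//; field; rewrite gt_eqF.
  apply: eq_integral => y _; rewrite /G /wpow powRM ?powR_ge0// -!powRrM.
  rewrite (_ : s * (sigma / s) = sigma)%R; last by field; rewrite gt_eqF.
  by rewrite (_ : - s * (sigma / s) = - sigma)%R//; field; rewrite gt_eqF.
have step3 : (\int[leb]_(y in B) ((h y * `|f y|) `^ s)%:E) `^ s^-1 <=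
    M%:E * (X * (A%:E * V `^ sigma^-1)).
  apply: (@le_trans _ _ (((M `^ s)%:E * (((X * (A%:E * V `^ sigma^-1)) `^ s))) `^ s^-1)); last first.
    rewrite poweRM ?lee_fin ?poweR_ge0//.
    rewrite poweR_EFin -poweRrM -powRrM mulfV ?gt_eqF// powRr1 ?(ltW M0)// poweRe1//.
    by rewrite !mule_ge0 ?lee_fin ?poweR_ge0.
  apply: lee_poweR; first by rewrite invr_ge0 ltW.
    by apply: integral_ge0 => y _; rewrite lee_fin powR_ge0.
  apply: (le_trans step1); apply: lee_wpmul2l; first by rewrite lee_fin.
  apply: (le_trans step2).
  rewrite poweRM ?poweR_ge0 ?mule_ge0 ?poweR_ge0 ?lee_fin//.
  rewrite /X wLnormE -poweRrM; apply: lee_wpmul2l; first exact: poweR_ge0.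
  rewrite (poweRrM _ sigma^-1); apply: lee_poweR; rewrite ?poweR_ge0 ?(ltW s0)//.
  apply: (@le_trans _ _ (((A `^ sigma)%:E * V) `^ sigma^-1)).
    apply: lee_poweR => //; first by rewrite invr_ge0 ltW.
    by apply: integral_ge0 => y _; rewrite lee_fin mulr_ge0 ?powR_ge0.
  rewrite poweRM ?lee_fin ?powR_ge0//; last by apply: wmeas_ge0; exact: wpow_ge0.
  by rewrite poweR_EFin -powRrM mulfV ?gt_eqF// powRr1.
have tp : (0 <= C1 * t `^ (n%:R - n%:R / s))%R by rewrite mulr_ge0 ?powR_ge0 ?(ltW C10).
have X0 : 0 <= X by exact: poweR_ge0.
apply: (@le_trans _ _ (U `^ q^-1 * ((C1 * t `^ (n%:R - n%:R / s))%:E *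
    (M%:E * (X * (A%:E * V `^ sigma^-1)))))).
  apply: lee_wpmul2l; first exact: poweR_ge0.
  apply: (le_trans (OH a x t _ t0 xa mhf hf0)).
  by apply: lee_wpmul2l; rewrite ?lee_fin.
rewrite (_ : U `^ q^-1 * _ = ((C1 * t `^ (n%:R - n%:R / s)) * M * A)%:E * X *
    (U `^ q^-1 * V `^ sigma^-1)); last first.
  move: (U `^ q^-1) (V `^ sigma^-1) (X) => U1 V1 X1.
  rewrite (EFinM _ A) (EFinM _ M) (muleCA U1) (muleCA U1) (muleCA U1) (muleCA U1).
  by rewrite (muleCA X1) !muleA.
apply: (@le_trans _ _ (((C1 * t `^ (n%:R - n%:R / s)) * M * A)%:E * X * (C0 * t `^ (n%:R / s - alpha))%:E)).
  apply: lee_wpmul2l; last exact: pair.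
  by rewrite mule_ge0// lee_fin !mulr_ge0 ?powR_ge0 ?(ltW C10) ?(ltW M0).
rewrite muleAC -EFinM; apply: lee_wpmul2r => //.
rewrite lee_fin.
have -> : (t `^ (n%:R - alpha) = t `^ (n%:R - n%:R / s) * t `^ (n%:R / s - alpha))%R.
  by rewrite -powRD ?(gt_eqF t0) ?implybT//; congr (_ `^ _)%R; ring.
by rewrite le_eqVlt; apply/orP; left; apply/eqP; ring.
Qed.

Lemma inv_linfty_ae w a t : {ae leb, forall y, eball a t y ->
  ((w y)^-1)%:E <= inv_linfty w a t}.
Proof.
rewrite /inv_linfty unlock.
have -> : 0 < leb setT.
  apply: (lt_le_trans (lebesgue_eball_gt0 0%R n_gt0 ltr01)).
  by apply: le_mu => //; exact: measurable_eball.
set g := (X in ess_sup _ X).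
apply: filterS (ess_sup_ge leb g) => y H By; apply: le_trans H.
by rewrite /g /= /patch mem_set//= lee_fin ler_norm.
Qed.

Lemma inv_linfty_ge0 w a t : 0 <= inv_linfty w a t.
Proof. exact: Lnorm_ge0. Qed.

Lemma avg_inv_le w a t : (0 < t)%R -> measurable_fun setT w -> (forall y, 0 <= w y)%R ->
  avg a t (EFin \o wpow w (-1)) <= inv_linfty w a t.
Proof.
move=> t0 mw w0; have mB : measurable (eball a t) by exact: measurable_eball.
rewrite avgE// lee_pdivrMl; last by rewrite mulr_gt0 ?exprn_gt0 ?ball_volume_gt0.
rewrite -(lebesgue_eball a t0) muleC -(integral_cst leb mB); apply: ae_ge0_le_integral => //.
- by move=> y _; rewrite lee_fin wpow_ge0.
- by apply/measurable_EFinP/measurable_funTS; exact: measurable_wpow.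
- by move=> y _; exact: inv_linfty_ge0.
- apply: filterS (inv_linfty_ae w a t) => y H /H.
  by rewrite /wpow powR_inv1.
Qed.

(** For p = s = 1 Omega is bounded, and |f| <= ||w1^(-1)||_oo |f| w1 on the
    ball. *)
Lemma kernel_ball_estimate1 (q alpha C0 : R) w1 u :
  s = 1%R -> (0 < q)%R -> measurable_fun setT w1 -> (forall y, 0 <= w1 y)%R ->
  {ae leb, forall y, (0 < w1 y)%R} -> (0 < C0)%R ->
  measurable_fun setT u -> (forall y, 0 <= u y)%R -> {ae leb, forall y, (0 < u y)%R} ->
  (forall a t, (0 < t)%R ->
    wmeas u (eball a t) `^ q^-1 * inv_linfty w1 a t <= (C0 * t `^ (n%:R - alpha))%:E) ->
  exists2 C : R, (0 < C)%R & forall a x t f, (0 < t)%R ->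
    (enorm (x - a) <= t)%R -> measurable_fun setT f ->
    wmeas u (eball a t) `^ q^-1 *
      \int[leb]_(y in eball a t) (`|Omega (x - y)| * `|f y|)%:E <=
    (C * t `^ (n%:R - alpha))%:E * wLnorm 1 w1 (eball a t) (EFin \o f).
Proof.
move=> s_1 q0 mw1 w10 w1pos C0_gt0 mu u0 upos pair.
have [C1 C10 OH] := omega_hoelder n_gt0 s1 LO hom.
exists (C1 * C0)%R; first by rewrite mulr_gt0.
move=> a x t f t0 xa mf; set B := eball a t.
have mB : measurable B by exact: measurable_eball.
have maf : measurable_fun setT (fun y => `|f y|)%R by exact: measurableT_comp.
have := OH a x t _ t0 xa maf (fun y => normr_ge0 _).
rewrite s_1 divr1 subrr powRr0 mulr1 invr1 poweRe1; last first.
  by apply: integral_ge0 => y _; rewrite lee_fin powR_ge0.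
under [in leRHS]eq_integral do rewrite powRr1//.
move=> step1.
rewrite wLnormE invr1 poweRe1; last first.
  by apply: integral_ge0 => y _; rewrite lee_fin mulr_ge0// powR_ge0.
under [in leRHS]eq_integral do rewrite powRr1//.
have L0 := inv_linfty_ge0 w1 a t.
have I0 : 0 <= \int[leb]_(y in B) (`|f y| * w1 y)%:E.
  by apply: integral_ge0 => y _; rewrite lee_fin mulr_ge0.
have step2 : \int[leb]_(y in B) (`|f y|)%:E <=
    inv_linfty w1 a t * \int[leb]_(y in B) (`|f y| * w1 y)%:E.
  rewrite -ge0_integralZl//; last 2 first.
  - by apply/measurable_EFinP/measurable_funTS; exact: measurable_funM.
  - by move=> y _; rewrite lee_fin mulr_ge0.
  apply: ae_ge0_le_integral => //.
  - by apply/measurable_EFinP/measurable_funTS.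
  - by move=> y _; rewrite mule_ge0// lee_fin mulr_ge0.
  - apply: emeasurable_funM; first exact: measurable_cst.
    by apply/measurable_EFinP/measurable_funTS; exact: measurable_funM.
  apply: filterS2 w1pos (inv_linfty_ae w1 a t) => y w1y H By.
  apply: (@le_trans _ _ (((w1 y)^-1)%:E * (`|f y| * w1 y)%:E)).
    by rewrite -EFinM lee_fin mulrCA mulVf ?gt_eqF// mulr1.
  by apply: lee_wpmul2r; [rewrite lee_fin mulr_ge0|exact: H].
set I := \int[leb]_(y in B) (`|f y| * w1 y)%:E.
apply: (@le_trans _ _ (wmeas u B `^ q^-1 * (C1%:E * (inv_linfty w1 a t * I)))).
  apply: lee_wpmul2l; first exact: poweR_ge0.
  apply: (le_trans step1); apply: lee_wpmul2l => //.
  by rewrite lee_fin ltW.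
rewrite muleCA -mulrA EFinM -[leRHS]muleA; apply: lee_wpmul2l; first by rewrite lee_fin ltW.
by rewrite muleA; apply: lee_wpmul2r => //; exact: pair.
Qed.

End kernel_on_balls.

(** * Dyadic annuli and the integral condition *)

Section annuli.
Context {R : realType} {n : nat}.
Hypothesis n_gt0 : (0 < n)%N.
Local Open Scope ereal_scope.
Local Notation leb := (@lebesgue_rV R n).
Implicit Types (a x : 'rV[R]_n) (r t p q : R) (w : 'rV[R]_n -> R).

(** For |x - a| < r and |y - a| >= 2^(k+1) r one has |x - y| >= 2^k r, so the
    kernel on the annulus is at most (2^k r)^(-beta), a fixed multiple of
    (2^(k+2) r)^(-beta). *)
Lemma integral_annuli_le (Omega g : 'rV[R]_n -> R) (beta r : R) a x (e : nat -> \bar R) :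
  measurable_fun setT Omega -> measurable_fun setT g -> (forall y, 0 <= g y)%R ->
  (0 < beta)%R -> (0 < r)%R -> (enorm (x - a) < r)%R -> (forall k, 0 <= e k) ->
  (forall k, \int[leb]_(y in eball a (2 ^+ k.+2 * r)) (`|Omega (x - y)| * g y)%:E <=
     ((2 ^+ k.+2 * r) `^ beta)%:E * e k) ->
  \int[leb]_(y in ~` eball a (2 * r))
     (`|Omega (x - y)| / enorm (x - y) `^ beta * g y)%:E <=
  (4 `^ beta)%:E * \sum_(k <oo) e k.
Proof.
move=> mO mg g0 beta0 r0 xa e0 He.
pose rho k : R := (2 ^+ k * r)%R.
have rho0 k : (0 < rho k)%R by rewrite mulr_gt0// exprn_gt0.
have rhoS k : (rho k.+1 = 2 * rho k)%R by rewrite /rho exprS mulrA.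
have rho_le i j : (i <= j)%N -> (rho i <= rho j)%R.
  by move=> ij; rewrite ler_pM2r// ler_eXn2l ?ltr1n.
pose F k : set 'rV[R]_n := eball a (rho k.+2) `\` eball a (rho k.+1).
have mF k : measurable (F k) by apply: measurableD; exact: measurable_eball.
have tF : trivIset setT F.
  apply/trivIsetP => i j _ _; wlog : i j / (i < j)%N.
    move=> H; rewrite neq_ltn => /orP[ij|ji]; first by apply: H => //; rewrite neq_ltn ij.
    by rewrite setIC; apply: H => //; rewrite neq_ltn ji.
  move=> ij _; rewrite -subset0 => y [[yi _] [_ yj]]; apply: yj.
  by apply: (lt_le_trans yi); exact: rho_le.
have UF : ~` eball a (2 * r) = \bigcup_k F k.
  apply/seteqP; split=> [y yr|y [k _ [_ yk] yr]]; last first.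
    by apply: yk; apply: (lt_le_trans yr); have := @rho_le 1%N k.+1 isT; rewrite {1}/rho expr1.
  have exk : exists k, (enorm (y - a) < rho k.+2)%R.
    have /archi_boundP : (0 <= enorm (y - a) / r)%R by rewrite divr_ge0 ?enorm_ge0 ?ltW.
    set N := Num.bound _; rewrite ltr_pdivrMr// => yN; exists N.
    apply: (lt_le_trans yN); rewrite ler_pM2r// -natrX ler_nat.
    by rewrite ltnW// (leq_trans (ltn_expl N (isT : (1 < 2)%N)))// leq_pexp2l// -addn2 leq_addr.
  case: (ex_minnP exk) => -[|k] yk mink.
    by exists 0%N => //; split => //; rewrite /rho expr1.
  exists k.+1 => //; split => // yk1.
  by have := mink k yk1; rewrite ltnn.
pose ker y := (`|Omega (x - y)| / enorm (x - y) `^ beta * g y)%R.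
have mOx : measurable_fun setT (fun y : 'rV[R]_n => `|Omega (x - y)| * g y)%R.
  apply: measurable_funM => //; apply: measurableT_comp => //.
  by apply: (measurableT_comp mO); exact: measurable_rVB.
have mker : measurable_fun setT ker.
  rewrite (_ : ker = fun y => (`|Omega (x - y)| * g y) * enorm (x - y) `^ (- beta))%R; last first.
    by apply/funext => y; rewrite /ker powRN mulrAC.
  apply: measurable_funM => //; apply: (measurableT_comp (measurable_powR _)).
  by apply: (measurableT_comp (@measurable_enorm R n)); exact: measurable_rVB.
have ker0 y : (0 <= ker y)%R by rewrite !mulr_ge0// invr_ge0 powR_ge0.
rewrite UF ge0_integral_bigcup//; first last.
- by move=> y _; rewrite lee_fin; exact: ker0.
- exact/measurable_EFinP/measurable_funTS.
rewrite -nneseriesZl; last by move=> k _; exact: e0.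
apply: lee_nneseries => [k _ _|k _].
  by apply: integral_ge0 => y _; rewrite lee_fin; exact: ker0.
apply: (@le_trans _ _ (\int[leb]_(y in eball a (rho k.+2))
    ((rho k `^ beta)^-1 * (`|Omega (x - y)| * g y))%:E)).
  apply: (@le_trans _ _ (\int[leb]_(y in F k) ((rho k `^ beta)^-1 * (`|Omega (x - y)| * g y))%:E)).
    apply: le_lower_integral => y [yk2 yk1]; first by rewrite lee_fin; exact: ker0.
    rewrite lee_fin /ker -mulrA (mulrC _ (g y)) mulrA mulrC ler_wpM2r ?mulr_ge0//.
    have dist : (rho k <= enorm (x - y))%R.
      have := enorm_triangle (x - y)%R (a - x)%R; rewrite [(_ + (a - x))%R](_ : _ = a - y)%R; last first.
        by rewrite addrC addrA subrK.
      move: yk1 => /negP; rewrite -leNgt -enormN opprB rhoS => yk1.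
      move: xa; rewrite -enormN opprB => xa.
      have : (r <= rho k)%R by apply: ler_peMl; [exact: ltW|rewrite exprn_ege1// ler1n].
      lra.
    rewrite lef_pV2 ?posrE ?powR_gt0//; last exact: lt_le_trans dist.
    by apply: ge0_ler_powR; rewrite ?nnegrE ?enorm_ge0 ?(ltW (rho0 k)) ?(ltW beta0).
  apply: ge0_subset_integral => //; first exact: measurable_eball.
  - by apply/measurable_EFinP/measurable_funTS; exact: measurable_funM.
  - by move=> y _; rewrite lee_fin !mulr_ge0// invr_ge0 powR_ge0.
  - by move=> y [].
rewrite integralZl_fin ?invr_ge0 ?powR_ge0//; last 2 first.
  exact: measurable_eball.
  by move=> y; rewrite mulr_ge0.
apply: (@le_trans _ _ (((rho k `^ beta)^-1)%:E * ((rho k.+2 `^ beta)%:E * e k))).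
  by apply: lee_wpmul2l (He k); rewrite lee_fin invr_ge0 powR_ge0.
rewrite muleA -EFinM (_ : rho k.+2 = 4 * rho k)%R; last by rewrite !rhoS; ring.
by rewrite powRM ?(ltW (rho0 k))// mulrCA mulVf ?mulr1// gt_eqF// powR_gt0.
Qed.

(** The step function equal to v_k / (2^(k+2) r) on [2^(k+2) r, 2^(k+3) r) lies
    below G, and only this step function is required to be measurable. *)
Lemma dyadic_series_le_integral (v : nat -> \bar R) (G : R -> \bar R) r :
  (0 < r)%R -> (forall k, 0 <= v k) -> (forall t, (r < t)%R -> 0 <= G t) ->
  (forall k t, (2 ^+ k.+2 * r <= t)%R -> (t < 2 ^+ k.+3 * r)%R ->
     v k * ((2 ^+ k.+2 * r)^-1)%:E <= G t) ->
  \sum_(k <oo) v k <= \int[@lebesgue_measure R]_(t in `]r, +oo[) G t.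
Proof.
move=> r0 v0 G0 vG.
pose rho k : R := (2 ^+ k * r)%R.
have rho0 k : (0 < rho k)%R by rewrite mulr_gt0// exprn_gt0.
have rho_le i j : (i <= j)%N -> (rho i <= rho j)%R.
  by move=> ij; rewrite ler_pM2r// ler_eXn2l ?ltr1n.
have rhoS k : (rho k.+1 = 2 * rho k)%R by rewrite /rho exprS mulrA.
pose I k : set R := [set` `[rho k.+2, rho k.+3[].
pose f k t : \bar R := v k * ((rho k.+2)^-1)%:E * (\1_(I k) t)%:E.
have c0 k : 0 <= v k * ((rho k.+2)^-1)%:E by rewrite mule_ge0// lee_fin invr_ge0 ltW.
have f0 k t : 0 <= f k t by rewrite mule_ge0// lee_fin.
have mI k : measurable (I k) by exact: measurable_itv.
have fI k t : I k t -> f k t = v k * ((rho k.+2)^-1)%:E.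
  by move=> Ikt; rewrite /f indicE mem_set// mule1.
have fN k t : ~ I k t -> f k t = 0.
  by move=> Ikt; rewrite /f indicE memNset// mule0.
have intf k : \int[@lebesgue_measure R]_(t in `]r, +oo[) f k t = v k.
  rewrite /f ge0_integralZl//; last first.
    by apply/measurable_EFinP; apply: measurable_indic; exact: mI.
  have -> : \int[@lebesgue_measure R]_(t in `]r, +oo[) (\1_(I k) t)%:E =
      @lebesgue_measure R (I k `&` [set` `]r, +oo[]).
    by apply: integral_indic; [exact: measurable_itv|exact: mI].
  rewrite setIidl; last first.
    move=> t; rewrite /I /= !in_itv/= andbT => /andP[+ _]; apply: lt_le_trans.
    by have := @rho_le 1%N k.+2 isT; apply: lt_le_trans; rewrite /rho expr1 ltr_pMl// ltr1n.
  have -> : lebesgue_measure (I k) = (rho k.+2)%:E.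
    rewrite /I lebesgue_measure_itv/= lte_fin (rhoS k.+2) ltr_pMl ?ltr1n// -EFinB.
    by congr (_%:E); ring.
  by rewrite -muleA -EFinM mulVf ?mule1// gt_eqF.
apply: lime_le; first exact: is_cvg_nneseries.
apply: nearW => K.
under eq_bigr do rewrite -intf.
rewrite -ge0_integral_sum//; last first.
  move=> k; apply: emeasurable_funM; first exact: measurable_cst.
  by apply/measurable_EFinP; apply: measurable_indic; exact: mI.
apply: le_lower_integral => t; first by move=> _; apply: sume_ge0.
rewrite /= in_itv/= andbT => rt.
have [[j [jK Ij]]|nI] := pselect (exists j, (j < K)%N /\ I j t).
  rewrite big_mkord (bigD1 (Ordinal jK))//= big1 ?adde0 => [|i ij].
    rewrite fI//; move: Ij; rewrite /I /= in_itv/= => /andP[]; exact: vG.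
  apply: fN; rewrite /I /= in_itv/= => /andP[i1 i2].
  move: Ij; rewrite /I /= in_itv/= => /andP[j1 j2].
  have [h|h|h] := ltngtP (i : nat) j.
  - by have := lt_le_trans i2 (le_trans (rho_le _ _ (h : i.+3 <= j.+2)%N) j1); rewrite ltxx.
  - by have := lt_le_trans j2 (le_trans (rho_le _ _ (h : j.+3 <= i.+2)%N) i1); rewrite ltxx.
  - by move: ij; rewrite -val_eqE/= h eqxx.
rewrite big_mkord big1 ?G0// => i _; apply: fN => Ii; apply: nI.
by exists i.
Qed.

(** If w(B) is infinite then so is the right-hand side. *)
Lemma le_of_morrey_norm (N : set 'rV[R]_n -> ('rV[R]_n -> \bar R) -> \bar R)
    p w psi f (M : R) a r :
  (0 < p)%R -> (0 < r)%R -> (0 < psi a r)%R -> (0 <= N (eball a r) f) ->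
  0 < wmeas w (eball a r) -> (0 < M)%R -> morrey_norm N p w psi f <= M%:E ->
  N (eball a r) f <= M%:E * ((psi a r)%:E * wmeas w (eball a r) `^ p^-1).
Proof.
move=> p0 r0 psi0 N0 W0 M0 fM.
have : ((psi a r)^-1)%:E * ((wmeas w (eball a r)) `^ p^-1)^-1 * N (eball a r) f <= M%:E.
  by apply: le_trans fM; apply: ereal_sup_ubound; exists (a, r).
have pi0 : (p^-1 != 0)%R by rewrite invr_eq0 gt_eqF.
move: W0; case: (wmeas w _) => [W| |]// W0.
  have Wp0 : (0 < W `^ p^-1)%R by rewrite powR_gt0.
  rewrite poweR_EFin inver gt_eqF// -EFinM -invfM lee_pdivrMl ?mulr_gt0//.
  by rewrite -EFinM muleC.
by rewrite poweRyr// gt0_muley ?lte_fin// gt0_muley ?lte_fin// leey.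
Qed.

Section psi_series.
Variables (p q D : R) (w1 w2 : 'rV[R]_n -> R) (psi1 psi2 : 'rV[R]_n -> R -> R).
Hypotheses (p0 : (0 < p)%R) (q0 : (0 < q)%R) (D0 : (0 < D)%R).
Hypotheses (mw1 : measurable_fun setT w1) (w1pos : {ae leb, forall x, (0 < w1 x)%R}).
Let W1 := wpow w1 p.
Let U a t := wmeas (wpow w2 q) (eball a t).
Hypothesis U_gt0 : forall a t, (0 < t)%R -> 0 < U a t.
Hypothesis U_fin : forall a t, (0 < t)%R -> U a t < +oo.
Hypothesis U_dbl : forall a t, (0 < t)%R -> U a (2 * t) <= D%:E * U a t.
Hypothesis psi1_gt0 : forall a t, (0 < t)%R -> (0 < psi1 a t)%R.
Hypothesis psi2_gt0 : forall a t, (0 < t)%R -> (0 < psi2 a t)%R.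

(** The terms of the dyadic sum: the norm of f on a ball, relative to the power
    1/q of the weight w2^q of the ball. *)
Definition ball_density a t (f : 'rV[R]_n -> R) : \bar R :=
  wLnorm p W1 (eball a t) (EFin \o f) * ((fine (U a t) `^ q^-1)^-1)%:E.

Lemma ball_density_ge0 a t f : 0 <= ball_density a t f.
Proof. by rewrite mule_ge0 ?wLnorm_ge0// lee_fin invr_ge0 powR_ge0. Qed.

(** The norm of f over B(a,r) is at most its norm over B(a,l), hence at most M
    times psi1(a,l) w1^p(B(a,l))^(1/p), for every l >= t; the weight of B(a,t)
    is at most D times that of B(a,r). *)
Lemma growth_ge f (M r t : R) a : (0 < M)%R -> (0 < r)%R ->
  (r <= t)%R -> (t <= 2 * r)%R ->
  morrey_norm (wLnorm p W1) p W1 psi1 (EFin \o f) <= M%:E ->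
  ball_density a r f * ((M * D `^ q^-1)^-1)%:E <= growth p q w1 w2 psi1 a t.
Proof.
move=> M0 r0 rt t2 fM.
have t0 : (0 < t)%R by exact: lt_le_trans rt.
have D'0 : (0 < D `^ q^-1)%R by rewrite powR_gt0.
have mW1 : measurable_fun setT W1 by exact: measurable_wpow.
have W1pos : {ae leb, forall x, (0 < W1 x)%R}.
  by apply: filterS w1pos => x x0; rewrite powR_gt0.
have infN : wLnorm p W1 (eball a r) (EFin \o f) * (M^-1)%:E <=
    ereal_inf [set (psi1 a l)%:E * (wmeas W1 (eball a l)) `^ p^-1 | l in [set l : R | (t <= l)%R]].
  apply: le_ereal_inf_tmp => _ [l /= tl <-].
  have l0 : (0 < l)%R by exact: lt_le_trans tl.
  rewrite muleC lee_pdivrMl//.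
  apply: (@le_trans _ _ (wLnorm p W1 (eball a l) (EFin \o f))).
    apply: wLnorm_sub => //; first exact: wpow_ge0.
    by apply: eball_subr; exact: le_trans tl.
  apply: le_of_morrey_norm => //; [exact: psi1_gt0|exact: wLnorm_ge0|].
  by apply: wmeas_gt0 => //; exact: wpow_ge0.
have Ufine b l : (0 < l)%R -> U b l = (fine (U b l))%:E.
  by move=> l0; rewrite fineK// ge0_fin_numE ?U_fin// ltW ?U_gt0.
have Ur0 b l : (0 < l)%R -> (0 < fine (U b l))%R.
  by move=> l0; rewrite -lte_fin -Ufine ?U_gt0.
have Utr : (fine (U a t) <= D * fine (U a r))%R.
  rewrite -lee_fin EFinM -!Ufine//; apply: le_trans (U_dbl a r0).
  by apply: le_wmeas; [exact: wpow_ge0|exact: eball_subr].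
rewrite /growth -/(U a t) (Ufine a t t0) poweR_EFin inver gt_eqF ?powR_gt0 ?Ur0//.
rewrite /ball_density invfM EFinM muleA (muleAC (wLnorm _ _ _ _)) -muleA -EFinM.
apply: (@le_trans _ _ (wLnorm p W1 (eball a r) (EFin \o f) * (M^-1)%:E *
   ((fine (U a t) `^ q^-1)^-1)%:E)).
  apply: lee_wpmul2l; first by rewrite mule_ge0 ?wLnorm_ge0// lee_fin invr_ge0 ltW.
  rewrite lee_fin -invfM lef_pV2 ?posrE ?mulr_gt0 ?powR_gt0 ?Ur0//.
  rewrite mulrC -powRM ?(ltW D0) ?(ltW (Ur0 _ _ _))//.
  by apply: ge0_ler_powR; rewrite ?nnegrE ?invr_ge0 ?mulr_ge0 ?(ltW D0) ?(ltW q0) ?(ltW (Ur0 _ _ _)).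
by apply: lee_wpmul2r infN; rewrite lee_fin invr_ge0 powR_ge0.
Qed.

Lemma psi_series (kap : R -> R -> R) (c : nat -> R) :
  (forall k, 0 <= c k)%R ->
  (forall r t, (0 < r)%R -> (r < t)%R -> (0 <= kap r t)%R) ->
  (forall k r t, (0 < r)%R -> (2 ^+ k.+2 * r <= t)%R -> (c k <= kap r t)%R) ->
  psi_condition kap p q w1 w2 psi1 psi2 ->
  exists2 C : R, (0 < C)%R & forall f (M : R), (0 < M)%R ->
    morrey_norm (wLnorm p W1) p W1 psi1 (EFin \o f) <= M%:E ->
    forall a r, (0 < r)%R ->
    \sum_(k <oo) (c k)%:E * ball_density a (2 ^+ k.+2 * r) f <= (C * M * psi2 a r)%:E.
Proof.
move=> c0 kap0 ckap; rewrite /psi_condition; set S := [set _ | _ in _] => Sfin.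
have [K K0 SK] : exists2 K : R, (0 < K)%R & ereal_sup S <= K%:E.
  case: (ereal_sup S) Sfin => [x _|//|_]; last by exists 1%R => //; rewrite leNye.
  by exists (Num.max x 1)%R; rewrite ?lt_max ?ltr01 ?orbT// lee_fin le_max lexx.
have D'0 : (0 < D `^ q^-1)%R by rewrite powR_gt0.
exists (2 * D `^ q^-1 * K)%R; first by rewrite !mulr_gt0.
move=> f M M0 fM a r r0.
have fac0 : (0 < 2 * (M * D `^ q^-1))%R by rewrite !mulr_gt0.
have int_le : \int[@lebesgue_measure R]_(t in `]r, +oo[)
    ((kap r t)%:E * growth p q w1 w2 psi1 a t * (t^-1)%:E) <= (psi2 a r * K)%:E.
  rewrite EFinM -lee_pdivrMl ?psi2_gt0//; apply: le_trans SK.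
  by apply: ereal_sup_ubound; exists (a, r).
have growth0 t : (r < t)%R -> 0 <= growth p q w1 w2 psi1 a t.
  move=> rt; have t0 := lt_trans r0 rt; rewrite mule_ge0//.
    apply: le_ereal_inf_tmp => _ [l /= tl <-]; rewrite mule_ge0 ?poweR_ge0// lee_fin.
    by rewrite ltW// psi1_gt0// (lt_le_trans t0).
  by rewrite inve_ge0 poweR_ge0.
pose v k := ((2 * (M * D `^ q^-1))^-1)%:E * ((c k)%:E * ball_density a (2 ^+ k.+2 * r) f).
have cd0 k : 0 <= (c k)%:E * ball_density a (2 ^+ k.+2 * r) f.
  by rewrite mule_ge0 ?ball_density_ge0// lee_fin.
have : \sum_(k <oo) v k <= (psi2 a r * K)%:E.
  apply: le_trans int_le; apply: dyadic_series_le_integral => //.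
  - by move=> k; rewrite mule_ge0// lee_fin invr_ge0 ltW.
  - move=> t rt; apply: mule_ge0; last by rewrite lee_fin invr_ge0 ltW// (lt_trans r0).
    by apply: mule_ge0; [rewrite lee_fin; exact: kap0|exact: growth0].
  move=> k t kt tk; set rho := (2 ^+ k.+2 * r)%R.
  have rho0 : (0 < rho)%R by rewrite mulr_gt0// exprn_gt0.
  have t0 : (0 < t)%R by exact: lt_le_trans kt.
  have t2 : (t <= 2 * rho)%R by rewrite /rho mulrA -exprS ltW.
  have G := growth_ge a M0 rho0 kt t2 fM.
  apply: (@le_trans _ _ ((c k)%:E * (ball_density a rho f * ((M * D `^ q^-1)^-1)%:E) * (t^-1)%:E)); last first.
    apply: lee_wpmul2r; first by rewrite lee_fin invr_ge0 ltW.
    apply: (@le_trans _ _ ((c k)%:E * growth p q w1 w2 psi1 a t)).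
      by apply: lee_wpmul2l; rewrite ?lee_fin.
    apply: lee_wpmul2r; last by rewrite lee_fin; exact: ckap.
    apply: le_trans G; rewrite mule_ge0 ?ball_density_ge0// lee_fin invr_ge0 mulr_ge0 ?powR_ge0//.
    exact: ltW.
  rewrite /v -/rho; move: (ball_density_ge0 a rho f); set E := ball_density _ _ _; clearbody E => E0.
  have -> : (c k)%:E * (E * ((M * D `^ q^-1)^-1)%:E) * (t^-1)%:E =
      E * (c k * (M * D `^ q^-1)^-1 / t)%:E.
    by rewrite (muleCA _ E) -muleA -!EFinM.
  have -> : ((2 * (M * D `^ q^-1))^-1)%:E * ((c k)%:E * E) * (rho^-1)%:E =
      E * (c k * (M * D `^ q^-1)^-1 / (2 * rho))%:E.
    rewrite (muleC _ E) muleCA -!muleA -!EFinM; congr (_ * _%:E).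
    by field; rewrite !gt_eqF.
  apply: lee_wpmul2l => //; rewrite lee_fin; apply: ler_wpM2l.
    by rewrite mulr_ge0// invr_ge0 mulr_ge0 ?powR_ge0// ltW.
  by rewrite lef_pV2// posrE mulr_gt0.
rewrite nneseriesZl//.
rewrite lee_pdivrMl// -EFinM => /le_trans; apply.
by rewrite lee_fin le_eqVlt; apply/orP; left; apply/eqP; ring.
Qed.

End psi_series.

End annuli.

(** * Near and far parts of a function *)

Section divergent_integrals.
Context d (T : measurableType d) (R : realType) (mu : {measure set T -> \bar R}).
Local Open Scope ereal_scope.
Implicit Types f g : T -> R.

(** With the convention +oo - oo = -oo a divergent integral is infinite, never
    a spurious finite number. *)
Lemma abse_integral_pinfty g : measurable_fun setT g ->
  ~ mu.-integrable setT (EFin \o g) -> `|\int[mu]_x (g x)%:E| = +oo.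
Proof.
move=> mg ng; have mEg : measurable_fun setT (EFin \o g) by exact/measurable_EFinP.
rewrite integralE.
set P := integral _ _ _; set Q := integral _ _ _.
have P0 : 0 <= P by exact: integral_ge0.
have Q0 : 0 <= Q by exact: integral_ge0.
have : ~ (P < +oo /\ Q < +oo).
  move=> [Pfin Qfin]; apply: ng; apply/integrableP; split => //.
  rewrite (eq_integral (fun x => (EFin \o g)^\+ x + (EFin \o g)^\- x)); last first.
    by move=> x _; rewrite -[LHS]/((abse \o (EFin \o g)) x) fune_abse.
  rewrite ge0_integralD//; [exact: lte_add_pinfty|exact: measurable_funepos|exact: measurable_funeneg].
move: P0 Q0; case: P => [a| |]//; case: Q => [c| |]//= _ _ H.
by exfalso; apply: H; rewrite !ltry.
Qed.

Lemma integrable_dom f g : measurable_fun setT f ->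
  \int[mu]_x `|f x|%:E < +oo -> mu.-integrable setT (EFin \o f).
Proof. by move=> mf fo; apply/integrableP; split => //; exact/measurable_EFinP. Qed.

(** If one of the integrals on the right diverges then the right-hand side is
    infinite, so no integrability is assumed. *)
Lemma abse_integralD_le f g : measurable_fun setT f -> measurable_fun setT g ->
  `|\int[mu]_x (f x + g x)%:E| <= `|\int[mu]_x (f x)%:E| + \int[mu]_x `|g x|%:E.
Proof.
move=> mf mg; have g0 : 0 <= \int[mu]_x `|g x|%:E.
  by apply: integral_ge0 => x _; rewrite lee_fin.
have [goo|gfin] := eqVneq (\int[mu]_x `|g x|%:E) +oo.
  by rewrite goo addey ?leey// -ltNye (lt_le_trans _ (abse_ge0 _))// ltNyr.
have ig : mu.-integrable setT (EFin \o g).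
  by apply: integrable_dom => //; rewrite ltey.
have [If|nf] := pselect (mu.-integrable setT (EFin \o f)); last first.
  by rewrite (abse_integral_pinfty mf nf) addye ?leey// -ltNye (lt_le_trans _ g0)// ltNyr.
under eq_integral do rewrite EFinD.
rewrite integralD//; apply: (le_trans (lee_abs_add _ _)); apply: leeD => //.
exact: (le_abse_integral _ _ (measurable_int mu ig)).
Qed.

(** The analogue for b * int F - int H. When the first term on the right is
    finite and b is nonzero, F1 and H1 are integrable and all integrals add up.
    When b = 0 nothing can be said of F1, because 0 * oo = 0, but then F1 and F2
    disappear from the inequality. *)
Lemma abse_integral_commD_le (b : R) (F1 F2 H1 H2 : T -> R) :
  measurable_fun setT F1 -> measurable_fun setT F2 ->
  measurable_fun setT H1 -> measurable_fun setT H2 ->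
  \int[mu]_x `|F2 x|%:E < +oo ->
  `|b%:E * \int[mu]_x (F1 x + F2 x)%:E - \int[mu]_x (H1 x + H2 x)%:E| <=
  `|b%:E * \int[mu]_x (F1 x)%:E - \int[mu]_x (H1 x)%:E| +
    \int[mu]_x `|b * F2 x - H2 x|%:E.
Proof.
move=> mF1 mF2 mH1 mH2 F2fin.
have iF2 := integrable_dom F2 mF2 F2fin.
set I := \int[mu]_x `|b * F2 x - H2 x|%:E.
have I0 : 0 <= I by apply: integral_ge0 => x _; rewrite lee_fin.
have [Ioo|Ifin] := eqVneq I +oo.
  by rewrite Ioo addey ?leey// -ltNye (lt_le_trans _ (abse_ge0 _))// ltNyr.
have mbF : measurable_fun setT (fun x => b * F2 x)%R by exact: measurable_funM.
have iD : mu.-integrable setT (EFin \o (fun x => b * F2 x - H2 x)%R).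
  by apply: integrable_dom => //; [exact: measurable_funB|rewrite ltey].
have ibF : mu.-integrable setT (EFin \o (fun x => b * F2 x)%R).
  by have := @integrableZl _ _ _ mu _ measurableT b _ iF2; apply.
have iH2 : mu.-integrable setT (EFin \o H2).
  have := @integrableB _ _ _ mu _ measurableT _ _ ibF iD.
  apply: eq_integrable => // x _ /=; rewrite -EFinB; congr (_%:E); ring.
have intD : \int[mu]_x (b * F2 x - H2 x)%:E = b%:E * \int[mu]_x (F2 x)%:E - \int[mu]_x (H2 x)%:E.
  under eq_integral do rewrite EFinB EFinM.
  rewrite integralB//; congr (_ - _); exact: integralZl.
have [b0|b0] := eqVneq b 0%R.
  rewrite b0 !mul0e !sub0e !abseN; apply: (le_trans (abse_integralD_le mH1 mH2)).
  apply: leeD => //; rewrite /I b0; under [leRHS]eq_integral do rewrite mul0r sub0r normrN.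
  by [].
have [JJ|nJ] := eqVneq `|b%:E * \int[mu]_x (F1 x)%:E - \int[mu]_x (H1 x)%:E| +oo.
  by rewrite JJ addye ?leey// -ltNye (lt_le_trans _ I0)// ltNyr.
have bF_inf : `|\int[mu]_x (F1 x)%:E| = +oo -> `|b%:E * \int[mu]_x (F1 x)%:E| = +oo.
  by move=> h; rewrite abseM h muleC gt0_mulye// lte_fin normr_gt0.
have subinf (y z : \bar R) : (`|y| = +oo \/ `|z| = +oo) -> `|y - z| = +oo.
  by case: y z => [y| |] [z| |] []//.
have iF1 : mu.-integrable setT (EFin \o F1).
  apply: contrapT => /(abse_integral_pinfty mF1)/bF_inf h.
  by move/eqP: nJ; apply; apply: subinf; left.
have iH1 : mu.-integrable setT (EFin \o H1).
  apply: contrapT => /(abse_integral_pinfty mH1) h.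
  by move/eqP: nJ; apply; apply: subinf; right.
under eq_integral do rewrite EFinD.
under [X in _ - X]eq_integral do rewrite EFinD.
rewrite !integralD//.
apply: (@le_trans _ _ `|(b%:E * \int[mu]_x (F1 x)%:E - \int[mu]_x (H1 x)%:E) +
   \int[mu]_x (b * F2 x - H2 x)%:E|).
  rewrite intD.
  have := integrable_fin_num measurableT iF1; have := integrable_fin_num measurableT iF2.
  have := integrable_fin_num measurableT iH1; have := integrable_fin_num measurableT iH2.
  rewrite /comp.
  move: (integral _ _ _) (integral _ _ _) (integral _ _ _) (integral _ _ _).
  move=> [u| |]// [v| |]// [z| |]// [y| |]// _ _ _ _.
  rewrite /= lee_fin.
  by rewrite le_eqVlt; apply/orP; left; apply/eqP; congr (`|_|%R); ring.
apply: (le_trans (lee_abs_add _ _)); apply: leeD => //.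
exact: (le_abse_integral _ _ (measurable_int mu iD)).
Qed.

End divergent_integrals.

Section localization.
Context {R : realType} {n : nat}.
Local Open Scope ereal_scope.
Local Notation leb := (@lebesgue_rV R n).
Implicit Types (a x : 'rV[R]_n) (f b h : 'rV[R]_n -> R).

Lemma integral_reflect (F : 'rV[R]_n -> R) x : measurable_fun setT F ->
  (forall y, 0 <= F y)%R -> \int[leb]_y (F (x - y)%R)%:E = \int[leb]_y (F y)%:E.
Proof.
move=> mF F0; have N1 : (-1 != 0 :> R)%R by rewrite oppr_eq0 oner_eq0.
have mEF : measurable_fun setT (EFin \o F) by exact/measurable_EFinP.
have := @integral_rV_affine _ _ x (-1) setT (EFin \o F) N1 measurableT mEF
  (fun y _ => F0 y).
rewrite normrN1 expr1n mul1e preimage_setT => <-.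
by apply: eq_integral => y _; rewrite /= scaleN1r.
Qed.

Variables (Omega : 'rV[R]_n -> R) (alpha : R).
Hypothesis mO : measurable_fun setT Omega.
Let beta : R := (n%:R - alpha)%R.
Let ker y : R := (Omega y / enorm y `^ beta)%R.

Let mker : measurable_fun setT ker := measurable_kernel alpha mO.

Let local (E : set 'rV[R]_n) f : 'rV[R]_n -> R := (fun y => f y * \1_E y)%R.

Let measurable_local (E : set 'rV[R]_n) f : measurable E -> measurable_fun setT f ->
  measurable_fun setT (local E f).
Proof. by move=> mE mf; apply: measurable_funM => //; exact: measurable_indic. Qed.

Let local_split (E : set 'rV[R]_n) f y : f y = (local E f y + local (~` E) f y)%R.
Proof.
rewrite /local -mulrDr !indicE in_setC.
by case: (y \in E); rewrite ?addr0 ?add0r mulr1.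
Qed.

(** The convolution integrand is reflected by y |-> x - y. *)
Lemma far_integralE (E : set 'rV[R]_n) h x : measurable E -> measurable_fun setT h ->
  \int[leb]_y `|ker y * local E h (x - y)|%:E =
  \int[leb]_(z in E) (`|Omega (x - z)| / enorm (x - z) `^ beta * `|h z|)%:E.
Proof.
move=> mE mh; pose F z := `|ker (x - z) * local E h z|%R.
have mF : measurable_fun setT F.
  apply: measurableT_comp => //; apply: measurable_funM; last exact: measurable_local.
  by apply: (measurableT_comp mker); exact: measurable_rVB.
rewrite [RHS]integral_mkcond -[LHS](integral_reflect x _ (fun y => normr_ge0 _)); last first.
  apply: measurableT_comp => //; apply: measurable_funM => //.
  by apply: (measurableT_comp (measurable_local mE mh)); exact: measurable_rVB.
apply: eq_integral => z _; rewrite (_ : x - (x - z) = z)%R; last by rewrite opprB addrC subrK.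
rewrite /patch /local indicE.
case: ifPn => _; last by rewrite !mulr0 normr0.
by rewrite mulr1 normrM normrM normfV (ger0_norm (powR_ge0 _ _)).
Qed.

Lemma frac_op_local (E : set 'rV[R]_n) f x : measurable E -> measurable_fun setT f ->
  `|frac_op Omega alpha f x| <= `|frac_op Omega alpha (fun y => f y * \1_E y)%R x| +
   \int[leb]_(z in ~` E) (`|Omega (x - z)| / enorm (x - z) `^ beta * `|f z|)%:E.
Proof.
move=> mE mf; rewrite -far_integralE//; last exact: measurableC.
have mx g : measurable_fun setT g -> measurable_fun setT (fun y => ker y * g (x - y))%R.
  move=> mg; apply: measurable_funM => //.
  by apply: (measurableT_comp mg); exact: measurable_rVB.
apply: le_trans (abse_integralD_le leb (mx _ (measurable_local mE mf))
   (mx _ (measurable_local (measurableC mE) mf))).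
rewrite le_eqVlt; apply/orP; left; apply/eqP; congr `|_|.
by apply: eq_integral => y _; rewrite -mulrDr -local_split.
Qed.

Lemma commutator_local (E : set 'rV[R]_n) b f x :
  measurable E -> measurable_fun setT b -> measurable_fun setT f ->
  \int[leb]_(z in ~` E) (`|Omega (x - z)| / enorm (x - z) `^ beta * `|f z|)%:E < +oo ->
  `|commutator b (frac_op Omega alpha) f x| <=
  `|commutator b (frac_op Omega alpha) (fun y => f y * \1_E y)%R x| +
   \int[leb]_(z in ~` E)
     (`|Omega (x - z)| / enorm (x - z) `^ beta * (`|b x - b z| * `|f z|))%:E.
Proof.
move=> mE mb mf.
have mE' : measurable (~` E) by exact: measurableC.
rewrite -far_integralE// => fin.
have mbb : measurable_fun setT (fun z => (b x - b z) * f z)%R.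
  by apply: measurable_funM => //; exact: measurable_funB.
under [X in _ <= _ + X]eq_integral do rewrite -normrM.
rewrite -(far_integralE x mE' mbb).
have mx g : measurable_fun setT g -> measurable_fun setT (fun y => ker y * g (x - y))%R.
  move=> mg; apply: measurable_funM => //.
  by apply: (measurableT_comp mg); exact: measurable_rVB.
have mbf : measurable_fun setT (b \* f)%R by exact: measurable_funM.
have := @abse_integral_commD_le _ _ _ leb (b x) _ _ _ _
  (mx _ (measurable_local mE mf)) (mx _ (measurable_local mE' mf))
  (mx _ (measurable_local mE mbf)) (mx _ (measurable_local mE' mbf)) fin.
congr (_ <= _).
- congr `|_|; rewrite /commutator; congr (_ * _ - _); apply: eq_integral => y _.
    by rewrite -mulrDr -local_split.
  by rewrite -mulrDr -local_split.
- congr (_ + _); last first.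
    by apply: eq_integral => y _; congr (`|_|%:E)%R; rewrite /local /=; ring.
  rewrite /commutator; congr `|_ - _|; apply: eq_integral => y _.
  by rewrite /local /=; congr (_%:E); rewrite /ker /beta; ring.
Qed.

End localization.

(** * Bounds for the near and far parts *)

Section local_to_morrey.
Context {R : realType} {n : nat}.
Hypothesis n_gt0 : (0 < n)%N.
Local Open Scope ereal_scope.
Local Notation leb := (@lebesgue_rV R n).
Implicit Types (a x : 'rV[R]_n) (r t L M : R) (f h b : 'rV[R]_n -> R).

Lemma lee_poweR_addle (q : R) (x y : \bar R) : (0 < q)%R -> 0 <= x -> 0 <= y ->
  (x + y) `^ q <= (2 `^ q)%:E * (x `^ q + y `^ q).
Proof.
move=> q0 x0 y0; have c0 : 0 < (2 `^ q)%:E by rewrite lte_fin powR_gt0.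
have q_neq0 : (q != 0)%R by rewrite gt_eqF.
move: x0 y0; case: x => [x| |]//; case: y => [y| |]//.
- by rewrite !poweR_EFin -EFinD -EFinM !lee_fin => x0 y0; exact: powR_addle.
- by move=> _ _; rewrite addey// !poweRyr// poweR_EFin addey// gt0_muley ?leey.
- by move=> _ _; rewrite addye// !poweRyr// poweR_EFin addye// gt0_muley ?leey.
- by move=> _ _; rewrite !poweRyr// gt0_muley// leey.
Qed.

Lemma wLnorm_local p w (E : set 'rV[R]_n) f : (0 < p)%R ->
  wLnorm p w setT (fun y => (f y * \1_E y)%:E) = wLnorm p w E (EFin \o f).
Proof.
move=> p0; rewrite wLnormE (wLnormE p w setT (fun y => f y * \1_E y)%R).
rewrite [in RHS]integral_mkcond; congr (_ `^ _); apply: eq_integral => y _.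
rewrite /patch indicE; case: ifPn => _; first by rewrite mulr1.
by rewrite mulr0 normr0 powR0 ?mul0r// gt_eqF.
Qed.

Lemma morrey_norm_le (N : set 'rV[R]_n -> ('rV[R]_n -> \bar R) -> \bar R)
    p w psi (f : 'rV[R]_n -> \bar R) (C : R) :
  (forall a r, (0 < r)%R -> (0 < psi a r)%R) ->
  (forall a r, (0 < r)%R -> 0 < wmeas w (eball a r)) ->
  (forall a r, (0 < r)%R -> wmeas w (eball a r) < +oo) ->
  (forall a r, (0 < r)%R ->
     N (eball a r) f <= (C * psi a r)%:E * wmeas w (eball a r) `^ p^-1) ->
  morrey_norm N p w psi f <= C%:E.
Proof.
move=> psi0 w0 wfin H; apply: ge_ereal_sup => _ [[a r] /= r0 <-].
move: (w0 a r r0) (wfin a r r0) (H a r r0).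
case: (wmeas w _) => // W; rewrite lte_fin => W0 _.
have Wp0 : (0 < W `^ p^-1)%R by rewrite powR_gt0.
rewrite poweR_EFin inver gt_eqF// -!EFinM -invfM => NW.
rewrite lee_pdivrMl ?mulr_gt0 ?psi0//; apply: (le_trans NW).
by rewrite lee_fin le_eqVlt; apply/orP; left; apply/eqP; ring.
Qed.

Section static_bounds.
Variables (p q alpha D C1 : R) (w1 w2 : 'rV[R]_n -> R) (psi2 : 'rV[R]_n -> R -> R).
Variable Omega : 'rV[R]_n -> R.
Hypotheses (p0 : (0 < p)%R) (q0 : (0 < q)%R) (D0 : (0 < D)%R) (C10 : (0 < C1)%R).
Hypothesis alpha_lt : (alpha < n%:R)%R.
Hypotheses (mO : measurable_fun setT Omega).
Let W1 := wpow w1 p.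
Let u := wpow w2 q.
Let U a t := wmeas u (eball a t).
Let beta : R := (n%:R - alpha)%R.
Hypothesis U_gt0 : forall a t, (0 < t)%R -> 0 < U a t.
Hypothesis U_fin : forall a t, (0 < t)%R -> U a t < +oo.
Hypothesis U_dbl : forall a t, (0 < t)%R -> U a (2 * t) <= D%:E * U a t.

Local Notation density := (ball_density p q w1 w2).

(** The hypothesis on f in which the integral condition is used; c k = 1 for
    the operator and c k = k + 3 for the commutator. *)
Definition density_series (c : nat -> R) f L := forall a r, (0 < r)%R ->
  \sum_(k <oo) (c k)%:E * density a (2 ^+ k.+2 * r) f <= (L * psi2 a r)%:E.

Let UE a t : (0 < t)%R -> U a t = (fine (U a t))%:E.
Proof. by move=> t0; rewrite fineK// ge0_fin_numE ?U_fin// ltW ?U_gt0. Qed.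

Let U0 a t : (0 < t)%R -> (0 < fine (U a t))%R.
Proof. by move=> t0; rewrite -lte_fin -UE ?U_gt0. Qed.

Let beta0 : (0 < beta)%R. Proof. by rewrite subr_gt0. Qed.

Let term_ge0 (c : nat -> R) f a r k : (0 <= c k)%R ->
  0 <= (c k)%:E * density a (2 ^+ k.+2 * r) f.
Proof. by move=> c0; rewrite mule_ge0 ?ball_density_ge0// lee_fin. Qed.

(** The ball B(a,2r) is inside B(a,4r), whose density is the first term of the
    series; doubling replaces w2^q(B(a,4r)) by w2^q(B(a,r)). *)
Lemma near_bound (c : nat -> R) f L a r : (forall k, 1 <= c k)%R ->
  density_series c f L -> (0 < r)%R ->
  wLnorm p W1 (eball a (2 * r)) (EFin \o f) <=
  ((D * D) `^ q^-1 * L * psi2 a r)%:E * U a r `^ q^-1.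
Proof.
move=> c1 fL r0.
have c0 k : (0 <= c k)%R by exact: le_trans (c1 k).
have r40 : (0 < 2 ^+ 2 * r)%R by rewrite mulr_gt0.
have d4 : density a (2 ^+ 2 * r) f <= (L * psi2 a r)%:E.
  apply: le_trans (fL a r r0).
  apply: (@le_trans _ _ ((c 0%N)%:E * density a (2 ^+ 2 * r) f)).
    by rewrite -[leLHS]mul1e; apply: lee_wpmul2r; [exact: ball_density_ge0|rewrite lee_fin].
  have := @nneseries_lim_ge _ (fun k => (c k)%:E * density a (2 ^+ k.+2 * r) f) xpredT 0 1%N
    (fun k _ _ => term_ge0 f a r (c0 k)).
  by rewrite big_nat1.
apply: (@le_trans _ _ (wLnorm p W1 (eball a (2 ^+ 2 * r)) (EFin \o f))).
  apply: wLnorm_sub => //; first exact: wpow_ge0.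
  by apply: eball_subr; rewrite expr2 -mulrA ler_peMl ?mulr_ge0 ?(ltW r0)// ler1n.
have U4 : (fine (U a (2 ^+ 2 * r)) <= D * D * fine (U a r))%R.
  rewrite -lee_fin !EFinM -!UE// expr2 -(mulrA 2%R) -muleA.
  apply: (le_trans (U_dbl a _)); first by rewrite mulr_gt0.
  by apply: lee_wpmul2l; [rewrite lee_fin ltW|exact: U_dbl].
have Uq0 : (0 < fine (U a (2 ^+ 2 * r)) `^ q^-1)%R by rewrite powR_gt0// U0.
have -> : wLnorm p W1 (eball a (2 ^+ 2 * r)) (EFin \o f) =
    density a (2 ^+ 2 * r) f * (fine (U a (2 ^+ 2 * r)) `^ q^-1)%:E.
  by rewrite /ball_density -muleA -EFinM mulVf ?mule1// gt_eqF.
apply: (@le_trans _ _ ((L * psi2 a r)%:E * (fine (U a (2 ^+ 2 * r)) `^ q^-1)%:E)).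
  by apply: lee_wpmul2r => //; rewrite lee_fin ltW.
have Lp0 : (0 <= L * psi2 a r)%R.
  by rewrite -lee_fin; apply: le_trans d4; exact: ball_density_ge0.
rewrite (UE a r0) poweR_EFin -!EFinM lee_fin.
rewrite (_ : _ * L * _ * _ = (L * psi2 a r) * ((D * D) `^ q^-1 * fine (U a r) `^ q^-1))%R; last by ring.
apply: ler_wpM2l => //.
rewrite -powRM ?mulr_ge0 ?(ltW D0) ?(ltW (U0 _ _))//.
by apply: ge0_ler_powR; rewrite ?nnegrE ?invr_ge0 ?mulr_ge0 ?(ltW D0) ?(ltW q0) ?(ltW (U0 _ _)).
Qed.

Let div_U (X : \bar R) (k : R) a t f : (0 < t)%R ->
  U a t `^ q^-1 * X <= k%:E * wLnorm p W1 (eball a t) (EFin \o f) ->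
  X <= k%:E * density a t f.
Proof.
move=> t0; have Uq0 : (0 < fine (U a t) `^ q^-1)%R by rewrite powR_gt0// U0.
rewrite (UE a t0) poweR_EFin => H.
by rewrite /ball_density muleA lee_pdivlMr// muleC.
Qed.

Hypothesis ball_est : forall a x t f, (0 < t)%R -> (enorm (x - a) <= t)%R ->
  measurable_fun setT f ->
  U a t `^ q^-1 * \int[leb]_(y in eball a t) (`|Omega (x - y)| * `|f y|)%:E <=
  (C1 * t `^ beta)%:E * wLnorm p W1 (eball a t) (EFin \o f).

Let dist_le x a r k : (0 < r)%R -> (enorm (x - a) < r)%R ->
  (enorm (x - a) <= 2 ^+ k * r)%R.
Proof.
move=> r0 xa; apply: (le_trans (ltW xa)).
by apply: ler_peMl; [exact: ltW|rewrite exprn_ege1// ler1n].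
Qed.

Lemma far_bound (c : nat -> R) f L a x r : (forall k, 1 <= c k)%R ->
  measurable_fun setT f -> density_series c f L -> (0 < r)%R -> (enorm (x - a) < r)%R ->
  \int[leb]_(y in ~` eball a (2 * r))
    (`|Omega (x - y)| / enorm (x - y) `^ beta * `|f y|)%:E <=
  (4 `^ beta * C1 * L * psi2 a r)%:E.
Proof.
move=> c1 mf fL r0 xa.
have c0 k : (0 <= c k)%R by exact: le_trans (c1 k).
pose e k := C1%:E * ((c k)%:E * density a (2 ^+ k.+2 * r) f).
have e0 k : 0 <= e k by rewrite mule_ge0 ?term_ge0// lee_fin ltW.
have maf : measurable_fun setT (fun y => `|f y|)%R by exact: measurableT_comp.
apply: (le_trans (integral_annuli_le mO maf (fun y => normr_ge0 _) beta0 r0 xa e0 _)).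
  move=> k; have rk : (0 < 2 ^+ k.+2 * r)%R by rewrite mulr_gt0// exprn_gt0.
  have := div_U rk (ball_est rk (dist_le k.+2 r0 xa) mf).
  move/le_trans; apply; rewrite mulrC EFinM -!muleA; apply: lee_wpmul2l.
    by rewrite lee_fin powR_ge0.
  apply: lee_wpmul2l; first by rewrite lee_fin ltW.
  by rewrite -[leLHS]mul1e; apply: lee_wpmul2r; [exact: ball_density_ge0|rewrite lee_fin].
rewrite nneseriesZl => [|k _]; last exact: term_ge0.
rewrite muleA -EFinM -2!mulrA mulrA (EFinM (_ * _)%R); apply: lee_wpmul2l (fL a r r0).
by rewrite lee_fin mulr_ge0 ?powR_ge0// ltW.
Qed.

(** Split |b(x) - b(y)| through m = favg b a r. The part with |b(x) - m| is
    [far_bound]. On B(a, 2^(k+2) r), |b(y) - m| is at most the deviation from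
    the average over that ball plus (k + 2) 2^n bt, which explains the
    coefficients k + 3 of the series. *)
Lemma far_bound_comm (C2 : R) b (bt : R) f L a x r : (0 < C2)%R ->
  (forall a' x' t f', (0 < t)%R -> (enorm (x' - a') <= t)%R -> measurable_fun setT f' ->
    U a' t `^ q^-1 * \int[leb]_(y in eball a' t)
        (`|Omega (x' - y)| * (`|b y - favg b a' t| * `|f' y|))%:E <=
    (C2 * bt * t `^ beta)%:E * wLnorm p W1 (eball a' t) (EFin \o f')) ->
  loc_integrable b -> (0 < bt)%R -> bmo_seminorm b <= bt%:E ->
  measurable_fun setT f -> density_series (fun k => k.+3%:R) f L ->
  (0 < r)%R -> (enorm (x - a) < r)%R ->
  \int[leb]_(y in ~` eball a (2 * r))
    (`|Omega (x - y)| / enorm (x - y) `^ beta * (`|b x - b y| * `|f y|))%:E <=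
  ((`|b x - favg b a r| + bt) *
     (4 `^ beta * (C1 + C2 + 2 ^+ n * C1) * L * psi2 a r))%:E.
Proof.
move=> C20 est lb bt0 bb mf fL r0 xa.
pose c (k : nat) : R := k.+3%:R.
have c1 k : (1 <= c k)%R by rewrite ler1n.
have c0 k : (0 <= c k)%R by exact: le_trans (c1 k).
have mb := lb.1.
set m := favg b a r.
have mOx : measurable_fun setT (fun y : 'rV[R]_n => `|Omega (x - y)|)%R.
  apply: measurableT_comp => //.
  by apply: (measurableT_comp mO); exact: measurable_rVB.
have mdev (z : R) : measurable_fun setT (fun y => `|b y - z|)%R.
  by apply: measurableT_comp => //; exact: measurable_funB.
have maf : measurable_fun setT (fun y => `|f y|)%R by exact: measurableT_comp.
have mdf (z : R) : measurable_fun setT (fun y => `|b y - z| * `|f y|)%R by exact: measurable_funM.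
have df0 (z : R) y : (0 <= `|b y - z| * `|f y|)%R by rewrite mulr_ge0.
have mE : measurable (~` eball a (2 * r)) by apply: measurableC; exact: measurable_eball.
pose K y : R := (`|Omega (x - y)| / enorm (x - y) `^ beta)%R.
have K0 y : (0 <= K y)%R by rewrite mulr_ge0// invr_ge0 powR_ge0.
have mK : measurable_fun setT K.
  rewrite (_ : K = fun y : 'rV[R]_n => (`|Omega (x - y)| * enorm (x - y) `^ (- beta)))%R; last first.
    by apply/funext => y; rewrite /K powRN.
  apply: measurable_funM => //; apply: (measurableT_comp (measurable_powR _)).
  by apply: (measurableT_comp (@measurable_enorm R n)); exact: measurable_rVB.
have Lp0 : (0 <= L * psi2 a r)%R.
  rewrite -lee_fin; apply: le_trans (fL a r r0); apply: nneseries_ge0 => k _ _.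
  by apply: (term_ge0 f a r (c0 k)).
have farb : \int[leb]_(y in ~` eball a (2 * r)) (K y * (`|b y - m| * `|f y|))%:E <=
    (bt * (4 `^ beta * (C2 + 2 ^+ n * C1) * L * psi2 a r))%:E.
  pose e k := (bt * (C2 + 2 ^+ n * C1))%:E * ((c k)%:E * density a (2 ^+ k.+2 * r) f).
  have k0 : (0 <= bt * (C2 + 2 ^+ n * C1))%R.
    by rewrite mulr_ge0 ?addr_ge0 ?mulr_ge0 ?exprn_ge0 ?(ltW bt0) ?(ltW C20) ?(ltW C10).
  have e0 k : 0 <= e k by rewrite mule_ge0 ?term_ge0// lee_fin.
  apply: (le_trans (integral_annuli_le mO (mdf m) (df0 m) beta0 r0 xa e0 _)).
    move=> k; set rho := (2 ^+ k.+2 * r)%R.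
    have rk : (0 < rho)%R by rewrite mulr_gt0// exprn_gt0.
    have mB : measurable (eball a rho) by exact: measurable_eball.
    have h1 := div_U rk (est _ _ _ _ rk (dist_le k.+2 r0 xa) mf).
    have h2 := div_U rk (ball_est rk (dist_le k.+2 r0 xa) mf).
    have h3 := favg_dilate n_gt0 a k.+2 r0 lb (ltW bt0) bb.
    apply: (@le_trans _ _ (\int[leb]_(y in eball a rho)
       ((`|Omega (x - y)| * (`|b y - favg b a rho| * `|f y|))%:E +
        (k.+2%:R * (2 ^+ n * bt) * (`|Omega (x - y)| * `|f y|))%:E))).
      apply: le_lower_integral => y _; first by rewrite lee_fin mulr_ge0.
      rewrite -EFinD lee_fin mulrCA -[X in (_ <= X + _)%R]mulrCA -mulrDl.
      apply: ler_wpM2r; first by rewrite mulr_ge0.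
      apply: (le_trans (ler_distD (favg b a rho) _ _)); rewrite lerD2l.
      by rewrite distrC.
    rewrite ge0_integralD//; first last.
    - by apply/measurable_EFinP/measurable_funTS; do !apply: measurable_funM.
    - by move=> y _; rewrite lee_fin !mulr_ge0// ltW.
    - by apply/measurable_EFinP/measurable_funTS; do !apply: measurable_funM.
    rewrite integralZl_fin//; first last.
    - by rewrite !mulr_ge0// ltW.
    - exact: measurable_funM.
    apply: (le_trans (leeD h1 (lee_wpmul2l _ h2))).
      by rewrite lee_fin !mulr_ge0// ltW.
    rewrite /e -/rho; have := ball_density_ge0 p q w1 w2 a rho f.
    set E := density a rho f; clearbody E => E0.
    rewrite [X in _ + X]muleA -EFinM -ge0_muleDl ?lee_fin; last 2 first.
      by rewrite !mulr_ge0 ?powR_ge0 ?(ltW C20) ?(ltW bt0).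
      by rewrite !mulr_ge0 ?powR_ge0 ?(ltW C10) ?(ltW bt0).
    rewrite !muleA -!EFinM; apply: lee_wpmul2r => //; rewrite lee_fin.
    have -> : c k = (k.+2%:R + 1)%R by rewrite natr1.
    rewrite -subr_ge0 [X in (0 <= X)%R](_ : _ =
      rho `^ beta * bt * (C2 * k.+2%:R + 2 ^+ n * C1))%R; last by ring.
    by rewrite mulr_ge0 ?addr_ge0 ?mulr_ge0 ?powR_ge0 ?exprn_ge0 ?(ltW bt0) ?(ltW C20) ?(ltW C10).
  rewrite nneseriesZl => [|k _]; last exact: (term_ge0 f a r (c0 k)).
  rewrite muleA -EFinM.
  apply: (le_trans (lee_wpmul2l _ (fL a r r0))); first by rewrite lee_fin mulr_ge0 ?powR_ge0.
  by rewrite -EFinM lee_fin le_eqVlt; apply/orP; left; apply/eqP; ring.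
have fara := far_bound c1 mf fL r0 xa.
apply: (@le_trans _ _ (\int[leb]_(y in ~` eball a (2 * r))
   ((`|b x - m| * (K y * `|f y|))%:E + (K y * (`|b y - m| * `|f y|))%:E))).
  apply: le_lower_integral => y _; first by rewrite lee_fin; apply: mulr_ge0; [exact: K0|exact: mulr_ge0].
  rewrite -EFinD lee_fin (mulrCA `|b x - m|%R) -mulrDr -mulrDl.
  apply: ler_wpM2l; first exact: K0.
  apply: ler_wpM2r => //; rewrite -(distrC m (b y)).
  exact: ler_distD.
have mKf : measurable_fun setT (fun y => K y * `|f y|)%R by exact: measurable_funM.
have mKbf : measurable_fun setT (fun y => K y * (`|b y - m| * `|f y|))%R.
  exact: measurable_funM.
rewrite ge0_integralD//; first last.
- exact/measurable_EFinP/measurable_funTS.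
- by move=> y _; rewrite lee_fin; apply: mulr_ge0; [exact: K0|exact: mulr_ge0].
- by apply/measurable_EFinP/measurable_funTS; exact: measurable_funM.
- by move=> y _; rewrite lee_fin; apply: mulr_ge0 => //; apply: mulr_ge0 => //; exact: K0.
rewrite integralZl_fin//; last by move=> y; apply: mulr_ge0; first exact: K0.
rewrite (mulrDl _ bt) EFinD; apply: leeD.
  apply: (le_trans (lee_wpmul2l _ fara)); first by rewrite lee_fin.
  rewrite -EFinM lee_fin -!mulrA; apply: ler_wpM2l => //; apply: ler_wpM2l; first exact: powR_ge0.
  apply: ler_wpM2r => //; rewrite -addrA lerDl addr_ge0 ?mulr_ge0 ?exprn_ge0 ?(ltW C20) ?(ltW C10)//.
apply: (le_trans farb).
rewrite lee_fin -!mulrA; apply: ler_wpM2l; first exact: ltW.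
apply: ler_wpM2l; first exact: powR_ge0.
by apply: ler_wpM2r => //; rewrite lerD2r lerDr ltW.
Qed.

End static_bounds.

End local_to_morrey.

(** * Local and Morrey bounds in space *)

Section morrey_bounds.
Context {R : realType} {n : nat}.
Hypothesis n_gt0 : (0 < n)%N.
Local Open Scope ereal_scope.
Local Notation leb := (@lebesgue_rV R n).
Implicit Types (a x : 'rV[R]_n) (r t p q L M : R) (f h b w : 'rV[R]_n -> R).

Lemma wLnorm_addle q w (B : set 'rV[R]_n) (g g1 : 'rV[R]_n -> \bar R) h : (0 < q)%R ->
  measurable B -> measurable_fun setT w -> (forall x, 0 <= w x)%R ->
  measurable_fun setT g1 -> measurable_fun setT h ->
  (forall x, B x -> `|g x| <= `|g1 x| + `|h x|%:E) ->
  wLnorm q w B g <=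
  (2 * 2 `^ q^-1)%:E * (wLnorm q w B g1 + wLnorm q w B (EFin \o h)).
Proof.
move=> q0 mB mw w0 mg1 mh gle.
have pos (k : 'rV[R]_n -> \bar R) x : 0 <= `|k x| `^ q * (w x)%:E.
  by rewrite mule_ge0 ?poweR_ge0// lee_fin.
have mpow (k : 'rV[R]_n -> \bar R) : measurable_fun setT k ->
    measurable_fun B (fun x => `|k x| `^ q * (w x)%:E).
  move=> mk; apply: measurable_funTS; apply: emeasurable_funM; last exact/measurable_EFinP.
  by apply: (measurableT_comp (measurable_poweR _)); exact: measurableT_comp.
have mEh : measurable_fun setT (EFin \o h) by exact/measurable_EFinP.
set P := \int[leb]_(x in B) (`|g1 x| `^ q * (w x)%:E).
set Q := \int[leb]_(x in B) (`|(EFin \o h) x| `^ q * (w x)%:E).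
have P0 : 0 <= P by exact: integral_ge0.
have Q0 : 0 <= Q by exact: integral_ge0.
have step : \int[leb]_(x in B) (`|g x| `^ q * (w x)%:E) <= (2 `^ q)%:E * (P + Q).
  apply: (@le_trans _ _ (\int[leb]_(x in B) ((2 `^ q)%:E *
      (`|g1 x| `^ q * (w x)%:E + `|(EFin \o h) x| `^ q * (w x)%:E)))).
    apply: le_lower_integral => x Bx //.
    rewrite -ge0_muleDl ?poweR_ge0// muleA; apply: lee_wpmul2r; first by rewrite lee_fin.
    apply: le_trans (lee_poweR_addle q0 (abse_ge0 _) (abse_ge0 _)).
    by apply: lee_poweR; [exact: ltW| |exact: gle].
  rewrite ge0_integralZl//; last 2 first.
  - by apply: emeasurable_funD; exact: mpow.
  - by move=> x _; rewrite adde_ge0.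
  rewrite ge0_integralD//; [exact: mpow|exact: mpow].
have qi0 : (0 < q^-1)%R by rewrite invr_gt0.
apply: (@le_trans _ _ (((2 `^ q)%:E * (P + Q)) `^ q^-1)).
  by apply: lee_poweR step; [exact: ltW|exact: integral_ge0].
have c0 : 0 <= (2 `^ q)%:E by rewrite lee_fin powR_ge0.
rewrite (poweRM _ c0 (adde_ge0 P0 Q0)).
rewrite poweR_EFin -powRrM mulfV ?gt_eqF// powRr1// EFinM -muleA.
by apply: lee_wpmul2l => //; exact: (lee_poweR_addle qi0 P0 Q0).
Qed.

Lemma wLnorm_scale_le q w (B : set 'rV[R]_n) h (c A : R) : (0 < q)%R ->
  measurable B -> measurable_fun setT w -> (forall x, 0 <= w x)%R ->
  measurable_fun setT h -> (0 <= c)%R -> (0 <= A)%R ->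
  \int[leb]_(x in B) (`|h x| `^ q * w x)%:E <= (A `^ q)%:E * wmeas w B ->
  wLnorm q w B (fun x => (c * h x)%:E) <= (c * A)%:E * wmeas w B `^ q^-1.
Proof.
move=> q0 mB mw w0 mh c0 A0 H.
have qi0 : (0 <= q^-1)%R by rewrite invr_ge0 ltW.
rewrite -[wLnorm _ _ _ _]/(wLnorm q w B (EFin \o (fun x => c * h x)%R)) wLnormE.
have -> : ((c * A)%:E = (((c * A) `^ q)%:E) `^ q^-1).
  by rewrite poweR_EFin -powRrM mulfV ?gt_eqF// powRr1// mulr_ge0.
rewrite -poweRM ?lee_fin ?powR_ge0 ?wmeas_ge0//.
apply: lee_poweR => //.
  by apply: integral_ge0 => x _; rewrite lee_fin mulr_ge0 ?powR_ge0.
under eq_integral do rewrite normrM (ger0_norm c0) powRM// -mulrA.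
rewrite integralZl_fin ?powR_ge0//; last 2 first.
- apply: measurable_funM => //; apply: (measurableT_comp (measurable_powR _)).
  exact: measurableT_comp.
- by move=> x; rewrite mulr_ge0 ?powR_ge0.
by rewrite powRM// EFinM -muleA; apply: lee_wpmul2l => //; rewrite lee_fin powR_ge0.
Qed.

Let measurable_rV_cst (c : R) : measurable_fun setT (cst c : 'rV[R]_n -> R).
Proof. exact: measurable_cst. Qed.

Lemma wLnorm_cst_le q w (B : set 'rV[R]_n) (c : R) : (0 < q)%R ->
  measurable B -> measurable_fun setT w -> (forall x, 0 <= w x)%R ->
  (0 <= c)%R ->
  wLnorm q w B (EFin \o cst c) <= c%:E * wmeas w B `^ q^-1.
Proof.
move=> q0 mB mw w0 c0.
rewrite (_ : EFin \o cst c = fun x => (c * cst 1 x)%:E)%R; last first.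
  by apply/funext => x /=; rewrite mulr1.
rewrite -[X in X%:E * _]mulr1; apply: wLnorm_scale_le => //.
by rewrite powR1 mul1e; under eq_integral do rewrite /= normr1 powR1 mul1r.
Qed.

Section static_bounds.
Variables (p q alpha D C1 : R) (w1 w2 : 'rV[R]_n -> R) (psi2 : 'rV[R]_n -> R -> R).
Variable Omega : 'rV[R]_n -> R.
Hypotheses (p0 : (0 < p)%R) (q0 : (0 < q)%R) (D0 : (0 < D)%R) (C10 : (0 < C1)%R).
Hypothesis alpha_lt : (alpha < n%:R)%R.
Hypotheses (mO : measurable_fun setT Omega).
Hypothesis mw2 : measurable_fun setT w2.
Let W1 := wpow w1 p.
Let u := wpow w2 q.
Let U a t := wmeas u (eball a t).
Let beta : R := (n%:R - alpha)%R.
Hypothesis U_gt0 : forall a t, (0 < t)%R -> 0 < U a t.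
Hypothesis U_fin : forall a t, (0 < t)%R -> U a t < +oo.
Hypothesis U_dbl : forall a t, (0 < t)%R -> U a (2 * t) <= D%:E * U a t.
Hypothesis psi2_gt0 : forall a t, (0 < t)%R -> (0 < psi2 a t)%R.
Hypothesis ball_est : forall a x t f, (0 < t)%R -> (enorm (x - a) <= t)%R ->
  measurable_fun setT f ->
  U a t `^ q^-1 * \int[leb]_(y in eball a t) (`|Omega (x - y)| * `|f y|)%:E <=
  (C1 * t `^ beta)%:E * wLnorm p W1 (eball a t) (EFin \o f).

Local Notation series := (density_series p q w1 w2 psi2).
Let N2 : R := ((D * D) `^ q^-1)%R.
Let cq : R := (2 * 2 `^ q^-1)%R.
Let f1 a r f : 'rV[R]_n -> R := (fun y => f y * \1_(eball a (2 * r)) y)%R.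

Let mu : measurable_fun setT u. Proof. exact: measurable_wpow. Qed.
Let u0 x : (0 <= u x)%R. Proof. exact: wpow_ge0. Qed.
Let cq0 : (0 < cq)%R. Proof. by rewrite mulr_gt0// powR_gt0. Qed.
Let N20 : (0 < N2)%R. Proof. by rewrite powR_gt0// mulr_gt0. Qed.

Let mf1 a r f : measurable_fun setT f -> measurable_fun setT (f1 a r f).
Proof.
by move=> mf; apply: measurable_funM => //; apply: measurable_indic; exact: measurable_eball.
Qed.

Let UE a t : (0 < t)%R -> U a t = (fine (U a t))%:E.
Proof. by move=> t0; rewrite fineK// ge0_fin_numE ?U_fin// ltW ?U_gt0. Qed.

Let near (c : nat -> R) f L a r : (forall k, 1 <= c k)%R ->
  measurable_fun setT f -> series c f L -> (0 < r)%R ->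
  fmem (wLspace p W1) (EFin \o f1 a r f) /\
  fnorm (wLspace p W1) (EFin \o f1 a r f) <= (N2 * L * psi2 a r)%:E * U a r `^ q^-1.
Proof.
move=> c1 mf fL r0; have nb := near_bound p0 q0 D0 U_gt0 U_fin U_dbl a c1 fL r0.
have E : wLnorm p W1 setT (EFin \o f1 a r f) = wLnorm p W1 (eball a (2 * r)) (EFin \o f).
  exact: wLnorm_local.
have fin : wLnorm p W1 (eball a (2 * r)) (EFin \o f) < +oo.
  by apply: (le_lt_trans nb); rewrite -/(U a r) (UE a r0) poweR_EFin -EFinM ltry.
split; last by rewrite [fnorm _ _]E.
split; first by apply/measurable_EFinP; exact: mf1.
by rewrite [X in X < _]E.
Qed.

Lemma morrey_frac_op (c : nat -> R) (K : R) : (forall k, 1 <= c k)%R -> (0 < K)%R ->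
  bounded_by K%:E (wLspace p W1) (wLspace q u) (frac_op Omega alpha) ->
  exists2 C : R, (0 < C)%R & forall f L, measurable_fun setT f -> (0 < L)%R ->
    series c f L ->
    morrey_norm (wLnorm q u) q u psi2 (frac_op Omega alpha f) <= (C * L)%:E.
Proof.
move=> c1 K0 bS.
exists (cq * (K * N2 + 4 `^ beta * C1))%R.
  apply: mulr_gt0 => //; apply: addr_gt0; apply: mulr_gt0 => //; exact: powR_gt0.
move=> f L mf L0 fL; apply: morrey_norm_le => // a r r0.
have mB : measurable (eball a r) by exact: measurable_eball.
have [f1mem f1le] := near a c1 mf fL r0.
have [[mSf1 _] Sf1le] := bS _ f1mem.
have p20 := psi2_gt0 a r0.
pose Lam : R := (4 `^ beta * C1 * L * psi2 a r)%R.
have Lam0 : (0 <= Lam)%R by rewrite !mulr_ge0 ?powR_ge0 ?(ltW C10) ?(ltW L0) ?(ltW p20).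
have pw x : eball a r x ->
    `|frac_op Omega alpha f x| <= `|frac_op Omega alpha (f1 a r f) x| + `|Lam|%:E.
  move=> xa; apply: (le_trans (frac_op_local alpha mO x (measurable_eball a (2 * r)) mf)).
  apply: leeD => //; rewrite ger0_norm//.
  exact: (far_bound C10 alpha_lt mO U_gt0 U_fin ball_est c1 mf fL r0 xa).
apply: (le_trans (wLnorm_addle q0 mB mu u0 mSf1 (measurable_rV_cst Lam) pw)).
apply: (@le_trans _ _ (cq%:E * ((K * (N2 * L * psi2 a r))%:E * U a r `^ q^-1 +
    Lam%:E * U a r `^ q^-1))).
  apply: lee_wpmul2l; first by rewrite lee_fin ltW.
  apply: leeD; last exact: wLnorm_cst_le.
  apply: (le_trans (wLnorm_sub _ q0 u0 (@subsetT _ _))).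
  apply: (le_trans Sf1le); rewrite EFinM -muleA; apply: lee_wpmul2l => //.
  by rewrite lee_fin ltW.
have KL0 : (0 <= K * (N2 * L * psi2 a r))%R by rewrite !mulr_ge0// ltW.
rewrite -ge0_muleDl ?lee_fin//.
rewrite muleA -EFinD -EFinM; apply: lee_wpmul2r; first exact: poweR_ge0.
by rewrite lee_fin le_eqVlt; apply/orP; left; apply/eqP; rewrite /Lam; ring.
Qed.

(** Heights up to 2 Lam, where Lam bounds the far part, cost at most
    2 Lam u(B)^(1/q); above them the near part exceeds half of the height. *)
Lemma weak_morrey_frac_op (c : nat -> R) (K : R) : (forall k, 1 <= c k)%R -> (0 < K)%R ->
  bounded_by K%:E (wLspace p W1) (wWLspace q u) (frac_op Omega alpha) ->
  exists2 C : R, (0 < C)%R & forall f L, measurable_fun setT f -> (0 < L)%R ->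
    series c f L ->
    morrey_norm (wWLnorm q u) q u psi2 (frac_op Omega alpha f) <= (C * L)%:E.
Proof.
move=> c1 K0 bS.
exists (2 * (K * N2 + 4 `^ beta * C1))%R.
  apply: mulr_gt0 => //; apply: addr_gt0; apply: mulr_gt0 => //; exact: powR_gt0.
move=> f L mf L0 fL; apply: morrey_norm_le => // a r r0.
have [f1mem f1le] := near a c1 mf fL r0.
have [[mSf1 _] Sf1le] := bS _ f1mem.
have p20 := psi2_gt0 a r0.
pose Lam : R := (4 `^ beta * C1 * L * psi2 a r)%R.
have Lam0 : (0 < Lam)%R by rewrite !mulr_gt0 ?powR_gt0.
have KL0 : (0 < K * (N2 * L * psi2 a r))%R by rewrite !mulr_gt0.
have pw x : eball a r x ->
    `|frac_op Omega alpha f x| <= `|frac_op Omega alpha (f1 a r f) x| + Lam%:E.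
  move=> xa; apply: (le_trans (frac_op_local alpha mO x (measurable_eball a (2 * r)) mf)).
  apply: leeD => //.
  exact: (far_bound C10 alpha_lt mO U_gt0 U_fin ball_est c1 mf fL r0 xa).
have tot : (2 * (K * N2 + 4 `^ beta * C1) * L * psi2 a r =
    2 * (K * (N2 * L * psi2 a r)) + 2 * Lam)%R by rewrite /Lam; ring.
have Uq0 : 0 <= U a r `^ q^-1 by exact: poweR_ge0.
have qi0 : (0 <= q^-1)%R by rewrite invr_ge0 ltW.
apply: ge_ereal_sup => _ [g /= g0 <-].
rewrite tot; have [gL|gL] := leP g (2 * Lam)%R.
  apply: (@le_trans _ _ ((2 * Lam)%:E * U a r `^ q^-1)).
    apply: lee_pmul; rewrite ?lee_fin ?(ltW g0) ?poweR_ge0//.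
    apply: lee_poweR; [exact: qi0|exact: wmeas_ge0|].
    by apply: le_integral_sub => x; [rewrite lee_fin|case].
  by apply: lee_wpmul2r => //; rewrite lee_fin lerDr mulr_ge0// ltW.
have g20 : (0 < g / 2)%R by rewrite divr_gt0.
apply: (@le_trans _ _ (2%:E * ((g / 2)%:E *
    wmeas u (setT `&` [set x | (g / 2)%:E < `|frac_op Omega alpha (f1 a r f) x|]) `^ q^-1))).
  rewrite [X in X * _ <= _](_ : _ = 2%:E * (g / 2)%:E); last first.
    by rewrite -EFinM; congr (_%:E); field.
  rewrite -[X in X <= _]muleA; apply: lee_wpmul2l; first by rewrite lee_fin.
  apply: lee_wpmul2l; first by rewrite lee_fin ltW.
  apply: lee_poweR; [exact: qi0|exact: wmeas_ge0|].
  apply: le_integral_sub => x; first by rewrite lee_fin.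
  move=> [Bx /= gx]; split => //=; have := lt_le_trans gx (pw x Bx).
  case: `|frac_op _ _ _ x| => [z| |]//; last by move=> _; rewrite ltry.
  rewrite -EFinD !lte_fin => ?; lra.
apply: (@le_trans _ _ (2%:E * ((K * (N2 * L * psi2 a r))%:E * U a r `^ q^-1))).
  apply: lee_wpmul2l => //.
  apply: (@le_trans _ _ (wWLnorm q u setT (frac_op Omega alpha (f1 a r f)))).
    by apply: ereal_sup_ubound; exists (g / 2)%R.
  apply: (le_trans Sf1le); rewrite EFinM -muleA; apply: lee_wpmul2l => //.
  by rewrite lee_fin ltW.
rewrite muleA -EFinM; apply: lee_wpmul2r => //.
by rewrite lee_fin lerDl mulr_ge0// ltW.
Qed.

(** The far part is Lam (|b(x) - favg b a r| + bt), whose norm over the ball is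
    bounded by the mean of order q of the deviation of b for the weight u. *)
Lemma morrey_commutator (C2 C3 K : R) b (bt : R) :
  (0 < C2)%R -> (0 < C3)%R -> (0 < K)%R ->
  (forall a' x' t f', (0 < t)%R -> (enorm (x' - a') <= t)%R -> measurable_fun setT f' ->
    U a' t `^ q^-1 * \int[leb]_(y in eball a' t)
        (`|Omega (x' - y)| * (`|b y - favg b a' t| * `|f' y|))%:E <=
    (C2 * bt * t `^ beta)%:E * wLnorm p W1 (eball a' t) (EFin \o f')) ->
  (forall a r, (0 < r)%R ->
    \int[leb]_(x in eball a r) (`|b x - favg b a r| `^ q * u x)%:E <=
    ((C3 * bt) `^ q)%:E * U a r) ->
  loc_integrable b -> (0 < bt)%R -> bmo_seminorm b <= bt%:E ->
  bounded_by (K * bt)%:E (wLspace p W1) (wLspace q u) (commutator b (frac_op Omega alpha)) ->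
  forall f L, measurable_fun setT f -> (0 < L)%R -> series (fun k => k.+3%:R) f L ->
  morrey_norm (wLnorm q u) q u psi2 (commutator b (frac_op Omega alpha) f) <=
  (cq * (K * N2 + cq * (4 `^ beta * (C1 + C2 + 2 ^+ n * C1)) * (C3 + 1)) * bt * L)%:E.
Proof.
move=> C20 C30 K0 est bmoq lb bt0 bb bS f L mf L0 fL.
have mb := lb.1.
have c1 (k : nat) : (1 <= k.+3%:R :> R)%R by rewrite ler1n.
apply: morrey_norm_le => // a r r0.
have mB : measurable (eball a r) by exact: measurable_eball.
have [f1mem f1le] := near a c1 mf fL r0.
have [[mSf1 _] Sf1le] := bS _ f1mem.
have p20 := psi2_gt0 a r0.
pose Lam : R := (4 `^ beta * (C1 + C2 + 2 ^+ n * C1) * L * psi2 a r)%R.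
have Lam0 : (0 <= Lam)%R.
  by rewrite !mulr_ge0 ?powR_ge0 ?addr_ge0 ?mulr_ge0 ?exprn_ge0 ?(ltW C10) ?(ltW C20) ?(ltW L0) ?(ltW p20).
have LamE : Lam = (4 `^ beta * (C1 + C2 + 2 ^+ n * C1) * L * psi2 a r)%R by [].
clearbody Lam.
pose m := favg b a r.
pose h x : R := (Lam * `|b x - m| + Lam * bt)%R.
have mh1 : measurable_fun setT (fun x => `|b x - m|)%R.
  by apply: measurableT_comp => //; exact: measurable_funB.
have mLh1 : measurable_fun setT (fun x => Lam * `|b x - m|)%R by exact: measurable_funM.
have mh : measurable_fun setT h by exact: measurable_funD.
have pw x : eball a r x ->
    `|commutator b (frac_op Omega alpha) f x| <=
    `|commutator b (frac_op Omega alpha) (f1 a r f) x| + `|h x|%:E.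
  move=> xa.
  have fb := far_bound C10 alpha_lt mO U_gt0 U_fin ball_est c1 mf fL r0 xa.
  apply: (le_trans (commutator_local mO (measurable_eball a (2 * r)) mb mf (le_lt_trans fb (ltry _)))).
  apply: leeD => //.
  apply: (le_trans (far_bound_comm n_gt0 C10 alpha_lt mO U_gt0 U_fin ball_est C20 est lb bt0 bb mf fL r0 xa)).
  rewrite lee_fin; apply: le_trans (ler_norm _).
  by rewrite /h LamE le_eqVlt; apply/orP; left; apply/eqP; rewrite -/m; ring.
apply: (le_trans (wLnorm_addle q0 mB mu u0 mSf1 mh pw)).
have hle : wLnorm q u (eball a r) (EFin \o h) <=
    (cq * (Lam * (C3 * bt) + Lam * bt))%:E * U a r `^ q^-1.
  have pw' x : eball a r x -> `|(EFin \o h) x| <= `|(Lam * `|b x - m|)%:E| + `|cst (Lam * bt) x|%:E.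
    move=> _; rewrite lee_fin; exact: ler_normD.
  have mE : measurable_fun setT (EFin \o (fun x => Lam * `|b x - m|)%R) by exact/measurable_EFinP.
  apply: (le_trans (wLnorm_addle q0 mB mu u0 mE (measurable_rV_cst (Lam * bt)%R) pw')).
  rewrite (EFinM cq) -[leRHS]muleA; apply: lee_wpmul2l; first by rewrite lee_fin ltW.
  rewrite EFinD ge0_muleDl ?lee_fin ?mulr_ge0 ?(ltW C30) ?(ltW bt0)//.
  apply: leeD; last by apply: wLnorm_cst_le => //; rewrite mulr_ge0// ltW.
  apply: wLnorm_scale_le => //; first by rewrite mulr_ge0// ltW.
  by under eq_integral do rewrite normr_id; exact: bmoq.
apply: (@le_trans _ _ (cq%:E * ((K * bt * (N2 * L * psi2 a r))%:E * U a r `^ q^-1 +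
    (cq * (Lam * (C3 * bt) + Lam * bt))%:E * U a r `^ q^-1))).
  apply: lee_wpmul2l; first by rewrite lee_fin ltW.
  apply: leeD => //.
  apply: (le_trans (wLnorm_sub _ q0 u0 (@subsetT _ _))).
  apply: (le_trans Sf1le); rewrite (EFinM (K * bt)%R) -[leRHS]muleA; apply: lee_wpmul2l => //.
  by rewrite lee_fin mulr_ge0// ltW.
rewrite -ge0_muleDl ?lee_fin ?mulr_ge0 ?addr_ge0 ?mulr_ge0 ?(ltW K0) ?(ltW N20) ?(ltW L0) ?(ltW p20) ?(ltW bt0) ?(ltW C30) ?(ltW cq0)//.
rewrite muleA -EFinD -EFinM; apply: lee_wpmul2r; first exact: poweR_ge0.
by rewrite lee_fin le_eqVlt; apply/orP; left; apply/eqP; rewrite LamE; ring.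
Qed.

End static_bounds.

End morrey_bounds.

(** * The weights of the theorem *)

Section weights_of_the_theorem.
Context {R : realType} {n : nat}.
Hypothesis n_gt0 : (0 < n)%N.
Local Open Scope ereal_scope.
Local Notation leb := (@lebesgue_rV R n).
Implicit Types (a x : 'rV[R]_n) (r t p q s sigma C : R) (f b w u v : 'rV[R]_n -> R).

Lemma wpow1 w : (forall x, 0 <= w x)%R -> wpow w 1 = w.
Proof. by move=> w0; apply/funext => x; rewrite /wpow powRr1. Qed.

Lemma wpow_gt0_ae w p : {ae leb, forall x, (0 < w x)%R} ->
  {ae leb, forall x, (0 < wpow w p x)%R}.
Proof. by apply: filterS => x x0; rewrite powR_gt0. Qed.

(** The condition A_{p/s,q/s} for the powers w1^s and w2^s, in terms of the
    weights w2^q and w1^(-sigma): the dual exponent of p / s is sigma / s. *)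
Lemma Apq_pair p q s sigma w1 w2 : (0 < s)%R -> (s < p)%R -> (0 < q)%R ->
  sigma = (s * p / (p - s))%R ->
  Apq (p / s) (q / s) (wpow w1 s) (wpow w2 s) ->
  exists2 C : R, (0 < C)%R & forall a r, (0 < r)%R ->
    avg a r (EFin \o wpow w2 q) `^ (s / q) *
    avg a r (EFin \o wpow w1 (- sigma)) `^ (s / sigma) <= C%:E.
Proof.
move=> s0 sp q0 sigmaE [C C0 HC]; exists C => // a r r0.
have p0 : (0 < p)%R by exact: lt_trans sp.
have ps : (p - s != 0)%R by rewrite subr_eq0 gt_eqF.
have s_neq0 : (s != 0)%R by rewrite gt_eqF.
have p_neq0 : (p != 0)%R by rewrite gt_eqF.
have := HC a r r0; rewrite /= ifF; last first.
  by apply/negbTE; rewrite -subr_eq0 (_ : _ - 1 = (p - s) / s)%R ?mulf_neq0 ?invr_eq0//; field.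
have -> : (p / s / (p / s - 1) = p / (p - s))%R.
  by field; rewrite ps s_neq0.
rewrite !wpow_wpow invf_div (mulrC s (q / s)%R) divfK// invf_div.
rewrite (_ : s * - (p / (p - s)) = - sigma)%R; last by rewrite sigmaE; ring.
rewrite (_ : (p - s) / p = s / sigma)%R//.
by rewrite sigmaE; field; rewrite ps s_neq0 p_neq0.
Qed.

Lemma pair_ball_le q s sigma alpha C u v : (0 < s)%R -> (0 < q)%R -> (0 < sigma)%R ->
  (0 < C)%R -> (q^-1 + sigma^-1 = s^-1 - alpha / n%:R)%R ->
  (forall x, 0 <= u x)%R -> (forall x, 0 <= v x)%R ->
  (forall a r, (0 < r)%R ->
    avg a r (EFin \o u) `^ (s / q) * avg a r (EFin \o v) `^ (s / sigma) <= C%:E) ->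
  exists2 C0 : R, (0 < C0)%R & forall a t, (0 < t)%R ->
    wmeas u (eball a t) `^ q^-1 * wmeas v (eball a t) `^ sigma^-1 <=
    (C0 * t `^ (n%:R / s - alpha))%:E.
Proof.
move=> s0 q0 sigma0 C0 expo u0 v0 HC.
have vol0 : (0 < ball_volume R n)%R by exact: ball_volume_gt0.
exists (C `^ s^-1 * ball_volume R n `^ (q^-1 + sigma^-1))%R.
  by rewrite mulr_gt0 ?powR_gt0.
move=> a t t0; have H := avg_pair_le n_gt0 t0 u0 v0 (HC a t t0).
have si0 : (0 <= s^-1)%R by rewrite invr_ge0 ltW.
have := lee_poweR si0 (mule_ge0 (poweR_ge0 _ _) (poweR_ge0 _ _)) H.
rewrite poweRM ?poweR_ge0// -!poweRrM !(mulrC s) !mulfK ?gt_eqF// => /le_trans; apply.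
rewrite poweR_EFin lee_fin powRM ?powR_ge0 ?(ltW C0)// -powRrM.
rewrite -mulrDl mulfK ?gt_eqF// powRM ?exprn_ge0 ?(ltW t0) ?(ltW vol0)//.
rewrite -powR_mulrn ?(ltW t0)// -powRrM.
rewrite (_ : n%:R * (q^-1 + sigma^-1) = n%:R / s - alpha)%R; last first.
  by rewrite expo; field; rewrite !gt_eqF ?ltr0n.
by rewrite le_eqVlt; apply/orP; left; apply/eqP; ring.
Qed.

(** The lower bound required by [fair_pair]; it is an equality where w is
    positive. *)
Lemma pair_one_le w q sigma s : (0 < s)%R -> (0 < q)%R -> (0 < sigma)%R ->
  {ae leb, forall x, (0 < w x)%R} ->
  {ae leb, forall x, (1 <= wpow w q x `^ (s / q) * wpow w (- sigma) x `^ (s / sigma))%R}.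
Proof.
move=> s0 q0 sigma0; apply: filterS => x x0; rewrite /wpow -!powRrM mulNr.
rewrite (mulrC q) (mulrC sigma) !divfK ?gt_eqF// -powRD; last by rewrite (gt_eqF x0) implybT.
by rewrite subrr powRr0.
Qed.

End weights_of_the_theorem.

(** * Boundedness on Morrey spaces *)

Section strong_case.
Context {R : realType} {n : nat}.
Local Open Scope ereal_scope.
Local Notation leb := (@lebesgue_rV R n).
Variables (alpha p q s : R) (w1 w2 : 'rV[R]_n -> R) (psi1 psi2 : 'rV[R]_n -> R -> R).
Variable Omega : 'rV[R]_n -> R.
Hypotheses (n_gt0 : (0 < n)%N) (alpha_lt : (alpha < n%:R)%R).
Hypotheses (s1 : (1 <= s)%R) (sp : (s < p)%R) (q0 : (0 < q)%R).
Hypothesis q_def : (q^-1 = p^-1 - alpha / n%:R)%R.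
Hypotheses (mw1 : measurable_fun setT w1) (mw2 : measurable_fun setT w2).
Hypotheses (w1pos : {ae leb, forall x, (0 < w1 x)%R}).
Hypotheses (w2pos : {ae leb, forall x, (0 < w2 x)%R}).
Hypothesis w12_Apq : Apq (p / s) (q / s) (wpow w1 s) (wpow w2 s).
Hypothesis w2_Apq : Apq (p / s) (q / s) (wpow w2 s) (wpow w2 s).
Hypothesis Omega_Lfun : Omega \in Lfun sphere_measure (hoelder_conjugate s%:E).
Hypothesis Omega_hom : homogeneous0 Omega.
Hypothesis psi1_gt0 : forall (a : 'rV[R]_n) (t : R), (0 < t)%R -> (0 < psi1 a t)%R.
Hypothesis psi2_gt0 : forall (a : 'rV[R]_n) (t : R), (0 < t)%R -> (0 < psi2 a t)%R.

Let mO : measurable_fun setT Omega.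
Proof. by move: Omega_Lfun; rewrite inE => /andP[/[!inE]]. Qed.

Let s0 : (0 < s)%R. Proof. exact: lt_le_trans s1. Qed.
Let p0 : (0 < p)%R. Proof. exact: lt_trans sp. Qed.
Let sigma : R := (s * p / (p - s))%R.
Let sigma0 : (0 < sigma)%R.
Proof. by rewrite divr_gt0 ?mulr_gt0// subr_gt0. Qed.
Let k0 : (0 < s / q)%R. Proof. by rewrite divr_gt0. Qed.
Let m0 : (0 < s / sigma)%R. Proof. by rewrite divr_gt0. Qed.
Let expo : (q^-1 + sigma^-1 = s^-1 - alpha / n%:R)%R.
Proof.
rewrite q_def /sigma invf_div.
have -> : ((p - s) / (s * p) = s^-1 - p^-1)%R by field; rewrite !gt_eqF.
by rewrite addrC addrA subrK.
Qed.
Let u := wpow w2 q.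
Let v := wpow w2 (- sigma).
Let mu : measurable_fun setT u := measurable_wpow q mw2.
Let mv : measurable_fun setT v := measurable_wpow (- sigma) mw2.
Let u0 x : (0 <= u x)%R := wpow_ge0 w2 q x.
Let v0 x : (0 <= v x)%R := wpow_ge0 w2 (- sigma) x.
Let upos : {ae leb, forall x, (0 < u x)%R} := wpow_gt0_ae q w2pos.
Let vpos : {ae leb, forall x, (0 < v x)%R} := wpow_gt0_ae (- sigma) w2pos.

Let U_gt0 (a : 'rV[R]_n) (t : R) : (0 < t)%R -> 0 < wmeas u (eball a t).
Proof. exact: wmeas_gt0. Qed.

Let U_fin (a : 'rV[R]_n) (t : R) : (0 < t)%R -> wmeas u (eball a t) < +oo.
Proof.
have [C C0 HC] := Apq_pair s0 sp q0 erefl w2_Apq.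
exact: (pair_wmeas_fin n_gt0 k0 mv u0 v0 vpos HC).
Qed.

Let V_fin (a : 'rV[R]_n) (t : R) : (0 < t)%R -> wmeas v (eball a t) < +oo.
Proof.
have [C C0 HC] := Apq_pair s0 sp q0 erefl w2_Apq.
exact: (pair_wmeas_fin2 n_gt0 m0 mu u0 v0 upos HC).
Qed.

Let u_fair : fair_weight u.
Proof.
have [C C0 HC] := Apq_pair s0 sp q0 erefl w2_Apq.
exact: (fair_pair n_gt0 k0 m0 C0 mu mv u0 v0 upos vpos HC (pair_one_le s0 q0 sigma0 w2pos)).
Qed.

Let v_fair : fair_weight v.
Proof.
have [C C0 HC] := Apq_pair s0 sp q0 erefl w2_Apq.
have HC' a r : (0 < r)%R ->
    avg a r (EFin \o v) `^ (s / sigma) * avg a r (EFin \o u) `^ (s / q) <= C%:E.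
  by move=> r0; rewrite muleC; exact: HC.
apply: (fair_pair n_gt0 m0 k0 C0 mv mu v0 u0 vpos upos HC').
by apply: filterS (pair_one_le s0 q0 sigma0 w2pos) => x; rewrite (mulrC (wpow w2 q x `^ _)%R).
Qed.

Let doubling : exists2 D : R, (0 < D)%R & forall (a : 'rV[R]_n) (t : R), (0 < t)%R ->
  wmeas u (eball a (2 * t)) <= D%:E * wmeas u (eball a t).
Proof.
have [D D0 HD] := fair_doubling n_gt0 u_fair 2.
exists D => // a t t0; apply: HD => //; first by rewrite mulr_gt0.
by apply: eball_subr; rewrite ler_peMl ?ler1n// ltW.
Qed.

Let kernel_est : exists2 C : R, (0 < C)%R &
  forall (a x : 'rV[R]_n) (t : R) (h f : 'rV[R]_n -> R) (A : R), (0 < t)%R ->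
    (enorm (x - a) <= t)%R -> measurable_fun setT h -> measurable_fun setT f ->
    (forall y, 0 <= h y)%R -> (0 <= A)%R ->
    \int[leb]_(y in eball a t) (h y `^ sigma * v y)%:E <=
      (A `^ sigma)%:E * wmeas v (eball a t) ->
    wmeas u (eball a t) `^ q^-1 *
      \int[leb]_(y in eball a t) (`|Omega (x - y)| * (h y * `|f y|))%:E <=
    (C * A * t `^ (n%:R - alpha))%:E *
      wLnorm p (wpow w1 p) (eball a t) (EFin \o f).
Proof.
have [C C0 HC] := Apq_pair s0 sp q0 erefl w2_Apq.
have [C' C'0 HC'] := Apq_pair s0 sp q0 erefl w12_Apq.
have qk : (q * (s / q) = s)%R by rewrite mulrC divfK// gt_eqF.
have sm : (sigma * (s / sigma) = s)%R by rewrite mulrC divfK// gt_eqF.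
have [M M0 w21] := ae_le_of_pair n_gt0 k0 m0 q0 sigma0 s0 C'0 qk sm mw1 mw2 w1pos HC'.
have [C1 C10 H1] := pair_ball_le n_gt0 s0 q0 sigma0 C0 expo u0 v0 HC.
exact: (kernel_ball_estimate n_gt0 s1 Omega_hom Omega_Lfun sp erefl mw1 mw2 w2pos C10 M0 w21 H1).
Qed.

Let ball_est : exists2 C : R, (0 < C)%R &
  forall (a x : 'rV[R]_n) (t : R) (f : 'rV[R]_n -> R), (0 < t)%R ->
    (enorm (x - a) <= t)%R -> measurable_fun setT f ->
    wmeas u (eball a t) `^ q^-1 *
      \int[leb]_(y in eball a t) (`|Omega (x - y)| * `|f y|)%:E <=
    (C * t `^ (n%:R - alpha))%:E *
      wLnorm p (wpow w1 p) (eball a t) (EFin \o f).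
Proof.
have [C C0 HC] := kernel_est; exists C => // a x t f t0 xa mf.
have -> : \int[leb]_(y in eball a t) (`|Omega (x - y)| * `|f y|)%:E =
    \int[leb]_(y in eball a t) (`|Omega (x - y)| * (cst 1 y * `|f y|))%:E.
  by apply: eq_integral => y _; rewrite /= mul1r.
rewrite -[C]mulr1; apply: HC => //.
rewrite powR1 mul1e.
by under eq_integral do rewrite /= mul1r.
Qed.

Lemma morrey_bounded_frac_op :
  psi_condition (fun _ _ => 1)%R p q w1 w2 psi1 psi2 ->
  bounded_op (wLspace p (wpow w1 p)) (wLspace q (wpow w2 q)) (frac_op Omega alpha) ->
  exists2 C : R, (0 < C)%R & forall f (M : R), measurable_fun setT f -> (0 < M)%R ->
    fnorm (Morrey p (wpow w1 p) psi1) (EFin \o f) <= M%:E ->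
    fnorm (Morrey q (wpow w2 q) psi2) (frac_op Omega alpha f) <= (C * M)%:E.
Proof.
move=> psiC [K K0 bS].
have [D D0 dbl] := doubling; have [C1 C10 est] := ball_est.
have [C2 C20 ser] := psi_series n_gt0 p0 q0 D0 mw1 w1pos U_gt0 U_fin dbl psi1_gt0 psi2_gt0
  (fun k : nat => ler01) (fun _ _ _ _ => ler01) (fun _ _ _ _ _ => lexx 1%R) psiC.
have [C3 C30 H3] := morrey_frac_op p0 q0 D0 C10 alpha_lt mO mw2 U_gt0 U_fin dbl
  psi2_gt0 est (fun k : nat => lexx 1%R) K0 bS.
exists (C3 * C2)%R => [|f M mf M0 fM]; first by rewrite mulr_gt0.
rewrite -mulrA; apply: H3 => //; first by rewrite mulr_gt0.
by move=> a r r0; exact: ser.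
Qed.

Lemma morrey_bounded_commutator b :
  psi_condition (fun r t => 1 + ln (t / r))%R p q w1 w2 psi1 psi2 ->
  loc_integrable b ->
  exists2 C : R, (0 < C)%R & forall (K bt : R), (0 < K)%R -> (0 < bt)%R ->
    bmo_seminorm b <= bt%:E ->
    bounded_by (K * bt)%:E (wLspace p (wpow w1 p)) (wLspace q (wpow w2 q))
      (commutator b (frac_op Omega alpha)) ->
    forall f (M : R), measurable_fun setT f -> (0 < M)%R ->
    fnorm (Morrey p (wpow w1 p) psi1) (EFin \o f) <= M%:E ->
    fnorm (Morrey q (wpow w2 q) psi2) (commutator b (frac_op Omega alpha) f) <=
      (C * (K + 1) * bt * M)%:E.
Proof.
move=> psiC lb.
have [D D0 dbl] := doubling; have [C1 C10 est] := ball_est.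
have [C2 C20 kest] := kernel_est.
have [Cv Cv0 Hv] := weighted_bmo n_gt0 mv v0 V_fin v_fair sigma0.
have [Cu Cu0 Hu] := weighted_bmo n_gt0 mu u0 U_fin u_fair q0.
(* 1 + ln (t / r) >= 1 + (k + 2) ln 2 >= c0 (k + 3) for t >= 2^(k+2) r. *)
pose c0 : R := Num.min 1%R (ln 2).
have ln2 : (0 < ln 2 :> R)%R by rewrite ln_gt0// ltr1n.
have c00 : (0 < c0)%R by rewrite lt_min ltr01.
have ln_le (k : nat) (r t : R) : (0 < r)%R -> (2 ^+ k.+2 * r <= t)%R ->
    (c0 * k.+3%:R <= 1 + ln (t / r))%R.
  move=> r0 rt; have : (ln (2 ^+ k.+2) <= ln (t / r))%R.
    by rewrite ler_ln ?posrE ?exprn_gt0// ?ler_pdivlMr// divr_gt0// (lt_le_trans _ rt)// mulr_gt0// exprn_gt0.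
  rewrite lnXn// => h; rewrite -natr1 mulrDr mulr1 addrC; apply: lerD.
    by rewrite ge_min lexx.
  apply: le_trans h; rewrite -(mulr_natr (ln 2)); apply: ler_wpM2r => //.
  by rewrite ge_min lexx orbT.
have kap0 (r t : R) : (0 < r)%R -> (r < t)%R -> (0 <= 1 + ln (t / r))%R.
  by move=> r0 rt; rewrite addr_ge0// ln_ge0// ler_pdivlMr// mul1r ltW.
have cge0 (k : nat) : (0 <= c0 * k.+3%:R)%R by rewrite mulr_ge0// ltW.
have [C4 C40 ser] := psi_series n_gt0 p0 q0 D0 mw1 w1pos U_gt0 U_fin dbl
  psi1_gt0 psi2_gt0 cge0 kap0 ln_le psiC.
pose C2v : R := (C2 * Cv `^ sigma^-1)%R.
pose C3 : R := (Cu `^ q^-1)%R.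
have C2v0 : (0 < C2v)%R by rewrite mulr_gt0 ?powR_gt0.
have C30 : (0 < C3)%R by rewrite powR_gt0.
pose G : R := (2 * 2 `^ q^-1 * (4 `^ (n%:R - alpha) * (C1 + C2v + 2 ^+ n * C1)) * (C3 + 1))%R.
have G0 : (0 < G)%R.
  rewrite /G; apply: mulr_gt0; last by rewrite addr_gt0.
  apply: mulr_gt0; first by rewrite mulr_gt0// powR_gt0.
  by apply: mulr_gt0; rewrite ?powR_gt0// !addr_gt0// mulr_gt0// exprn_gt0.
pose N2 : R := ((D * D) `^ q^-1)%R.
have N20 : (0 < N2)%R by rewrite powR_gt0// mulr_gt0.
have cq0 : (0 < 2 * 2 `^ q^-1 :> R)%R by rewrite mulr_gt0 ?powR_gt0.
exists (2 * 2 `^ q^-1 * (N2 + G) * (C4 / c0))%R.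
  by apply: mulr_gt0; [apply: mulr_gt0 => //; exact: addr_gt0|exact: divr_gt0].
move=> K bt K0 bt0 bb bC f M mf M0 fM.
have mdev (a : 'rV[R]_n) t : measurable_fun setT (fun y => `|b y - favg b a t|)%R.
  by apply: measurableT_comp => //; apply: measurable_funB => //; exact: lb.1.
have cestv (a x : 'rV[R]_n) (t : R) (f' : 'rV[R]_n -> R) : (0 < t)%R ->
    (enorm (x - a) <= t)%R -> measurable_fun setT f' ->
    wmeas u (eball a t) `^ q^-1 * \int[leb]_(y in eball a t)
        (`|Omega (x - y)| * (`|b y - favg b a t| * `|f' y|))%:E <=
    (C2v * bt * t `^ (n%:R - alpha))%:E * wLnorm p (wpow w1 p) (eball a t) (EFin \o f').
  move=> t0 xa mf'; rewrite /C2v -(mulrA C2).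
  apply: kest => //; first by rewrite mulr_ge0 ?powR_ge0// ltW.
  rewrite powRM ?powR_ge0 ?(ltW bt0)// -powRrM mulVf ?gt_eqF// powRr1 ?(ltW Cv0)//.
  exact: Hv.
have cestu (a : 'rV[R]_n) (r : R) : (0 < r)%R ->
    \int[leb]_(x in eball a r) (`|b x - favg b a r| `^ q * u x)%:E <=
    ((C3 * bt) `^ q)%:E * wmeas u (eball a r).
  move=> r0; rewrite powRM ?powR_ge0 ?(ltW bt0)// -powRrM mulVf ?gt_eqF// powRr1 ?(ltW Cu0)//.
  exact: Hu.
have L0 : (0 < C4 / c0 * M)%R by rewrite mulr_gt0// divr_gt0.
have fL : density_series p q w1 w2 psi2 (fun k => k.+3%:R)%R f (C4 / c0 * M).
  move=> a r r0; have := ser f M M0 fM a r r0.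
  under eq_eseriesr do rewrite EFinM -muleA.
  rewrite nneseriesZl; last by move=> k _; rewrite mule_ge0 ?ball_density_ge0// lee_fin.
  rewrite muleC -lee_pdivlMr// => /le_trans; apply.
  by rewrite -EFinM lee_fin le_eqVlt; apply/orP; left; apply/eqP; ring.
have := morrey_commutator n_gt0 p0 q0 D0 C10 alpha_lt mO mw2 U_gt0 U_fin dbl psi2_gt0 est
  C2v0 C30 K0 cestv cestu lb bt0 bb bC mf L0 fL.
move/le_trans; apply; rewrite lee_fin -/N2 -/G.
rewrite -subr_ge0 [X in (0 <= X)%R](_ : _ =
  2 * 2 `^ q^-1 * (N2 + K * G) * bt * (C4 / c0 * M))%R; last by ring.
apply: mulr_ge0 (ltW L0); apply: mulr_ge0 (ltW bt0); apply: mulr_ge0; first exact: ltW.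
by apply: addr_ge0; [exact: ltW|apply: mulr_ge0; exact: ltW].
Qed.

End strong_case.

Section weak_case.
Context {R : realType} {n : nat}.
Local Open Scope ereal_scope.
Local Notation leb := (@lebesgue_rV R n).

(** For p = 1 the weights w2^q and w2^(-1) play the role of w2^q and
    w2^(-sigma), the essential supremum of w2^(-1) dominating its average. *)
Lemma weak_morrey_bounded_frac_op (alpha q : R) (w1 w2 : 'rV[R]_n -> R)
    (psi1 psi2 : 'rV[R]_n -> R -> R) (Omega : 'rV[R]_n -> R) :
  (0 < n)%N -> (alpha < n%:R)%R -> (0 < q)%R -> (q^-1 = 1 - alpha / n%:R)%R ->
  weight w1 -> weight w2 ->
  Apq 1 q w1 w2 -> Apq 1 q w2 w2 ->
  Omega \in Lfun sphere_measure (hoelder_conjugate 1%:E) -> homogeneous0 Omega ->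
  (forall a t, 0 < t -> 0 < psi1 a t)%R -> (forall a t, 0 < t -> 0 < psi2 a t)%R ->
  psi_condition (fun _ _ => 1)%R 1 q w1 w2 psi1 psi2 ->
  bounded_op (wLspace 1 w1) (wWLspace q (wpow w2 q)) (frac_op Omega alpha) ->
  exists2 C : R, (0 < C)%R & forall (f : 'rV[R]_n -> R) (M : R),
    measurable_fun setT f -> (0 < M)%R ->
    fnorm (Morrey 1 w1 psi1) (EFin \o f) <= M%:E ->
    fnorm (WMorrey q (wpow w2 q) psi2) (frac_op Omega alpha f) <= (C * M)%:E.
Proof.
move=> n_gt0 alpha_lt q0 q_def [w10 w1pos [mw1 _]] [w20 w2pos [mw2 _]].
move=> [C C0 HC] [C' C'0 HC'] LO hom psi10 psi20 psiC [K K0 bS].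
have mO : measurable_fun setT Omega by move: LO; rewrite inE => /andP[/[!inE]].
have w1E : wpow w1 1 = w1 by exact: wpow1.
pose u := wpow w2 q; pose v := wpow w2 (-1).
have mu : measurable_fun setT u by exact: measurable_wpow.
have mv : measurable_fun setT v by exact: measurable_wpow.
have u0 x : (0 <= u x)%R by exact: wpow_ge0.
have v0 x : (0 <= v x)%R by exact: wpow_ge0.
have upos : {ae leb, forall x, (0 < u x)%R} by exact: wpow_gt0_ae.
have vpos : {ae leb, forall x, (0 < v x)%R} by exact: wpow_gt0_ae.
have k0 : (0 < 1 / q)%R by rewrite divr_gt0.
have m0 : (0 < 1 / 1 :> R)%R by rewrite divr_gt0.
have pairC a r : (0 < r)%R -> avg a r (EFin \o u) `^ (1 / q) *
    avg a r (EFin \o v) `^ (1 / 1) <= C'%:E.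
  move=> r0; have := HC' a r r0; rewrite /= eqxx; apply: le_trans.
  have e1 : (1 / q = q^-1)%R by exact: mul1r.
  have e2 : (1 / 1 = 1 :> R)%R by exact: divr1.
  rewrite e1 e2; apply: lee_wpmul2l; first exact: poweR_ge0.
  rewrite poweRe1; first exact: avg_inv_le.
  by rewrite /avg mule_ge0 ?wmeas_ge0// inve_ge0 measure_ge0.
have U_gt0 a t : (0 < t)%R -> 0 < wmeas u (eball a t) by exact: wmeas_gt0.
have U_fin a t : (0 < t)%R -> wmeas u (eball a t) < +oo.
  exact: (pair_wmeas_fin n_gt0 k0 mv u0 v0 vpos pairC).
have u_fair : fair_weight u.
  exact: (fair_pair n_gt0 k0 m0 C'0 mu mv u0 v0 upos vpos pairC (pair_one_le ltr01 q0 ltr01 w2pos)).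
have [D D0 HD] := fair_doubling n_gt0 u_fair 2.
have dbl a t : (0 < t)%R -> wmeas u (eball a (2 * t)) <= D%:E * wmeas u (eball a t).
  move=> t0; apply: HD => //; first by rewrite mulr_gt0.
  by apply: eball_subr; rewrite ler_peMl ?ler1n// ltW.
have [C1 C10 est] : exists2 C1 : R, (0 < C1)%R &
    forall (a x : 'rV[R]_n) (t : R) (f : 'rV[R]_n -> R), (0 < t)%R ->
    (enorm (x - a) <= t)%R -> measurable_fun setT f ->
    wmeas u (eball a t) `^ q^-1 *
      \int[leb]_(y in eball a t) (`|Omega (x - y)| * `|f y|)%:E <=
    (C1 * t `^ (n%:R - alpha))%:E * wLnorm 1 (wpow w1 1) (eball a t) (EFin \o f).
  rewrite w1E.
  have vol0 : (0 < ball_volume R n)%R by exact: ball_volume_gt0.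
  have Cv0 : (0 < C * ball_volume R n `^ q^-1)%R by rewrite mulr_gt0 ?powR_gt0.
  apply: (kernel_ball_estimate1 n_gt0 (lexx 1%R) hom LO erefl q0 mw1 w10 w1pos Cv0 mu u0 upos) => a t t0.
  have := HC a t t0; rewrite /= eqxx avgE//.
  have V0 : (0 < t ^+ n * ball_volume R n)%R by rewrite mulr_gt0 ?exprn_gt0.
  rewrite poweRM ?wmeas_ge0 ?lee_fin ?invr_ge0 ?(ltW V0)//.
  rewrite poweR_EFin powRVl ?(ltW V0)// -muleA lee_pdivrMl ?powR_gt0// -EFinM => /le_trans; apply.
  rewrite lee_fin powRM ?exprn_ge0 ?(ltW t0) ?(ltW vol0)//.
  rewrite -powR_mulrn ?(ltW t0)// -powRrM.
  rewrite (_ : n%:R * q^-1 = n%:R - alpha)%R; last first.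
    by rewrite q_def; field; rewrite gt_eqF ?ltr0n.
  by rewrite le_eqVlt; apply/orP; left; apply/eqP; ring.
have [C2 C20 ser] := psi_series n_gt0 ltr01 q0 D0 mw1 w1pos U_gt0 U_fin dbl psi10 psi20
  (fun k : nat => ler01) (fun _ _ _ _ => ler01) (fun _ _ _ _ _ => lexx 1%R) psiC.
rewrite -w1E in bS.
have [C3 C30 H3] := weak_morrey_frac_op ltr01 q0 D0 C10 alpha_lt mO U_gt0 U_fin dbl
  psi20 est (fun k : nat => lexx 1%R) K0 bS.
exists (C3 * C2)%R => [|f M mf M0 fM]; first by rewrite mulr_gt0.
rewrite -mulrA; apply: H3 => //; first by rewrite mulr_gt0.
by move=> a r r0; apply: ser => //; rewrite w1E.
Qed.

End weak_case.

(** * Nonnegativity of the norms, and the theorem *)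

Section norms_ge0.
Context {R : realType} {n : nat}.
Local Open Scope ereal_scope.

Lemma morrey_norm_ge0 (N : set 'rV[R]_n -> ('rV[R]_n -> \bar R) -> \bar R)
    p w psi (f : 'rV[R]_n -> \bar R) :
  (forall a r, 0 < r -> 0 < psi a r)%R -> (forall E g, 0 <= N E g) ->
  0 <= morrey_norm N p w psi f.
Proof.
move=> psi0 N0; apply: (@le_trans _ _ (((psi 0%R 1%R)^-1)%:E *
  ((wmeas w (eball 0%R 1%R)) `^ p^-1)^-1 * N (eball 0%R 1%R) f)).
  apply: mule_ge0 => //; apply: mule_ge0; last by rewrite inve_ge0 poweR_ge0.
  by rewrite lee_fin invr_ge0 ltW// psi0.
by apply: ereal_sup_ubound; exists (0%R, 1%R) => //=.
Qed.

Lemma wWLnorm_ge0 p w (E : set 'rV[R]_n) (f : 'rV[R]_n -> \bar R) : 0 <= wWLnorm p w E f.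
Proof.
apply: (@le_trans _ _ (1%:E * (wmeas w (E `&` [set x | 1%:E < `|f x|])) `^ p^-1)).
  by apply: mule_ge0 => //; exact: poweR_ge0.
by apply: ereal_sup_ubound; exists 1%R => //=.
Qed.

Lemma bmo_seminorm_ge0 (b : 'rV[R]_n -> R) : 0 <= bmo_seminorm b.
Proof.
apply: (@le_trans _ _ (avg 0%R 1%R
   (fun x => (`|b x - fine (avg 0%R 1%R (EFin \o b))|%R)%:E))).
  rewrite /avg; apply: mule_ge0; first by rewrite inve_ge0 measure_ge0.
  by apply: integral_ge0 => x _; rewrite lee_fin.
by apply: ereal_sup_ubound; exists (0%R, 1%R) => //=.
Qed.

End norms_ge0.

Theorem theorem5p9 (R : realType) (n : nat) (alpha p q s p0 T : R)
    (w1 w2 w : 'rV[R]_n -> R) (psi psi1 psi2 : 'rV[R]_n -> R -> R)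
    (Omega : 'rV[R]_n -> R)
    (n_ge2 : (2 <= n)%N)
    (alpha_gt0 : 0 < alpha) (alpha_ltn : alpha < n%:R)
    (p_ge1 : 1 <= p) (p_lt : p < n%:R / alpha)
    (q_def : q^-1 = p^-1 - alpha / n%:R)
    (s_range : (1 < p -> 1 <= s < p) /\ (p = 1 -> s = 1))
    (w1_weight : weight w1) (w2_weight : weight w2)
    (w12_Apq : Apq (p / s) (q / s) (wpow w1 s) (wpow w2 s))
    (w2_Apq : Apq (p / s) (q / s) (wpow w2 s) (wpow w2 s))
    (p0_gt1 : 1 < p0) (T_gt0 : 0 < T)
    (psi_gt0 : forall (a : 'rV[R]_n) (r : R), 0 < r -> 0 < psi a r)
    (w_weight : weight w)
    (Omega_Lfun : Omega \in Lfun sphere_measure (hoelder_conjugate s%:E))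
    (Omega_hom : homogeneous0 Omega)
    (psi1_gt0 : forall (a : 'rV[R]_n) (r : R), 0 < r -> 0 < psi1 a r)
    (psi2_gt0 : forall (a : 'rV[R]_n) (r : R), 0 < r -> 0 < psi2 a r) :
  (psi_condition (fun _ _ => 1) p q w1 w2 psi1 psi2 ->
     (1 < p ->
      bounded_op (wLspace p (wpow w1 p)) (wLspace q (wpow w2 q))
        (frac_op Omega alpha) ->
      bounded_op
        (TimeMorrey p0 w psi T (Morrey p (wpow w1 p) psi1))
        (TimeMorrey p0 w psi T (Morrey q (wpow w2 q) psi2))
        (in_time (frac_op Omega alpha))) /\
     (p = 1 ->
      bounded_op (wLspace 1 w1) (wWLspace q (wpow w2 q))
        (frac_op Omega alpha) ->
      bounded_op
        (TimeMorrey p0 w psi T (Morrey 1 w1 psi1))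
        (TimeMorrey p0 w psi T (WMorrey q (wpow w2 q) psi2))
        (in_time (frac_op Omega alpha)))) /\
  (1 < p -> muckenhoupt_infty w1 ->
   psi_condition (fun r t => 1 + ln (t / r)) p q w1 w2 psi1 psi2 ->
   forall b : 'rV[R]_n -> R, BMO b ->
   bounded_comm b (wLspace p (wpow w1 p)) (wLspace q (wpow w2 q))
     (commutator b (frac_op Omega alpha)) ->
   bounded_comm b
     (TimeMorrey p0 w psi T (Morrey p (wpow w1 p) psi1))
     (TimeMorrey p0 w psi T (Morrey q (wpow w2 q) psi2))
     (in_time (commutator b (frac_op Omega alpha)))).
Proof.
have n_gt0 : (0 < n)%N by exact: leq_trans n_ge2.
have nR0 : 0 < n%:R :> R by rewrite ltr0n.
have p_gt0 : 0 < p by exact: lt_le_trans p_ge1.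
have q_gt0 : 0 < q.
  rewrite -invr_gt0 q_def subr_gt0 ltr_pdivrMr// mulrC ltr_pdivlMr// mulrC.
  by rewrite -ltr_pdivlMr.
have p0_gt0 : 0 < p0 by exact: lt_trans p0_gt1.
have mO : measurable_fun setT Omega by move: Omega_Lfun; rewrite inE => /andP[/[!inE]].
have [w1_ge0 w1pos [mw1 _]] := w1_weight.
have [w2_ge0 w2pos [mw2 _]] := w2_weight.
have X0 g : (0 <= fnorm (Morrey p (wpow w1 p) psi1) g)%E.
  by apply: morrey_norm_ge0 => // E h; exact: wLnorm_ge0.
have Y0 g : (0 <= fnorm (Morrey q (wpow w2 q) psi2) g)%E.
  by apply: morrey_norm_ge0 => // E h; exact: wLnorm_ge0.
have mS (f : 'rV[R]_n * R -> R) : measurable_fun (time_dom T) f ->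
    measurable_fun (time_dom T) (in_time (frac_op Omega alpha) f).
  exact: measurable_in_time_frac_op.
split=> [psiC|p_gt1 _ psiC b [lb bfin] [K K0 bC]]; first split.
- move=> p_gt1 bS; have /andP[s_ge1 s_ltp] := s_range.1 p_gt1.
  have [C C0 HC] := morrey_bounded_frac_op n_gt0 alpha_ltn s_ge1 s_ltp q_gt0 q_def mw1 mw2
    w1pos w2pos w12_Apq w2_Apq Omega_Lfun Omega_hom psi1_gt0 psi2_gt0 psiC bS.
  exists C; first exact: C0.
  exact: (time_morrey_lift T_gt0 p0_gt0 (ltW C0) psi_gt0 X0 Y0 mS HC).
- move=> p1 bS; have s_1 := s_range.2 p1; subst p s.
  move: w12_Apq w2_Apq; rewrite !divr1 !wpow1// => w12_A w2_A.
  have q_def1 : q^-1 = 1 - alpha / n%:R by rewrite q_def invr1.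
  have [C C0 HC] := weak_morrey_bounded_frac_op n_gt0 alpha_ltn q_gt0 q_def1 w1_weight w2_weight
    w12_A w2_A Omega_Lfun Omega_hom psi1_gt0 psi2_gt0 psiC bS.
  have X10 g : (0 <= fnorm (Morrey 1 w1 psi1) g)%E.
    by apply: morrey_norm_ge0 => // E h; exact: wLnorm_ge0.
  have Y10 g : (0 <= fnorm (WMorrey q (wpow w2 q) psi2) g)%E.
    by apply: morrey_norm_ge0 => // E h; exact: wWLnorm_ge0.
  exists C; first exact: C0.
  exact: (time_morrey_lift T_gt0 p0_gt0 (ltW C0) psi_gt0 X10 Y10 mS HC).
have /andP[s_ge1 s_ltp] := s_range.1 p_gt1.
have [C C0 HC] := morrey_bounded_commutator n_gt0 alpha_ltn s_ge1 s_ltp q_gt0 q_def mw1 mw2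
  w1pos w2pos w12_Apq w2_Apq Omega_Lfun Omega_hom psi1_gt0 psi2_gt0 psiC lb.
have bge0 := bmo_seminorm_ge0 b.
exists (C * (K + 1)); first by rewrite mulr_gt0// addr_gt0.
have bE : bmo_seminorm b = (fine (bmo_seminorm b))%:E by rewrite fineK// ge0_fin_numE.
rewrite bE -EFinM in bC *.
set B := fine (bmo_seminorm b) in bE bC *.
have B0 : 0 <= B by rewrite -lee_fin -bE.
have CK0 : 0 < C * (K + 1) by rewrite mulr_gt0// addr_gt0.
have mC (f : 'rV[R]_n * R -> R) : measurable_fun (time_dom T) f ->
    measurable_fun (time_dom T) (in_time (commutator b (frac_op Omega alpha)) f).
  exact: measurable_in_time_commutator lb.1 mO.
have CKB0 : 0 <= C * (K + 1) * B by rewrite mulr_ge0// ltW.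
apply: (time_morrey_lift T_gt0 p0_gt0 CKB0 psi_gt0 X0 Y0 mC).
move=> g M mg M0 gM.
apply/lee_addgt0Pr => e e0.
(* The seminorm may vanish, while the bound is available for positive bt only. *)
pose bt := B + e / (C * (K + 1) * M).
have ee0 : 0 < e / (C * (K + 1) * M) by rewrite divr_gt0// mulr_gt0.
have bt0 : 0 < bt by rewrite ltr_wpDl.
have Bbt : B <= bt by rewrite lerDl ltW.
apply: (@le_trans _ _ (C * (K + 1) * bt * M)%:E).
  apply: HC => //; first by rewrite bE lee_fin.
  move=> f fX; have [fY fle] := bC f fX; split => //; apply: (le_trans fle).
  apply: lee_wpmul2r; last by rewrite lee_fin ler_pM2l.
  exact: wLnorm_ge0.
rewrite -EFinD lee_fin le_eqVlt; apply/orP; left; apply/eqP; rewrite /bt.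
by field; rewrite !gt_eqF// addr_gt0.
Qed.
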